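(* Let $K\subset\mathbb{R}^n$ be a convex body with positive volume, let $\mu$ be the uniform probability measure on $K$, and let $\|\cdot\|$ be any norm on $\mathbb{R}^n$. Then for every measurable $S\subset K$ with $0<\mu(S)\le1/2$, $$(\operatorname{diam}K)\,\mu^+(S)\ \ge\ \mu(S)\,G_n(1/\mu(S)),$$ where $G_n$ is defined in the context. Moreover this bound is sharp for every $x=\mu(S)\in(0,1/2]$, every dimension $n$ and every norm: the infimum of $(\operatorname{diam}K)\mu^+(S)/\mu(S)$ over all convex bodies $K\subset\mathbb{R}^n$ and measurable $S\subset K$ with $\mu(S)=x$ equals $G_n(1/x)$.
   Context: A convex body is a closed, bounded convex set. For a norm $\|\cdot\|$, $\operatorname{diam}K=\sup_{a,b\in K}\|a-b\|$, $S_h=\{y:\exists s\in S,\|y-s\|\le h\}$, and $\mu^+(S)=\lim_{h\to0^+}\mu(S_h\setminus S)/h$. The function $G_n$ on $[2,\infty)$: for $n=1$, $x\,G_1(1/x)=1$, i.e. $G_1(1/x)=1/x$. For $n>1$, $G_n(2)=2$, and for every $\gamma>0$, $$x\,G_n(1/x)=\frac{\gamma n}{(1+\gamma)^n-1}\left[\frac{(1+\gamma)^{n-1}\gamma(n-1)}{(1+\gamma)^{n-1}-1}\right]^{1-1/n}\quad\text{where}\quad x=\frac{(1+\gamma)^{n-1}[\gamma(n-1)-1]+1}{[(1+\gamma)^{n-1}-1][(1+\gamma)^n-1]}\in(0,1/2).$$ *)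

(* Defs.v *)
From HB Require Import structures.
From mathcomp Require Import all_boot all_order all_algebra.
From mathcomp Require Import all_classical all_reals all_analysis.
Set Implicit Arguments. Unset Strict Implicit. Unset Printing Implicit Defensive.
Import Order.TTheory GRing.Theory Num.Theory.
Import numFieldNormedType.Exports.
Local Open Scope classical_set_scope.
Local Open Scope ring_scope.

Section Defs.
Variables (R : realType) (n : nat).
Notation V := 'rV[R]_n.

Definition is_norm (N : V -> R) : Prop :=
  [/\ forall x, 0 <= N x,
      forall x, N x = 0 -> x = 0,
      forall (a : R) x, N (a *: x) = `|a| * N x &
      forall x y, N (x + y) <= N x + N y].

Definition box (a b : V) : set V :=
  [set x | forall i : 'I_n, a ord0 i <= x ord0 i <= b ord0 i].
Definition box_vol (a b : V) : R := \prod_(i < n) (b ord0 i - a ord0 i).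

Definition lebesgue_outer (A : set V) : \bar R :=
  ereal_inf [set e : \bar R | exists (a b : nat -> V),
     [/\ forall k (i : 'I_n), a k ord0 i <= b k ord0 i,
         A `<=` \bigcup_k box (a k) (b k) &
         e = (\sum_(0 <= k <oo) (box_vol (a k) (b k))%:E)%E]].

Definition lebesgue_measurable (A : set V) : Prop :=
  forall T : set V,
    lebesgue_outer T = (lebesgue_outer (T `&` A) + lebesgue_outer (T `&` ~` A))%E.

Definition convex_set (K : set V) : Prop :=
  forall x y (t : R), K x -> K y -> 0 <= t <= 1 -> K (t *: x + (1 - t) *: y).
Definition convex_body (K : set V) : Prop :=
  [/\ closed K, bounded_set K & convex_set K].

Definition unif (K : set V) (A : set V) : R :=
  fine (lebesgue_outer (A `&` K)) / fine (lebesgue_outer K).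

Definition diam (N : V -> R) (K : set V) : R :=
  sup [set d : R | exists2 a : V, K a & exists2 b : V, K b & d = N (a - b)].

Definition nbhd_h (N : V -> R) (S : set V) (h : R) : set V :=
  [set y | exists2 s, S s & N (y - s) <= h].

Definition boundary_measure (N : V -> R) (K S : set V) (L : R) : Prop :=
  (fun h => unif K (nbhd_h N S h `\` S) / h) x @[x --> 0^'+] --> L.

End Defs.

Definition Gx (R : realType) (n : nat) (g : R) : R :=
  ((1 + g) ^+ n.-1 * (g * n.-1%:R - 1) + 1) /
  (((1 + g) ^+ n.-1 - 1) * ((1 + g) ^+ n - 1)).
Definition Gval (R : realType) (n : nat) (g : R) : R :=
  (g * n%:R / ((1 + g) ^+ n - 1)) *
  powR ((1 + g) ^+ n.-1 * g * n.-1%:R / ((1 + g) ^+ n.-1 - 1)) (1 - n%:R^-1).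
(* G n y for y in [2, oo) *)
Definition G (R : realType) (n : nat) (y : R) : R :=
  if n == 1%N then y
  else if y == 2 then 2
  else y * Gval n (xget 0 [set g : R | 0 < g /\ Gx n g = y^-1]).

(* Main.v *)
Require Import Defs.
From HB Require Import structures.
From mathcomp Require Import all_boot all_order all_algebra.
From mathcomp Require Import all_classical all_reals all_analysis.
From mathcomp Require Import measurable_realfun.
From mathcomp Require Import ring lra.
Import Order.TTheory GRing.Theory Num.Theory.
Import numFieldNormedType.Exports.
Set Implicit Arguments.
Unset Strict Implicit.
Unset Printing Implicit Defensive.
Local Open Scope classical_set_scope.
Local Open Scope ring_scope.

(** Bisect [K] by hyperplanes rotating about the codimension-two flats
    [x i = c1, x j = c2] of a fine grid, always keeping
    [vol (S /\ K') = x * vol K'].  The final pieces are as thin as we like, hence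
    nearly one-dimensional: only their widest coordinate matters, and by
    Brunn-Minkowski its distribution is [1/n]-concave.  On such a needle the
    density at a point is bounded below by comparison with the tangent affine
    function to its [1/(n-1)]-th power, i.e. with a truncated cone; weighted AM-GM,
    with weights read off the equality case, then gives the constant [G_n].
    Summing the one-dimensional inequalities over the pieces bounds the volume of
    the [h]-neighbourhood of [S].
    Equality is approached by thin truncated cones cut by a hyperplane parallel
    to their bases, with axis along a vector norming a coordinate functional. *)

(** * The extremal constant *)

(** A piece is only nearly one-dimensional: [S] fills the fraction [x] of its volume, but need not
    be a union of slices, and its projection [A] to the axis may carry far more mass. The statement
    on needles therefore speaks of [A] and uses [x] only through one fact: after removing an
    interval free of [A], the remaining slices have mass at least [x]. It returns either a run of
    slices near [A] of mass [x + gain], or gaps off [A] of total mass [gain]; in the second case the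
    volume of [S] itself is added to that of the gaps.

    All pieces keep the same fraction [x], so the gain is the same multiple of each volume and the
    bounds add over a finite dissection. The grid is chosen for each [h], and no limiting needle is
    formed.

    The density bound at a point with mass [p] on its left is [c * min(1, p/x, (1-p)/x)], where
    [c = x * G(1/x)]. Stretches of [A]-free points lying outside the two [x]-quantiles have a weaker
    density, but the two sides together make up [c] to first order in [h].

    All cutting hyperplanes involve two coordinates only, so translations and homotheties are the
    only changes of variables for volumes. *)

Section Profile.
Variable R : realType.
Implicit Types (u v w x z l : R) (m k : nat).

Lemma nth_root_ex k (y : R) : 0 <= y -> exists2 r : R, 0 <= r & r ^+ k.+1 = y.
Proof.
move=> y0; exists (y `^ (k.+1%:R^-1)); first exact: powR_ge0.
by rewrite -powR_mulrn ?powR_ge0// -powRrM mulVf ?powRr1.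
Qed.

Lemma young_monomial m i u z l : 0 <= u -> 0 <= z -> 0 <= l -> (i <= m)%N ->
  m.+1%:R * (u ^+ (m - i) * z ^+ i * l) <=
  (m - i)%:R * u ^+ m.+1 + i%:R * z ^+ m.+1 + l ^+ m.+1.
Proof.
move=> u0 z0 l0 im.
(* AM-GM on [m.+1] numbers: [m - i] copies of [u ^+ m.+1], [i] copies of [z ^+ m.+1] and one
   [l ^+ m.+1]. Their product is the [m.+1]-th power of the monomial. *)
pose E (j : nat) := if (j < m - i)%N then u ^+ m.+1 else
  if (j < m)%N then z ^+ m.+1 else l ^+ m.+1.
have E0 j : 0 <= E j by rewrite /E; do 2?case: ifP => _; apply: exprn_ge0.
have [+ _] := @leif_AGM _ _ [pred _ : 'I_m.+1 | true] (fun j => E j) (fun j _ => E0 j).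
rewrite cardT size_enum_ord.
have -> : \sum_(j < m.+1) E j =
    (m - i)%:R * u ^+ m.+1 + i%:R * z ^+ m.+1 + l ^+ m.+1.
  rewrite big_ord_recr /= /E ltnn ifN -?leqNgt ?leq_subr//; congr (_ + _).
  rewrite -(big_mkord xpredT (fun j => if (j < m - i)%N then _ else
     if (j < m)%N then _ else _)).
  rewrite (big_cat_nat (n := (m - i)%N)) ?leq_subr//=; congr (_ + _).
    rewrite (@eq_big_nat _ _ _ _ _ _ (fun=> u ^+ m.+1)); last by move=> j /andP[_ ->].
    by rewrite big_const_nat subn0 iter_addr addr0 mulr_natl.
  rewrite (@eq_big_nat _ _ _ _ _ _ (fun=> z ^+ m.+1)); last first.
    by move=> j /andP[+ ->]; rewrite leqNgt => /negbTE ->.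
  by rewrite big_const_nat subKn// iter_addr addr0 mulr_natl.
have -> : \prod_(j < m.+1) E j = (u ^+ (m - i) * z ^+ i * l) ^+ m.+1.
  rewrite !exprMn big_ord_recr /= /E ltnn ifN -?leqNgt ?leq_subr//; congr (_ * _).
  rewrite -(big_mkord xpredT (fun j => if (j < m - i)%N then _ else
     if (j < m)%N then _ else _)).
  rewrite (big_cat_nat (n := (m - i)%N)) ?leq_subr//=; congr (_ * _).
    rewrite (@eq_big_nat _ _ _ _ _ _ (fun=> u ^+ m.+1)); last by move=> j /andP[_ ->].
    by rewrite prodr_const_nat subn0 exprAC.
  rewrite (@eq_big_nat _ _ _ _ _ _ (fun=> z ^+ m.+1)); last first.
    by move=> j /andP[+ ->]; rewrite leqNgt => /negbTE ->.
  by rewrite prodr_const_nat subKn// exprAC.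
rewrite ler_pXn2r ?nnegrE//; last 2 first.
- by rewrite !mulr_ge0 ?exprn_ge0.
- by rewrite divr_ge0// !addr_ge0 ?mulr_ge0 ?exprn_ge0.
by rewrite ler_pdivlMr// mulrC.
Qed.

Definition geo k w : R := \sum_(i < k) w ^+ i.
Definition geo1 k w : R := \sum_(i < k) i%:R * w ^+ i.
Definition hom_sum m u v : R := \sum_(i < m.+1) u ^+ (m - i) * v ^+ i.

(* [w] is the ratio of the endpoint widths of the extremal needle for volume
   fraction [x]. *)
Definition extremal_ratio m x w : Prop :=
  geo1 m.+1 w * (1 - x + x * w ^+ m.+1) = m%:R * x * w ^+ m.+1 * geo m.+1 w.

Lemma geo_gt0 m w : 0 <= w -> 0 < geo m.+1 w.
Proof.
move=> w0; rewrite /geo big_ord_recl /= expr0 ltr_wpDr//.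
by apply: sumr_ge0 => i _; exact: exprn_ge0.
Qed.

(** For an affine function with end values [u] and [v], [hom_sum m u v / m.+1] is the mean of its
    [m]-th power, and [(1 - x) * u ^+ m.+1 + x * v ^+ m.+1] is its [m.+1]-th power at the point with
    the fraction [x] of the mass on the side of [u]. Equality holds at [u = 1], [v = w]. *)
Lemma extremal_ratio_le m x w u v : 0 < x < 1 -> 0 < w -> extremal_ratio m x w ->
  0 <= u -> 0 <= v ->
  hom_sum m u v ^+ m.+1 * (1 - x + x * w ^+ m.+1) ^+ m <=
  geo m.+1 w ^+ m.+1 * ((1 - x) * u ^+ m.+1 + x * v ^+ m.+1) ^+ m.
Proof.
move=> /andP[x0 x1] w0 Rel u0 v0.
have [m0|m0] := posnP m.
  by rewrite m0 /hom_sum /geo !big_ord_recl !big_ord0 /= subnn !expr0 !expr1 !addr0 !mulr1.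
set A := 1 - x + _; set B := (1 - x) * _ + _; set s := geo _ _.
have A0 : 0 < A by rewrite addr_gt0// ?subr_gt0// mulr_gt0// exprn_gt0.
have s0 : 0 < s by apply: geo_gt0; exact: ltW.
have B0 : 0 <= B.
  by rewrite addr_ge0// mulr_ge0 ?exprn_ge0 ?subr_ge0 ?(ltW x0) ?(ltW x1).
(* At [u = 1], [v = w] the numbers [u], [v / w] and [l] are all [1], so every use of
   [young_monomial] below is sharp there. *)
have [l l0 lE] : exists2 l : R, 0 <= l & l ^+ m.+1 = B / A.
  by apply: nth_root_ex; rewrite divr_ge0// ltW.
have [le0|lne0] := eqVneq l 0.
  have B00 : B = 0.
    by apply/eqP; have := lE; rewrite le0 expr0n /= => /esym/eqP; rewrite mulf_eq0 invr_eq0 (gt_eqF A0) orbF.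
  have : ((1 - x) * u ^+ m.+1 == 0) && (x * v ^+ m.+1 == 0).
    rewrite -paddr_eq0; first by apply/eqP; exact: B00.
    - by rewrite mulr_ge0 ?exprn_ge0 ?subr_ge0 ?(ltW x1).
    - by rewrite mulr_ge0 ?exprn_ge0 ?(ltW x0).
  rewrite !mulf_eq0 !expf_eq0/= subr_eq0 (gt_eqF x1) (gt_eqF x0) /= => /andP[/eqP-> /eqP->].
  rewrite (_ : hom_sum m 0 0 = 0); last first.
    rewrite /hom_sum big1// => i _; rewrite !expr0n.
    by case: i => -[|i] ilt /=; rewrite ?mulr0// subn0 gtn_eqF// mul0r.
  by rewrite expr0n/= mul0r mulr_ge0 ?exprn_ge0// ltW.
have lp : 0 < l by rewrite lt_def lne0.
have key : m.+1%:R * l * hom_sum m u v <= m.+1%:R * s * l ^+ m.+1.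
  pose z := v / w.
  have z0 : 0 <= z by rewrite divr_ge0// ltW.
  have vE : v = w * z by rewrite /z mulrC divfK// gt_eqF.
  have step : m.+1%:R * l * hom_sum m u v <=
      (m%:R * s - geo1 m.+1 w) * u ^+ m.+1 + geo1 m.+1 w * z ^+ m.+1 + s * l ^+ m.+1.
    rewrite /s /geo /geo1 /hom_sum !mulr_sumr -sumrB !mulr_suml -!big_split /=.
    apply: ler_sum => i _.
    have im : (i <= m)%N by rewrite -ltnS.
    have := young_monomial u0 z0 l0 im; rewrite natrB// => yg.
    rewrite vE exprMn.
    have := ler_wpM2l (exprn_ge0 i (ltW w0)) yg; lra.
  apply: le_trans step _.
  (* The relation defining [extremal_ratio] is what turns the two AM-GM coefficients into the
     weights [1 - x] and [x] of [B]. *)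
  have : A * ((m%:R * s - geo1 m.+1 w) * u ^+ m.+1 + geo1 m.+1 w * z ^+ m.+1) = m%:R * s * B.
    have wz : w ^+ m.+1 * z ^+ m.+1 = v ^+ m.+1 by rewrite -exprMn -vE.
    have Rel' : geo1 m.+1 w * A = m%:R * x * w ^+ m.+1 * s := Rel.
    transitivity (m%:R * s * A * u ^+ m.+1 - (geo1 m.+1 w * A) * u ^+ m.+1 + (geo1 m.+1 w * A) * z ^+ m.+1); first by ring.
    by rewrite Rel' /B -wz /A; ring.
  have -> : m%:R * s * B = A * (m%:R * s * l ^+ m.+1).
    by rewrite lE; field; rewrite gt_eqF.
  move/(mulfI (lt0r_neq0 A0)) => ->; rewrite -natr1; lra.
have {}key : hom_sum m u v <= s * l ^+ m.
  have : m.+1%:R * l * hom_sum m u v <= m.+1%:R * l * (s * l ^+ m).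
    by apply: le_trans key _; rewrite exprS le_eqVlt; apply/orP; left; apply/eqP; ring.
  by rewrite ler_pM2l// mulr_gt0.
have H0 : 0 <= hom_sum m u v.
  by apply: sumr_ge0 => i _; rewrite mulr_ge0 ?exprn_ge0.
apply: (@le_trans _ _ ((s * l ^+ m) ^+ m.+1 * A ^+ m)).
  by rewrite ler_wpM2r ?exprn_ge0 ?(ltW A0)// lerXn2r ?nnegrE// (le_trans H0).
by rewrite exprMn exprAC lE -mulrA -exprMn divfK ?gt_eqF.
Qed.

Lemma geoE k w : (w - 1) * geo k w = w ^+ k - 1.
Proof. by rewrite subrX1. Qed.

Lemma geo1E m w : (w - 1) ^+ 2 * geo1 m.+1 w = (w - 1) * m%:R * w ^+ m.+1 - (w ^+ m.+1 - w).
Proof.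
elim: m => [|m IH].
  by rewrite /geo1 big_ord_recl big_ord0 /= !(mul0r, addr0, mulr0, expr1, subrr).
rewrite /geo1 big_ord_recr /= mulrDr -/(geo1 _ _) IH -natr1 !exprS; ring.
Qed.

Lemma geo2E m w :
  (w - 1) ^+ 2 * \sum_(i < m) i.+1%:R * w ^+ i = w ^+ m * ((w - 1) * m%:R - 1) + 1.
Proof.
elim: m => [|m IH]; first by rewrite big_ord0 expr0 mulr0 mul1r mulr0 add0r addNr.
rewrite big_ord_recr /= mulrDr IH (exprS w) -natr1; ring.
Qed.

(** Cancelling [g ^+ 2] and putting [w = 1 + g], [Gx] becomes the quotient of [\sum i.+1 * w ^ i] by
    [geo m.+1 w * geo m w], with value [1/2] at [w = 1]. The polynomial [p] clears denominators: it
    is negative at [1] because [x < 1/2], and nonnegative at [m / x]. *)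
Lemma Gx_surj m x : (0 < m)%N -> 0 < x < 2^-1 ->
  exists2 g : R, 0 < g & Gx m.+1 g = x.
Proof.
move=> m0 /andP[x0 x12].
pose p : {poly R} := x *: ((\poly_(i < m.+1) 1) * (\poly_(i < m) 1)) - \poly_(i < m) i.+1%:R.
have pE w : p.[w] = x * (geo m.+1 w * geo m w) - \sum_(i < m) i.+1%:R * w ^+ i.
  rewrite hornerD hornerN hornerZ hornerM !horner_poly /geo.
  by do ?[congr (_ - _) | congr (_ * _)]; apply: eq_bigr => i _; rewrite mul1r.
have mp : 0 < m%:R :> R by rewrite ltr0n.
have p1 : p.[1] < 0.
  rewrite pE /geo.
  have E k : \sum_(i < k) (1 : R) ^+ i = k%:R.
    by under eq_bigr do rewrite expr1n; rewrite sumr_const card_ord.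
  rewrite !E.
  have -> : \sum_(i < m) i.+1%:R * (1 : R) ^+ i = m.+1%:R * m%:R / 2.
    elim: (m) => [|k IH]; first by rewrite big_ord0; ring.
    by rewrite big_ord_recr/= IH expr1n -!natr1; field.
  have : 0 < m.+1%:R * m%:R :> R by rewrite mulr_gt0.
  nra.
have mx1 : 1 <= m%:R / x.
  rewrite ler_pdivlMr// mul1r; apply: (@le_trans _ _ 1); first by lra.
  by rewrite ler1n.
have p2 : 0 <= p.[m%:R / x].
  rewrite pE; set w := m%:R / x.
  have w0 : 0 <= w by apply: le_trans mx1.
  have sm0 : 0 <= geo m w by apply: sumr_ge0 => i _; exact: exprn_ge0.
  have gw : w <= geo m.+1 w.
    rewrite /geo; case: (m) m0 => // k _; rewrite 2!big_ord_recl /= expr1.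
    rewrite -[leLHS]add0r lerD// lerDl.
    by apply: sumr_ge0 => i _; exact: exprn_ge0.
  have le1 : \sum_(i < m) i.+1%:R * w ^+ i <= m%:R * geo m w.
    by rewrite mulr_sumr; apply: ler_sum => i _; rewrite ler_wpM2r ?exprn_ge0// ler_nat.
  rewrite subr_ge0 (le_trans le1)// mulrA ler_wpM2r//.
  have -> : m%:R = x * w by rewrite /w mulrC divfK// gt_eqF.
  by rewrite ler_wpM2l// ltW.
have [|w /andP[w1 _] /rootP pw] := poly_ivt (p := p) mx1; first by rewrite (ltW p1) p2.
have {}w1 : 1 < w.
  by rewrite lt_neqAle w1 andbT; apply/eqP => w1'; move: p1; rewrite w1' pw ltxx.
exists (w - 1); first by rewrite subr_gt0.
rewrite /Gx (_ : 1 + (w - 1) = w) /=; last by ring.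
rewrite -geo2E -!geoE.
have g1 : 0 < geo m.+1 w by apply: geo_gt0; lra.
have g2 : 0 < geo m w by case: (m) m0 => // k _; apply: geo_gt0; lra.
move: pw; rewrite pE => /eqP; rewrite subr_eq0 => /eqP <-.
by field; rewrite !gt_eqF// subr_gt0.
Qed.

(** Passes from the parameter [g] to the ratio [w = 1 + g]; the second conclusion identifies the
    base of the real power in [Gval]. *)
Lemma Gx_extremal m x g : 0 < x -> 0 < g -> (0 < m)%N -> Gx m.+1 g = x ->
  extremal_ratio m x (1 + g) /\
  1 - x + x * (1 + g) ^+ m.+1 = (1 + g) ^+ m * g * m%:R / ((1 + g) ^+ m - 1).
Proof.
move=> x0 g0 m0; rewrite /Gx /=.
have w1 : 1 < 1 + g by lra.
have E1 : (1 + g) ^+ m != 1 by rewrite gt_eqF// exprn_egt1// -lt0n.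
have E2 : (1 + g) ^+ m.+1 != 1 by rewrite gt_eqF// exprn_egt1.
move: E1 E2; rewrite exprS; set E := (1 + g) ^+ m => E1 E2.
have wE : (1 + g) * E - 1 != 0 by rewrite subr_eq0.
have E10 : E - 1 != 0 by rewrite subr_eq0.
move=> xE.
have key : 1 - x + x * ((1 + g) * E) = E * g * m%:R / (E - 1).
  by rewrite -xE; field; rewrite E10 wE.
split => //; rewrite /extremal_ratio exprS -/E key.
have gg : g ^+ 2 != 0 by rewrite expf_neq0// gt_eqF.
apply: (mulfI gg).
have -> : g ^+ 2 * (geo1 m.+1 (1 + g) * (E * g * m%:R / (E - 1))) =
  ((1 + g - 1) ^+ 2 * geo1 m.+1 (1 + g)) * (E * g * m%:R / (E - 1)) by ring.
have -> : g ^+ 2 * (m%:R * x * ((1 + g) * E) * geo m.+1 (1 + g)) =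
  g * (m%:R * x * ((1 + g) * E)) * ((1 + g - 1) * geo m.+1 (1 + g)) by ring.
by rewrite geo1E geoE -xE exprS -/E; field; rewrite E10 wE.
Qed.

(** A form of [G] without real powers that covers all three clauses of its definition. In the
    clauses [n = 1] and [x = 1/2] the ratio is [w = 1]: the extremal needle is a cylinder. *)
Lemma G_extremal m x : 0 < x <= 2^-1 ->
  exists w : R, [/\ 1 <= w, extremal_ratio m x w, 0 < x * G m.+1 x^-1 &
    (x * G m.+1 x^-1) ^+ m.+1 * geo m.+1 w ^+ m.+1 =
    m.+1%:R ^+ m.+1 * (1 - x + x * w ^+ m.+1) ^+ m].
Proof.
move=> /andP[x0 x12]; rewrite /G.
case: eqP => [[->]|m0].
  exists 1; split => //.
  - by rewrite /extremal_ratio /geo1 big_ord_recl big_ord0 /= !(mul0r, addr0).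
  - by rewrite divff ?gt_eqF.
  - rewrite divff ?gt_eqF// /geo big_ord_recl big_ord0 /= !expr0 !expr1 addr0 mulr1 //.
have {}m0 : (0 < m)%N by rewrite lt0n; apply/eqP => m00; apply: m0; rewrite m00.
have geo11 k : geo k 1 = k%:R :> R.
  by rewrite /geo; under eq_bigr do rewrite expr1n; rewrite sumr_const card_ord.
case: eqP => [x2|x2].
  have -> : x = 2^-1 by rewrite -x2 invrK.
  exists 1; split => //.
  - rewrite /extremal_ratio !expr1n geo11 /geo1.
    have -> : \sum_(i < m.+1) i%:R * (1 : R) ^+ i = m.+1%:R * m%:R / 2.
      elim: (m) => [|k IH]; first by rewrite big_ord_recl big_ord0 /= !(mul0r, mulr0, addr0).
      by rewrite big_ord_recr/= IH expr1n -!natr1; field.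
    by field.
  - by rewrite mulVf ?pnatr_eq0// !expr1n geo11 mul1r mulr1 subrK expr1n mulr1.
have {}x12 : x < 2^-1.
  by rewrite lt_neqAle x12 andbT; apply/eqP => xE; apply: x2; rewrite xE invrK.
have x0' : 0 < x < 2^-1 by rewrite x0.
have [g1 g10 g1E] := Gx_surj m0 x0'.
set g := xget _ _.
have [g0 gE] : 0 < g /\ Gx m.+1 g = x.
  have : [set g : R | 0 < g /\ Gx m.+1 g = (x^-1)^-1] g.
    by apply: xgetPex; exists g1; split => //; rewrite invrK.
  by move=> [? ->]; rewrite invrK.
have [Rel AE] := Gx_extremal x0 g0 m0 gE.
exists (1 + g); split => //.
- by rewrite lerDl ltW.
- rewrite mulrA divff ?gt_eqF// mul1r /Gval /= mulr_gt0//.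
    by rewrite divr_gt0 ?mulr_gt0// subr_gt0 exprn_egt1// ltrDl.
  rewrite powR_gt0// divr_gt0 ?mulr_gt0 ?exprn_gt0 ?ltr0n//; first by lra.
  by rewrite subr_gt0 exprn_egt1 ?ltrDl// -lt0n.
- rewrite mulrA divff ?gt_eqF// mul1r /Gval /= -AE.
  set A := 1 - x + _.
  have A0 : 0 < A.
    by rewrite addr_gt0 ?subr_gt0 ?mulr_gt0 ?exprn_gt0//; lra.
  have pE : (A `^ (1 - m.+1%:R^-1)) ^+ m.+1 = A ^+ m.
    rewrite -powR_mulrn ?powR_ge0// -powRrM -powR_mulrn ?ltW//; congr (_ `^ _).
    by rewrite mulrBl mulVf// mul1r -natr1 addrK.
  rewrite exprMn pE mulrAC; congr (_ * _).
  rewrite -exprMn; congr (_ ^+ _).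
  have := geoE m.+1 (1 + g); rewrite (_ : 1 + g - 1 = g); last by ring.
  move=> <-; field; rewrite !gt_eqF//.
  by apply: geo_gt0; lra.
Qed.

End Profile.

(** * Lebesgue outer measure *)

Section BoxCover.
Variable R : realType.

(* Induction on the dimension: integrating the bound for the slices in the last
   coordinate replaces the usual compactness argument. *)
Lemma prod_le_cover n (a b : nat -> R) (A B : nat -> nat -> R) (P : nat -> bool) :
  (forall i, (i < n)%N -> a i <= b i) ->
  (forall k i, (i < n)%N -> A k i <= B k i) ->
  (forall x : nat -> R, (forall i, (i < n)%N -> a i < x i < b i) ->
     exists2 k, P k & forall i, (i < n)%N -> A k i <= x i <= B k i) ->
  ((\prod_(i < n) (b i - a i))%:E <=
   \sum_(0 <= k <oo) (if P k then \prod_(i < n) (B k i - A k i) else 0)%:E)%E.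
Proof.
elim: n P => [|n IH] P ab AB cov.
  have [k Pk _] := cov (fun=> 0) (fun i => ltac:(by [])).
  have := @nneseries_lim_ge R (fun k => (if P k then \prod_(i < 0) (B k i - A k i) else 0)%:E) xpredT 0 k.+1.
  move=> H; apply: le_trans (H _); last first.
    by move=> j _ _; rewrite lee_fin; case: ifP => // _; rewrite big_ord0.
  rewrite big_nat_recr//= Pk !big_ord0 leeDr//; apply: sume_ge0 => j _.
  by rewrite lee_fin; case: ifP => // _; rewrite big_ord0.
pose c k : R := if P k then \prod_(i < n) (B k i - A k i) else 0.
have c0 k : 0 <= c k.
  rewrite /c; case: ifP => // _; apply: prodr_ge0 => i _.
  by rewrite subr_ge0 AB// ltnS ltnW.
pose I k : set (measurableTypeR R) := `[A k n, B k n]%classic.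
pose D : set (measurableTypeR R) := `]a n, b n[%classic.
have mI k : R.-ocitv.-measurable.-sigma.-measurable (I k) by exact: measurable_itv.
have mD : R.-ocitv.-measurable.-sigma.-measurable D by exact: measurable_itv.
pose f k (t : measurableTypeR R) : \bar R := ((c k)%:E * (\1_(I k) t)%:E)%E.
have f0 k t : (0 <= f k t)%E by rewrite mule_ge0// lee_fin.
have m1 k : measurable_fun D (EFin \o (\1_(I k) : measurableTypeR R -> R)).
  by apply/measurable_EFinP; exact: measurable_indic.
have mf k : measurable_fun D (f k) by exact: (measurable_funeM (c k)%:E (m1 k)).
have abn : a n <= b n by rewrite ab.
have muD : lebesgue_measure D = (b n - a n)%:E.
  rewrite lebesgue_measure_itv/= lte_fin.
  case: ltP => // ba; rewrite (_ : b n = a n) ?subrr//; first by apply/eqP; rewrite eq_le ba abn.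
set p := \prod_(i < n) (b i - a i).
(* At height [t] only the boxes whose last side contains [t] matter; [P] is there to carry this
   selection through the induction. *)
have slice t : D t -> (p%:E <= \sum_(0 <= k <oo) f k t)%E.
  rewrite /D /= in_itv /= => tD.
  apply: le_trans (IH (fun k => P k && (A k n <= t <= B k n)) _ _ _) _.
  - by move=> i ni; apply: ab; rewrite ltnS ltnW.
  - by move=> k i ni; apply: AB; rewrite ltnS ltnW.
  - move=> x xab.
    have [|k Pk xk] := cov (fun i => if i == n then t else x i).
      move=> i; rewrite ltnS leq_eqVlt; case: eqP => [->//|_ /= ni]; exact: xab.
    exists k.
      by rewrite Pk; have := xk n (leqnn _); rewrite eqxx.
    move=> i ni; have := xk i; rewrite ltn_eqF//; apply; exact: ltnW.
  - apply: lee_nneseries => k _.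
      move=> _; rewrite lee_fin; case: ifP => // _; apply: prodr_ge0 => i _.
      by rewrite subr_ge0 AB// ltnS ltnW.
    rewrite /f /c -EFinM lee_fin indicE.
    case: ifPn => [/andP[Pk tk]|_]; last by rewrite mulr_ge0 ?ler0n//; exact: c0.
    rewrite Pk.
    by rewrite (_ : t \in I k) ?mulr1//; apply/mem_set; rewrite /I /= in_itv.
have : (\int[lebesgue_measure]_(t in D) cst p%:E t <=
        \int[lebesgue_measure]_(t in D) \sum_(0 <= k <oo) f k t)%E.
  apply: ge0_le_integral => //.
  - move=> t _; rewrite lee_fin; apply: prodr_ge0 => i _.
    by rewrite subr_ge0 ab// ltnS ltnW.
  - apply: (@ge0_emeasurable_sum _ _ _ D f xpredT) => [k t _ _|k _]; [exact: f0|exact: mf].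
rewrite integral_cst// (_ : (p%:E * _ = p%:E * (b n - a n)%:E)%E); last by congr (_ * _)%E; exact: muD.
rewrite integral_nneseries// big_ord_recr /= -/p -EFinM.
move=> /le_trans; apply; apply: lee_nneseries => k _.
  by move=> _; apply: integral_ge0 => t _; exact: f0.
rewrite (ge0_integralZl_EFin lebesgue_measure mD _ (m1 k) (c0 k)); last first.
  by move=> t _; rewrite lee_fin indicE ler0n.
rewrite integral_indic//.
apply: (@le_trans _ _ ((c k)%:E * lebesgue_measure (I k))%E).
  apply: lee_wpmul2l; first by rewrite lee_fin.
  apply: le_measure; [apply: mem_set; exact: (measurableI _ _ (mI k) mD)|apply: mem_set; exact: (mI k)|exact: subIsetl].
rewrite lebesgue_measure_itv/= lte_fin /c.
have ABk : A k n <= B k n by rewrite AB.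
case: (P k); last by rewrite mul0e.
rewrite big_ord_recr/=; case: ltP => [_|BA]; first by rewrite -EFinM.
rewrite mule0 lee_fin mulr_ge0 ?subr_ge0//; apply: prodr_ge0 => i _.
by rewrite subr_ge0 AB// ltnS ltnW.
Qed.

End BoxCover.

(** * Subadditivity of the box outer measure *)

Section LebesgueOuter.
Variables (R : realType) (m : nat).
Local Notation n := m.+1.
Local Notation V := 'rV[R]_n.
Local Notation lam := (@lebesgue_outer R n).
Implicit Types (A B T : set V) (a b : nat -> V).

Lemma box_vol_ge0 (a b : V) : (forall i, a ord0 i <= b ord0 i) -> 0 <= box_vol a b.
Proof. by move=> ab; apply: prodr_ge0 => i _; rewrite subr_ge0. Qed.

Lemma lam_le_cover A a b : (forall k i, a k ord0 i <= b k ord0 i) ->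
  A `<=` \bigcup_k box (a k) (b k) ->
  (lam A <= \sum_(0 <= k <oo) (box_vol (a k) (b k))%:E)%E.
Proof. by move=> ab Ac; apply: ereal_inf_lbound; exists a, b. Qed.

Lemma lam_ge0 A : (0 <= lam A)%E.
Proof.
apply: le_ereal_inf_tmp => _ [a [b [ab _ ->]]].
by apply: nneseries_ge0 => k _ _; rewrite lee_fin box_vol_ge0.
Qed.

Lemma box_vol_diag (a : V) : box_vol a a = 0.
Proof. by rewrite /box_vol big_ord_recl subrr mul0r. Qed.

Lemma lam0 : lam set0 = 0%E.
Proof.
apply/eqP; rewrite eq_le lam_ge0 andbT.
have := @lam_le_cover set0 (fun=> 0) (fun=> 0) (fun _ _ => lexx _) (sub0set _).
by rewrite box_vol_diag eseries0.
Qed.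

Lemma le_lam : {homo lam : A B / A `<=` B >-> (A <= B)%E}.
Proof.
move=> A B AB; apply: le_ereal_inf_tmp => _ [a [b [ab Bc ->]]].
by apply: lam_le_cover => //; exact: subset_trans Bc.
Qed.

Lemma lam_sigma_subadditive : sigma_subadditive lam.
Proof.
move=> A; have [[i ioo]|] := pselect (exists i, lam (A i) = +oo%E).
  rewrite (eseries_pinfty _ _ ioo) ?leey// => k _.
  by rewrite -ltNye (lt_le_trans _ (lam_ge0 _)).
rewrite -forallNE => Aoo.
suff add2e (e : {posnum R}) :
    (lam (\bigcup_n A n) <= \sum_(i <oo) lam (A i) + e%:num%:E)%E.
  by apply/lee_addgt0Pr => _/posnumP[].
rewrite (le_trans _ (epsilon_trick _ _ _))//; last first.
  by move=> k; exact: lam_ge0.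
pose P k (B : nat -> V * V) := [/\ forall j i, (B j).1 ord0 i <= (B j).2 ord0 i,
   A k `<=` \bigcup_j box (B j).1 (B j).2 &
  (\sum_(j <oo) (box_vol (B j).1 (B j).2)%:E <= lam (A k) + (e%:num / (2 ^ k.+1)%:R)%:E)%E].
have [G PG] : {G : nat -> nat -> V * V & forall k, P k (G k)}.
  apply: (@choice _ _ P) => k; rewrite /P.
  have fA : lam (A k) \is a fin_num.
    by rewrite ge0_fin_numE ?lam_ge0// ltey; apply/eqP; exact: Aoo.
  have en1 : 0 < e%:num / (2 ^ k.+1)%:R by [].
  have [x [a [b [ab Ac ->]]] xS] := lb_ereal_inf_adherent en1 fA.
  by exists (fun j => (a j, b j)); split => //=; exact: ltW.
pose w (q : nat * nat) : \bar R := (box_vol (G q.1 q.2).1 (G q.1 q.2).2)%:E.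
have w0 q : (0 <= w q)%E.
  by rewrite lee_fin box_vol_ge0//; have [] := PG q.1.
apply: (@le_trans _ _ (\esum_(i in setT) w i)).
  have /card_esym/ppcard_eqP[f] := card_nat2.
  apply: le_trans.
    apply: (@lam_le_cover _ (fun k => (G (f k).1 (f k).2).1) (fun k => (G (f k).1 (f k).2).2)).
      by move=> k i; have [] := PG (f k).1.
    move=> t [k _ At]; have [_ + _] := PG k => /(_ t At)[j _ tj].
    by exists (f^-1%FUN (k, j)) => //=; rewrite invK ?inE.
  rewrite le_eqVlt; apply/orP; left; apply/eqP.
  rewrite -(esum_pred_image w f xpredT) ?[fun=> _]set_true//.
  by rewrite image_eq.
rewrite (_ : esum _ _ = (\sum_(i <oo) \sum_(j <oo ) w (i, j))%E); last first.
  pose J : nat -> set (nat * nat) := fun i => [set (i, j) | j in setT].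
  rewrite (_ : setT = \bigcup_k J k); last first.
    by rewrite predeqE => -[a b]; split => // _; exists a => //; exists b.
  rewrite esum_bigcupT //=; last first.
    apply/trivIsetP => i j _ _ ij.
    rewrite predeqE => -[k l] /=; split => //= -[] [_] _ [<-{k} _].
    by move=> [l' _] [] /esym/eqP; rewrite (negbTE ij).
  rewrite -(image_id [set: nat]) -fun_true esum_pred_image//; last first.
    by move=> k _; exact: esum_ge0.
  apply: eq_eseriesr => /= j _.
  rewrite -(esum_pred_image w (pair j) predT)//=; last by move=> ? ? _ _ [].
  by congr esum; rewrite predeqE => -[a b]; split; move=> [i _ <-]; exists i.
apply: lee_nneseries => k _ /=; first by move=> _; apply: nneseries_ge0.
by have [] := PG k.
Qed.

End LebesgueOuter.

(** [lebesgue_measurable] is Caratheodory measurability for this outer measure, so the closure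
    properties of Caratheodory sets apply to it directly. *)
HB.instance Definition _ (R : realType) (m : nat) :=
  isOuterMeasure.Build R 'rV[R]_m.+1 (@lebesgue_outer R m.+1)
    (@lam0 R m) (@lam_ge0 R m) (@le_lam R m) (@lam_sigma_subadditive R m).

(** * Measurable half-spaces, similarities, volume of bounded sets *)

Section Volume.
Variables (R : realType) (m : nat).
Local Notation n := m.+1.
Local Notation V := 'rV[R]_n.
Local Notation lam := (@lebesgue_outer R n).
Implicit Types (A B T : set V) (a b v x : V) (i j : 'I_n) (c e M r : R).

Lemma coord_le_norm v i : `|v ord0 i| <= `|v|.
Proof.
by rewrite [leRHS]/Num.norm /= mx_normrE; apply/bigmax_geP; right; exists (ord0, i).
Qed.

Lemma lam_box_le a b : (forall i, a ord0 i <= b ord0 i) ->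
  (lam (box a b) <= (box_vol a b)%:E)%E.
Proof.
move=> ab.
apply: le_trans (@lam_le_cover R m _ (fun k => if k is 0%N then a else 0)
  (fun k => if k is 0%N then b else 0) _ _) _.
- by case.
- by move=> x bx; exists 0%N.
- rewrite nneseries_recl//; last by case => // *; rewrite lee_fin box_vol_ge0.
  by rewrite eseries_cond/= eseries0 ?adde0// => -[|]//= k _ _; rewrite box_vol_diag.
Qed.

Definition open_box a b : set V := [set x | forall i, a ord0 i < x ord0 i < b ord0 i].

Lemma lam_open_box_ge a b : (forall i, a ord0 i <= b ord0 i) ->
  ((box_vol a b)%:E <= lam (open_box a b))%E.
Proof.
move=> ab; apply: le_ereal_inf_tmp => _ [A [B [AB cov ->]]].
pose f (x : V) (k : nat) := x ord0 (inord k).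
have fE (x y : V) : box_vol x y = \prod_(k < n) (f y k - f x k).
  by apply: eq_bigr => i _; rewrite /f inord_val.
have := @prod_le_cover R n (f a) (f b) (fun k => f (A k)) (fun k => f (B k)) xpredT.
rewrite -fE => H; apply: le_trans (H _ _ _) _ => {H}.
- by move=> i _; exact: ab.
- by move=> k i _; exact: AB.
- move=> x xab; have [i|k _ xk] := cov (\row_(i < n) x i).
    by rewrite mxE; have := xab i (ltn_ord i); rewrite /f inord_val.
  by exists k => // i ni; have := xk (inord i); rewrite mxE inordK.
- by rewrite le_eqVlt; apply/orP; left; apply/eqP; apply: eq_eseriesr => k _; rewrite -fE.
Qed.

Definition upd a i c : V := \row_j (if j == i then c else a ord0 j).

Lemma box_vol_upd a b i c : box_vol a (upd b i c) + box_vol (upd a i c) b = box_vol a b.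
Proof.
have E (x y : V) : box_vol x y =
    (y ord0 i - x ord0 i) * \prod_(j < n | j != i) (y ord0 j - x ord0 j).
  by rewrite /box_vol (bigD1 i).
rewrite !E !mxE eqxx.
rewrite (eq_bigr (fun j => b ord0 j - a ord0 j)); last by move=> j /negbTE ji; rewrite mxE ji.
rewrite [X in _ + _ * X](eq_bigr (fun j => b ord0 j - a ord0 j)); last by move=> j /negbTE ji; rewrite mxE ji.
by rewrite -mulrDl addrC addrA subrK.
Qed.

(** Cutting each box of a cover at level [c] yields covers of both parts, and the volumes of the two
    halves add up to that of the box. *)
Lemma lt_coord_meas i c : lebesgue_measurable [set x : V | x ord0 i < c].
Proof.
apply: (@le_caratheodory_measurable R V lam) => X.
apply: le_ereal_inf_tmp => _ [a [b [ab Xc ->]]].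
(* The level [c] clamped to the [i]-th side of the box, so that both halves are boxes, possibly
   flat. *)
pose e k := Num.max (a k ord0 i) (Num.min (b k ord0 i) c).
have ae k : a k ord0 i <= e k by rewrite le_max lexx.
have eb k : e k <= b k ord0 i by rewrite ge_max ab ge_min lexx.
have le1 k j : a k ord0 j <= upd (b k) i (e k) ord0 j.
  by rewrite mxE; case: eqP => [->|].
have le2 k j : upd (a k) i (e k) ord0 j <= b k ord0 j.
  by rewrite mxE; case: eqP => [->|].
have c1 : X `&` [set x | x ord0 i < c] `<=` \bigcup_k box (a k) (upd (b k) i (e k)).
  move=> x [/Xc [k _ xk] /= xc]; exists k => // j; have := xk j; rewrite mxE.
  case: eqP => // -> /andP[-> xb] /=.
  by rewrite /e le_max le_min xb (ltW xc) orbT.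
have c2 : X `&` ~` [set x | x ord0 i < c] `<=` \bigcup_k box (upd (a k) i (e k)) (b k).
  move=> x [/Xc [k _ xk] /negP]; rewrite -leNgt => xc.
  exists k => // j; have := xk j; rewrite mxE.
  case: eqP => // -> /andP[ax ->]; rewrite andbT.
  by rewrite /e ge_max ax ge_min xc orbT.
apply: le_trans (leeD (lam_le_cover le1 c1) (lam_le_cover le2 c2)) _.
rewrite -nneseriesD.
- rewrite le_eqVlt; apply/orP; left; apply/eqP; apply: eq_eseriesr => k _.
  by rewrite -EFinD box_vol_upd.
- by move=> k _ _; rewrite lee_fin box_vol_ge0.
- by move=> k _ _; rewrite lee_fin box_vol_ge0.
Qed.

Lemma measC A : lebesgue_measurable A -> lebesgue_measurable (~` A).
Proof. exact: (@caratheodory_measurable_setC R V lam). Qed.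
Lemma measI A B : lebesgue_measurable A -> lebesgue_measurable B ->
  lebesgue_measurable (A `&` B).
Proof. exact: (@caratheodory_measurable_setI R V lam). Qed.
Lemma meas_bigcup (A : nat -> set V) : (forall k, lebesgue_measurable (A k)) ->
  lebesgue_measurable (\bigcup_k A k).
Proof. exact: (@caratheodory_measurable_bigcup R V lam). Qed.
Lemma meas0 : lebesgue_measurable (set0 : set V).
Proof. exact: (@caratheodory_measurable_set0 R V lam). Qed.

Lemma le_coord_meas i c : lebesgue_measurable [set x : V | x ord0 i <= c].
Proof.
rewrite (_ : mkset _ = ~` \bigcup_k ~` [set x : V | x ord0 i < c + k.+1%:R^-1]).
  by apply: measC; apply: meas_bigcup => k; apply: measC; exact: lt_coord_meas.
apply/seteqP; split => x /=.
  by move=> xc [k _] /=; apply; rewrite (le_lt_trans xc)// ltrDl invr_gt0.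
move=> H; apply/ler_addgt0Pl => e e0; rewrite addrC.
have [k ke] : exists k : nat, k.+1%:R^-1 < e.
  by have /ltr_add_invr[k] := e0; rewrite add0r; exists k.
apply: contrapT => /negP; rewrite -ltNge => xe; apply: H; exists k => //= xk.
by have := lt_trans xe xk; rewrite ltrD2l ltNge ltW.
Qed.

Lemma lt_scaled_coord_meas i (al c : R) : lebesgue_measurable [set x : V | al * x ord0 i < c].
Proof.
have [->|al0] := eqVneq al 0.
  have [c0|c0] := ltP 0 c.
    rewrite (_ : mkset _ = ~` set0); first exact/measC/meas0.
    by apply/seteqP; split => x /=; [move=> _ []|rewrite mul0r].
  rewrite (_ : mkset _ = set0); first exact: meas0.
  by apply/seteqP; split => x /=; [rewrite mul0r ltNge c0|].
have [alp|aln] := ltP 0 al.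
  rewrite (_ : mkset _ = [set x : V | x ord0 i < c / al]); first exact: lt_coord_meas.
  by apply/seteqP; split => x /=; rewrite ltr_pdivlMr// mulrC.
have {}aln : al < 0 by rewrite lt_neqAle al0.
rewrite (_ : mkset _ = ~` [set x : V | x ord0 i <= c / al]); first exact/measC/le_coord_meas.
apply/seteqP; split => x /=.
  by rewrite mulrC -ltr_ndivrMr// => xc; apply/negP; rewrite -ltNge.
by move/negP; rewrite -ltNge ltr_ndivrMr// mulrC.
Qed.

(** A hyperplane containing a flat [x i = c1, x j = c2] has such a form as its equation. *)
Definition lf i j (al be : R) x : R := al * x ord0 i + be * x ord0 j.

(** The inequality [a + b < c] holds exactly when some rational [q] satisfies [a < q] and
    [b < c - q]: an oblique half-space is a countable union of intersections of coordinate
    half-spaces. *)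
Lemma lt_lf_meas i j al be c : lebesgue_measurable [set x : V | lf i j al be x < c].
Proof.
pose q (k : nat) : R := ratr (odflt 0 (unpickle k)).
rewrite (_ : mkset _ = \bigcup_k ([set x : V | al * x ord0 i < q k] `&`
   [set x | be * x ord0 j < c - q k])).
  by apply: meas_bigcup => k; apply: measI; exact: lt_scaled_coord_meas.
apply/seteqP; split => x /=; last first.
  by move=> [k _ [/= h1 h2]]; rewrite /lf; lra.
rewrite /lf => h.
have [r] : exists r : rat, al * x ord0 i < ratr r < c - be * x ord0 j.
  have h' : al * x ord0 i < c - be * x ord0 j by lra.
  by have [r rin] := rat_in_itvoo h'; exists r; rewrite in_itv in rin.
move=> /andP[h1 h2]; exists (pickle r) => //=; rewrite /q pickleK /=; split => //; lra.
Qed.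

Lemma le_lf_meas i j al be c : lebesgue_measurable [set x : V | lf i j al be x <= c].
Proof.
rewrite (_ : mkset _ = ~` [set x : V | lf i j (- al) (- be) x < - c]).
  exact/measC/lt_lf_meas.
apply/seteqP; split => x /=; rewrite /lf; first by move=> h; apply/negP; rewrite -leNgt; lra.
by move/negP; rewrite -leNgt; lra.
Qed.

Lemma box_volZ r a b : box_vol (r *: a) (r *: b) = r ^+ n * box_vol a b.
Proof.
rewrite /box_vol -[X in r ^+ X]card_ord -prodr_const -big_split /=.
by apply: eq_bigr => i _; rewrite !mxE mulrBr.
Qed.

Lemma lam_scale_le r v A : 0 < r ->
  (lam [set x | A (r^-1 *: (x - v))] <= (r ^+ n)%:E * lam A)%E.
Proof.
move=> r0; rewrite -ereal_inf_pZl ?exprn_gt0//.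
apply: le_ereal_inf_tmp => _ [_ [a [b [ab Ac ->]]] <-].
pose a' k := r *: a k + v; pose b' k := r *: b k + v.
have ab' k i : a' k ord0 i <= b' k ord0 i.
  by rewrite !mxE lerD2r ler_pM2l.
have Ac' : [set x | A (r^-1 *: (x - v))] `<=` \bigcup_k box (a' k) (b' k).
  move=> x /= /Ac [k _ xk]; exists k => // i; have := xk i; rewrite !mxE.
  by rewrite ler_pdivlMl// ler_pdivrMl// => /andP[h1 h2]; apply/andP; split; lra.
apply: le_trans (lam_le_cover ab' Ac') _.
rewrite -nneseriesZl; last by move=> k _; rewrite lee_fin box_vol_ge0.
rewrite le_eqVlt; apply/orP; left; apply/eqP; apply: eq_eseriesr => k _.
rewrite -EFinM -box_volZ; congr EFin; apply: eq_bigr => i _.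
by rewrite !mxE; ring.
Qed.

Lemma lam_scale r v A : 0 < r ->
  lam [set x | A (r^-1 *: (x - v))] = ((r ^+ n)%:E * lam A)%E.
Proof.
move=> r0; apply/eqP; rewrite eq_le lam_scale_le//=.
(* The reverse inequality is the same bound for the inverse similarity. *)
have := @lam_scale_le r^-1 (- (r^-1 *: v)) [set x | A (r^-1 *: (x - v))].
rewrite invr_gt0 => /(_ r0).
have -> : [set x | [set y | A (r^-1 *: (y - v))] (r^-1^-1 *: (x - - (r^-1 *: v)))] = A.
  have E x : r^-1 *: (r^-1^-1 *: (x - - (r^-1 *: v)) - v) = x.
    rewrite invrK opprK scalerBr scalerA mulVf ?gt_eqF// scale1r addrK //.
  by apply/seteqP; split => x /=; rewrite E.
move=> H; have rn : (0 <= (r ^+ n)%:E)%E by rewrite lee_fin exprn_ge0// ltW.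
apply: le_trans (lee_wpmul2l rn H) _.
by rewrite muleA -EFinM exprVn divff ?expf_neq0 ?gt_eqF// mul1e.
Qed.

Definition bnd A : Prop := exists M, forall x, A x -> forall i, `|x ord0 i| <= M.
(** [fine] sends [+oo] to [0], so monotonicity and additivity of [vol] are stated for [bnd] sets,
    where the outer measure is finite. *)
Definition vol A : R := fine (lam A).

Lemma bnd_sub A B : A `<=` B -> bnd B -> bnd A.
Proof. by move=> AB [M BM]; exists M => x /AB; exact: BM. Qed.

Lemma bndU A B : bnd A -> bnd B -> bnd (A `|` B).
Proof.
move=> [M AM] [N BN]; exists (Num.max M N) => x [/AM|/BN] h i; rewrite le_max h //.
by rewrite orbT.
Qed.

Lemma bndI A B : bnd A -> bnd (A `&` B).
Proof. by apply: bnd_sub; exact: subIsetl. Qed.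

Lemma lam_fin A : bnd A -> lam A = (vol A)%:E.
Proof.
move=> [M AM]; rewrite /vol fineK// ge0_fin_numE ?lam_ge0//.
pose a : V := const_mx (- `|M|); pose b : V := const_mx `|M|.
apply: le_lt_trans (le_lam (y := box a b) _) _.
  by move=> x Ax i; rewrite !mxE -ler_norml (le_trans (AM x Ax i))// ler_norm.
apply: (@le_lt_trans _ _ (box_vol a b)%:E); last exact: ltry.
apply: lam_box_le.
by move=> i; rewrite !mxE lerNl (@le_trans _ _ 0)// oppr_le0.
Qed.

Lemma vol_ge0 A : 0 <= vol A.
Proof. by rewrite fine_ge0// lam_ge0. Qed.

Lemma vol0 : vol set0 = 0.
Proof. by rewrite /vol lam0. Qed.

Lemma le_vol A B : A `<=` B -> bnd B -> vol A <= vol B.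
Proof.
move=> AB bB; rewrite -lee_fin -!lam_fin//; first exact: le_lam.
exact: bnd_sub bB.
Qed.

Lemma volU_le A B : bnd A -> bnd B -> vol (A `|` B) <= vol A + vol B.
Proof.
move=> bA bB; rewrite -lee_fin EFinD -!lam_fin//; last exact: bndU.
exact: (@outer_measureU2 V R lam).
Qed.

Lemma vol_split A B : bnd A -> lebesgue_measurable B ->
  vol A = vol (A `&` B) + vol (A `&` ~` B).
Proof.
move=> bA mB; apply: EFin_inj; rewrite EFinD -!lam_fin//; exact: bndI.
Qed.

Lemma vol_scale r v A : 0 < r -> bnd A ->
  vol [set x | A (r^-1 *: (x - v))] = r ^+ n * vol A.
Proof. by move=> r0 bA; rewrite /vol lam_scale// (lam_fin bA). Qed.

Lemma bnd_scale r v A : 0 < r -> bnd A -> bnd [set x | A (r^-1 *: (x - v))].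
Proof.
move=> r0 [M AM]; exists (r * M + `|v|) => x /AM + i => /(_ i).
rewrite !mxE normrM gtr0_norm ?invr_gt0// ler_pdivrMl// => h.
rewrite -[x ord0 i](subrK (v ord0 i)) (le_trans (ler_normD _ _))// lerD//.
exact: coord_le_norm.
Qed.

Lemma vol_shift v A : bnd A -> vol [set x | A (x - v)] = vol A.
Proof.
move=> bA; rewrite -[RHS]mul1r -[X in X * _](expr1n _ n) -(vol_scale v)//.
by congr vol; apply/seteqP; split => x /=; rewrite invr1 scale1r.
Qed.

Definition cube M : set V := [set x | forall i, `|x ord0 i| <= M].

Lemma bnd_cube M : bnd (cube M). Proof. by exists M. Qed.

End Volume.

(** * Thin slabs and hyperplanes *)

Section Slabs.
Variables (R : realType) (m : nat).
Local Notation n := m.+1.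
Local Notation V := 'rV[R]_n.
Variables (g : V -> R) (u : V).
Hypothesis gB : forall x y, g (x - y) = g x - g y.
Hypothesis gZ : forall (t : R), g (t *: u) = t.
Hypothesis gm : forall c, lebesgue_measurable [set x | g x < c].

(* Disjoint translates of a thin slab pack into a fixed cube. *)
Lemma slab_small (M e : R) : 0 < e -> exists2 eta : R, 0 < eta &
  forall c, vol (cube M `&` [set x : V | c <= g x < c + eta]) <= e.
Proof.
(* The translations used are [k * eta *: u] with [k * eta <= 1], so they move each coordinate by at
   most the norm of [u]. *)
move=> e0; pose Q := @cube R m (M + `|u|).
have bQ : bnd Q by exact: bnd_cube.
have [N Ne] : exists N : nat, vol Q / e < N.+1%:R.
  exists (Num.truncn (vol Q / e)); exact: truncnS_gt.
have Np : 0 < N.+1%:R :> R by [].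
exists N.+1%:R^-1; first by rewrite invr_gt0.
move=> c; set eta := N.+1%:R^-1; set T := _ `&` _.
have bT : bnd T by apply: bndI; exact: bnd_cube.
have pack k : (k <= N.+1)%N ->
    k%:R * vol T <= vol (Q `&` [set x | g x < c + k%:R * eta]).
  elim: k => [_|k IH kN]; first by rewrite mul0r vol_ge0.
  rewrite (vol_split (bndI _ bQ) (gm (c + k%:R * eta))) -natr1 mulrDl mul1r.
  apply: lerD.
    apply: le_trans (IH (ltnW kN)) _; apply: le_vol; last by do 2 apply: bndI.
    move=> x [Qx /= gx]; split => //; split => //=.
    by rewrite (lt_trans gx)// ltrD2l ltr_pM2r ?invr_gt0// ltrDl.
  rewrite -(vol_shift (k%:R * eta *: u) bT); apply: le_vol; last by do 2 apply: bndI.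
  move=> x [Tx /andP[/= g1 g2]]; rewrite gB gZ in g1 g2; split; last first.
    by apply/negP; rewrite /= -leNgt; lra.
  split => /=; last by rewrite mulrDl mul1r; lra.
  move=> i; rewrite -[x ord0 i](subrK ((k%:R * eta *: u) ord0 i)).
  rewrite (le_trans (ler_normD _ _))// lerD//; first by have := Tx i; rewrite !mxE.
  rewrite mxE normrM (@le_trans _ _ (1 * `|u ord0 i|))//.
    rewrite ler_wpM2r// ger0_norm ?mulr_ge0 ?invr_ge0//.
    by rewrite ler_pdivrMr// mul1r ler_nat ltnW.
  by rewrite mul1r coord_le_norm.
have := pack N.+1 (leqnn _).
move=> /le_trans /(_ (le_vol (@subIsetl _ _ _) bQ)).
rewrite -ler_pdivlMl// => /le_trans; apply.
by rewrite ler_pdivrMl// -ler_pdivrMr// ltW.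
Qed.

Lemma vol_hyperplane (A : set V) c : bnd A -> vol (A `&` [set x | g x = c]) = 0.
Proof.
move=> [M AM]; apply/eqP; rewrite eq_le vol_ge0 andbT.
apply/ler_addgt0Pl => e e0; rewrite addr0.
have [eta eta0 /(_ c)] := slab_small M e0; apply: le_trans; apply: le_vol.
  by move=> x [/AM Ax /= ->]; split => //=; rewrite lexx ltrDl.
by apply: bndI; exact: bnd_cube.
Qed.

End Slabs.

(** * The Brunn-Minkowski inequality *)

Section BrunnMinkowski.
Variables (R : realType) (m : nat).
Local Notation n := m.+1.
Local Notation V := 'rV[R]_n.
Implicit Types (A B C : set V) (a b v x y : V) (i j : 'I_n) (c e M r : R) (p q : V * V)
  (s t : seq (V * V)).

Definition tvol s : R := \sum_(p <- s) box_vol p.1 p.2.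
Definition box_sep p q : bool :=
  [exists i, (p.2 ord0 i <= q.1 ord0 i) || (q.2 ord0 i <= p.1 ord0 i)].
Definition box_nondeg p : bool := [forall i, p.1 ord0 i < p.2 ord0 i].
Definition box_family s : bool := all box_nondeg s && pairwise box_sep s.

(** Boxes that miss the open half-space are discarded: the others stay nondegenerate, and the number
    of boxes drops when the cut separates two of them. *)
Definition cutl i c s : seq (V * V) :=
  [seq (p.1, upd p.2 i (Num.min (p.2 ord0 i) c)) | p <- s & p.1 ord0 i < c].
Definition cutr i c s : seq (V * V) :=
  [seq (upd p.1 i (Num.max (p.1 ord0 i) c), p.2) | p <- s & c < p.2 ord0 i].

Lemma upd_id a i : upd a i (a ord0 i) = a.
Proof. by apply/rowP => j; rewrite mxE; case: eqP => // ->. Qed.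

Lemma box_sep_sub p q p' q' :
  (forall i, p.1 ord0 i <= p'.1 ord0 i) -> (forall i, p'.2 ord0 i <= p.2 ord0 i) ->
  (forall i, q.1 ord0 i <= q'.1 ord0 i) -> (forall i, q'.2 ord0 i <= q.2 ord0 i) ->
  box_sep p q -> box_sep p' q'.
Proof.
move=> h1 h2 h3 h4 /existsP[i /orP[h|h]]; apply/existsP; exists i; apply/orP; [left|right].
  by rewrite (le_trans (h2 i))// (le_trans h).
by rewrite (le_trans (h4 i))// (le_trans h).
Qed.

Lemma box_family_cutl i c s : box_family s -> box_family (cutl i c s).
Proof.
move=> /andP[nd sep]; apply/andP; split.
  apply/allP => _ /mapP[p + ->]; rewrite mem_filter => /andP[pc ps].
  have /forallP pn := allP nd p ps.
  apply/forallP => j /=; rewrite mxE; case: eqP => [->|//].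
  by rewrite lt_min pn.
rewrite pairwise_map; apply: sub_pairwise (subseq_pairwise (filter_subseq _ _) sep).
move=> p q /=; apply: box_sep_sub => j //=; rewrite mxE; case: eqP => // ->;
  by rewrite ge_min lexx.
Qed.

Lemma box_family_cutr i c s : box_family s -> box_family (cutr i c s).
Proof.
move=> /andP[nd sep]; apply/andP; split.
  apply/allP => _ /mapP[p + ->]; rewrite mem_filter => /andP[pc ps].
  have /forallP pn := allP nd p ps.
  apply/forallP => j /=; rewrite mxE; case: eqP => [->|//].
  by rewrite gt_max pn.
rewrite pairwise_map; apply: sub_pairwise (subseq_pairwise (filter_subseq _ _) sep).
move=> p q /=; apply: box_sep_sub => j //=; rewrite mxE; case: eqP => // ->;
  by rewrite le_max lexx.
Qed.

Lemma tvol_cut i c s : all box_nondeg s -> tvol (cutl i c s) + tvol (cutr i c s) = tvol s.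
Proof.
rewrite /tvol /cutl /cutr !big_map !big_filter !(big_mkcond (fun p : V * V => _ < _))/=.
rewrite -big_split /= => nd; apply: eq_big_seq => p ps.
have /forallP/(_ i) pn := allP nd p ps.
have [pc|pc] := ltP (p.1 ord0 i) c; have [cp|cp] := ltP c (p.2 ord0 i).
- by rewrite box_vol_upd.
- by rewrite addr0 upd_id.
- by rewrite add0r upd_id.
- by have := lt_le_trans pn (le_trans cp pc); rewrite ltxx.
Qed.

Lemma tvol_cutl_cont i s (nd : all box_nondeg s) : continuous (fun c => tvol (cutl i c s)).
Proof.
(* A box contributes its cross-section times a clamped length, which is [0] precisely when the box
   is discarded. *)
have E : (fun c => tvol (cutl i c s)) = (fun c => \sum_(p <- s)
    (\prod_(j < n | j != i) (p.2 ord0 j - p.1 ord0 j)) *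
    (Num.max (p.1 ord0 i) (Num.min (p.2 ord0 i) c) - p.1 ord0 i)).
  apply/funext => c.
  rewrite /tvol /cutl big_map big_filter big_mkcond /=; apply: eq_big_seq => p ps.
  have /forallP/(_ i) pn := allP nd p ps.
  case: ifPn => [pc|]; last first.
    by rewrite -leNgt => pc; rewrite max_l ?subrr ?mulr0// ge_min pc orbT.
  rewrite /box_vol (bigD1 i)//= mulrC mxE eqxx max_r ?le_min ?(ltW pn) ?(ltW pc)//.
  by congr (_ * _); apply: eq_bigr => j /negbTE ji; rewrite mxE ji.
rewrite E => {E} c; elim: s {nd} => [|p s IH].
  by under eq_fun do rewrite big_nil; exact: cvg_cst.
under eq_fun do rewrite big_cons; apply: cvgD; last exact: IH.
apply: cvgM; first exact: cvg_cst.
apply: cvgB; last exact: cvg_cst.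
apply: continuous_max; first exact: cvg_cst.
by apply: continuous_min; [exact: cvg_cst|exact: cvg_id].
Qed.

Lemma tvol_gt0 s : all box_nondeg s -> s != [::] -> 0 < tvol s.
Proof.
have pos p : box_nondeg p -> 0 < box_vol p.1 p.2.
  by move=> /forallP h; apply: prodr_gt0 => i _; rewrite subr_gt0.
case: s => // p s /= /andP[/pos np ns] _; rewrite /tvol big_cons ltr_wpDr//.
by rewrite big_seq; apply: sumr_ge0 => q qs; apply/ltW/pos/(allP ns).
Qed.

(** The statement proved by the Hadwiger-Ohmann induction: Brunn-Minkowski for finite unions of open
    boxes. Quantifying over bounded sets [C] containing the sums leaves no question about
    measurability of the sumset. *)
Definition HO s t : Prop := forall C, bnd C ->
  (forall p q x y, p \in s -> q \in t -> open_box p.1 p.2 x -> open_box q.1 q.2 y -> C (x + y)) ->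
  forall al be : R, 0 <= al -> 0 <= be -> al ^+ n = tvol s -> be ^+ n = tvol t ->
  (al + be) ^+ n <= vol C.

Lemma HO_sym s t : HO s t -> HO t s.
Proof.
move=> H C bC sub al be al0 be0 alE beE; rewrite addrC; apply: H => //.
by move=> p q x y ps qt px qy; rewrite addrC; exact: sub qy px.
Qed.

Lemma open_box_sub p a b : (forall i, p.1 ord0 i <= a ord0 i) ->
  (forall i, b ord0 i <= p.2 ord0 i) -> open_box a b `<=` open_box p.1 p.2.
Proof.
move=> h1 h2 x xab i; have /andP[h3 h4] := xab i.
by rewrite (le_lt_trans (h1 i))// (lt_le_trans h4).
Qed.

Lemma cutl_open i c s p x : p \in cutl i c s -> open_box p.1 p.2 x ->
  x ord0 i < c /\ exists2 q, q \in s & open_box q.1 q.2 x.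
Proof.
move=> /mapP[q + ->] /=; rewrite mem_filter => /andP[qc qs] xq; split.
  have /andP[_] := xq i; rewrite mxE eqxx => /lt_le_trans; apply.
  by rewrite ge_min lexx orbT.
exists q => //; apply: open_box_sub xq => j //.
by rewrite mxE; case: eqP => // ->; rewrite ge_min lexx.
Qed.

Lemma cutr_open i c s p x : p \in cutr i c s -> open_box p.1 p.2 x ->
  c < x ord0 i /\ exists2 q, q \in s & open_box q.1 q.2 x.
Proof.
move=> /mapP[q + ->] /=; rewrite mem_filter => /andP[qc qs] xq; split.
  have /andP[+ _] := xq i; rewrite mxE eqxx; apply: le_lt_trans.
  by rewrite le_max lexx orbT.
exists q => //; apply: open_box_sub xq => j //.
by rewrite mxE; case: eqP => // ->; rewrite le_max lexx.
Qed.

Lemma tvol_cut_ivt i s (th : R) : box_family s -> 0 <= th <= 1 ->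
  exists c, tvol (cutl i c s) = th * tvol s.
Proof.
move=> /andP[nd _] /andP[th0 th1].
have [lo hlo] : exists lo : R, forall p, p \in s -> lo <= p.1 ord0 i.
  elim: (s) => [|p s' [lo IH]]; first by exists 0.
  exists (Num.min lo (p.1 ord0 i)) => q; rewrite inE => /orP[/eqP->|/IH h].
    by rewrite ge_min lexx orbT.
  by rewrite ge_min h.
have [hi hhi] : exists hi : R, forall p, p \in s -> p.2 ord0 i <= hi.
  elim: (s) => [|p s' [hi IH]]; first by exists 0.
  exists (Num.max hi (p.2 ord0 i)) => q; rewrite inE => /orP[/eqP->|/IH h].
    by rewrite le_max lexx orbT.
  by rewrite le_max h.
have tlo : tvol (cutl i lo s) = 0.
  rewrite /tvol /cutl big_map big_filter big_seq_cond big_pred0// => p.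
  by apply/negP => /andP[/hlo h1]; rewrite ltNge h1.
have thi : tvol (cutl i (Num.max lo hi) s) = tvol s.
  rewrite -[RHS](tvol_cut i (Num.max lo hi))// [X in _ + X](_ : _ = 0) ?addr0//.
  rewrite /tvol /cutr big_map big_filter big_seq_cond big_pred0// => p.
  by apply/negP => /andP[/hhi h1]; rewrite ltNge le_max h1 orbT.
have tge : 0 <= tvol s.
  by case: (s) nd => [|p s'] nd; [rewrite /tvol big_nil|apply/ltW/tvol_gt0].
have lh : lo <= Num.max lo hi by rewrite le_max lexx.
have [||c _ cE] := @IVT R (fun c => tvol (cutl i c s)) _ _ (th * tvol s) lh.
- by apply: continuous_subspaceT => c; exact: tvol_cutl_cont.
- by rewrite tlo thi min_l// max_r// mulr_ge0//= ler_piMl.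
by exists c.
Qed.

(** Two separated boxes of [s] give a coordinate hyperplane with a full box of [s] on either side;
    [t] is cut by a parallel hyperplane in the same proportion. The sums of left parts and of right
    parts lie on opposite sides of the level [c + c'], so their contributions to the volume of [C]
    add up, and [s] has lost a box on each side. *)
Lemma HO_step s t : box_family s -> box_family t -> t != [::] -> (1 < size s)%N ->
  (forall s' t', box_family s' -> box_family t' -> s' != [::] -> t' != [::] ->
     (size s' < size s)%N -> (size t' <= size t)%N -> HO s' t') ->
  HO s t.
Proof.
move=> fs ft t0 s1 IH C bC sub al be al0 be0 alE beE.
have /andP[nds seps] := fs; have /andP[ndt _] := ft.
have [i [c [pl [pr [pls prs plc prc]]]]] : exists i c p q,
    [/\ p \in s, q \in s, p.2 ord0 i <= c & c <= q.1 ord0 i].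
  case: (s) s1 seps => [|p [|q s']]//= _ /andP[/andP[/existsP[i /orP[h|h]] _] _].
    by exists i, (p.2 ord0 i), p, q; rewrite !inE !eqxx orbT.
  by exists i, (q.2 ord0 i), q, p; rewrite !inE !eqxx orbT.
have nz u : 0 < tvol u -> u != [::] by case: u => //; rewrite /tvol big_nil ltxx.
have s0 : s != [::] by case: (s) s1.
have /forallP/(_ i) npl := allP nds pl pls; have /forallP/(_ i) npr := allP nds pr prs.
have inl : (pl.1, upd pl.2 i (Num.min (pl.2 ord0 i) c)) \in cutl i c s.
  by apply/mapP; exists pl => //; rewrite mem_filter pls (lt_le_trans npl).
have inr : (upd pr.1 i (Num.max (pr.1 ord0 i) c), pr.2) \in cutr i c s.
  by apply/mapP; exists pr => //; rewrite mem_filter prs (le_lt_trans prc).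
have l0 : cutl i c s != [::] by apply/eqP => h; rewrite h in inl.
have r0 : cutr i c s != [::] by apply/eqP => h; rewrite h in inr.
have fl := box_family_cutl i c fs; have fr := box_family_cutr i c fs.
have szl : (size (cutl i c s) < size s)%N.
  rewrite size_map size_filter -(count_predC (fun p => p.1 ord0 i < c) s) -addn1 leq_add2l.
  by rewrite -has_count; apply/hasP; exists pr => //=; rewrite -leNgt.
have szr : (size (cutr i c s) < size s)%N.
  rewrite size_map size_filter -(count_predC (fun p => c < p.2 ord0 i) s) -addn1 leq_add2l.
  by rewrite -has_count; apply/hasP; exists pl => //=; rewrite -leNgt.
have sz2 c' : (size (cutl i c' t) <= size t)%N.
  by rewrite size_map size_filter count_size.
have sz3 c' : (size (cutr i c' t) <= size t)%N.
  by rewrite size_map size_filter count_size.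
have tl : 0 < tvol (cutl i c s) by apply: tvol_gt0 => //; case/andP: fl.
have tr : 0 < tvol (cutr i c s) by apply: tvol_gt0 => //; case/andP: fr.
have ts := tvol_gt0 nds s0; have tt := tvol_gt0 ndt t0.
have tsE := tvol_cut i c nds.
pose th := tvol (cutl i c s) / tvol s.
have th0 : 0 < th by rewrite divr_gt0.
have th1 : th < 1 by rewrite ltr_pdivrMr// mul1r -tsE ltrDl.
have thE : tvol (cutl i c s) = th * tvol s by rewrite /th divfK// gt_eqF.
have thE' : tvol (cutr i c s) = (1 - th) * tvol s by rewrite mulrBl mul1r -thE -tsE addrC addKr.
have [|c' c'E] := @tvol_cut_ivt i t th ft; first by rewrite !ltW.
have c'E' : tvol (cutr i c' t) = (1 - th) * tvol t.
  by rewrite mulrBl mul1r -c'E -[X in X - _](tvol_cut i c' ndt) addrC addKr.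
have fl' := box_family_cutl i c' ft; have fr' := box_family_cutr i c' ft.
have l0' : cutl i c' t != [::] by apply: nz; rewrite c'E mulr_gt0.
have r0' : cutr i c' t != [::] by apply: nz; rewrite c'E' mulr_gt0// subr_gt0.
have [ta ta0 taE] := @nth_root_ex R m th (ltW th0).
have [tb tb0 tbE] : exists2 r : R, 0 <= r & r ^+ n = 1 - th.
  by apply: nth_root_ex; rewrite subr_ge0 ltW.
rewrite (vol_split bC (lt_coord_meas i (c + c'))).
(* Equal proportions make both roots shrink by the same factor, [ta] on the left and [tb] on the
   right, with [ta ^+ n + tb ^+ n = 1]. *)
have -> : (al + be) ^+ n = (ta * al + ta * be) ^+ n + (tb * al + tb * be) ^+ n.
  by rewrite -!mulrDr !exprMn taE tbE; ring.
apply: lerD.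
- apply: (IH _ _ fl fl') => //; try by rewrite mulr_ge0.
  + exact: bndI.
  + move=> p q x y pin qin px qy.
    have [xc [p' p's xp']] := cutl_open pin px; have [yc [q' q't yq']] := cutl_open qin qy.
    by split; [exact: sub xp' yq'|rewrite /= mxE ltrD].
  + by rewrite exprMn taE alE thE.
  + by rewrite exprMn taE beE c'E.
- apply: (IH _ _ fr fr') => //; try by rewrite mulr_ge0.
  + exact: bndI.
  + move=> p q x y pin qin px qy.
    have [xc [p' p's xp']] := cutr_open pin px; have [yc [q' q't yq']] := cutr_open qin qy.
    split; first exact: sub xp' yq'.
    by apply/negP; rewrite /= mxE -leNgt ltW// ltrD.
  + by rewrite exprMn tbE alE thE'.
  + by rewrite exprMn tbE beE c'E'.
Qed.

(** AM-GM applied to the ratios [f i / (f i + g i)] and to [g i / (f i + g i)], whose arithmetic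
    means add up to [1]. *)
Lemma prod_add_ge (f g : 'I_n -> R) (al be : R) : (forall i, 0 < f i) -> (forall i, 0 < g i) ->
  0 <= al -> 0 <= be -> al ^+ n = \prod_i f i -> be ^+ n = \prod_i g i ->
  (al + be) ^+ n <= \prod_i (f i + g i).
Proof.
move=> f0 g0 al0 be0 alE beE.
have h0 i : 0 < f i + g i by rewrite addr_gt0.
have P0 : 0 < \prod_i (f i + g i) by apply: prodr_gt0.
have [rh rh0 rhE] := @nth_root_ex R m _ (ltW P0).
have rhp : 0 < rh by rewrite lt_def rh0 andbT; apply/eqP => h; move: P0; rewrite -rhE h expr0n/= ltxx.
have key (u : 'I_n -> R) (r : R) : (forall i, 0 < u i) -> 0 <= r -> r ^+ n = \prod_i u i ->
    r / rh <= (\sum_i u i / (f i + g i)) / n%:R.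
  move=> u0 r0 rE.
  have [+ _] := @leif_AGM R _ [pred _ : 'I_n | true] (fun i => u i / (f i + g i))
    (fun i _ => divr_ge0 (ltW (u0 i)) (ltW (h0 i))).
  rewrite cardT size_enum_ord prodf_div -rhE -rE -expr_div_n.
  rewrite ler_pXn2r// nnegrE; first by rewrite divr_ge0.
  by rewrite divr_ge0// sumr_ge0// => i _; rewrite divr_ge0// ltW.
have : al / rh + be / rh <= 1.
  apply: le_trans (lerD (key _ _ f0 al0 alE) (key _ _ g0 be0 beE)) _.
  rewrite -mulrDl -big_split /= (eq_bigr (fun=> 1)); last first.
    by move=> i _; rewrite -mulrDl divff// gt_eqF.
  by rewrite sumr_const card_ord divff.
rewrite -mulrDl ler_pdivrMr// mul1r => le.
by rewrite -rhE lerXn2r// nnegrE ?addr_ge0.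
Qed.

Lemma HO_base p q : box_nondeg p -> box_nondeg q -> HO [:: p] [:: q].
Proof.
move=> /forallP ndp /forallP ndq C bC sub al be al0 be0.
rewrite /tvol !big_seq1 => alE beE.
have f0 i : 0 < p.2 ord0 i - p.1 ord0 i by rewrite subr_gt0.
have g0 i : 0 < q.2 ord0 i - q.1 ord0 i by rewrite subr_gt0.
apply: le_trans (prod_add_ge f0 g0 al0 be0 alE beE) _.
have -> : \prod_i (p.2 ord0 i - p.1 ord0 i + (q.2 ord0 i - q.1 ord0 i)) =
    box_vol (p.1 + q.1) (p.2 + q.2).
  by apply: eq_bigr => i _; rewrite !mxE; ring.
rewrite -lee_fin -(lam_fin bC); apply: le_trans (lam_open_box_ge _) _.
  by move=> i; rewrite !mxE lerD// ltW.
apply: le_lam => z zb.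
pose t i := (z ord0 i - (p.1 ord0 i + q.1 ord0 i)) /
  (p.2 ord0 i - p.1 ord0 i + (q.2 ord0 i - q.1 ord0 i)).
have d0 i : 0 < p.2 ord0 i - p.1 ord0 i + (q.2 ord0 i - q.1 ord0 i) by rewrite addr_gt0.
have t01 i : 0 < t i < 1.
  have := zb i; rewrite !mxE => /andP[h1 h2].
  by rewrite divr_gt0//= ?subr_gt0// ltr_pdivrMr//; lra.
pose x : V := \row_i (p.1 ord0 i + t i * (p.2 ord0 i - p.1 ord0 i)).
pose y : V := \row_i (q.1 ord0 i + t i * (q.2 ord0 i - q.1 ord0 i)).
have -> : z = x + y.
  apply/rowP => i; rewrite !mxE.
  have : t i * (p.2 ord0 i - p.1 ord0 i + (q.2 ord0 i - q.1 ord0 i)) =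
      z ord0 i - (p.1 ord0 i + q.1 ord0 i) by rewrite /t divfK// gt_eqF.
  by lra.
apply: (sub p q); rewrite ?inE//.
- move=> i; rewrite mxE; have /andP[h1 h2] := t01 i; have h3 := f0 i; nra.
- move=> i; rewrite mxE; have /andP[h1 h2] := t01 i; have h3 := g0 i; nra.
Qed.

Lemma HO_all s t : box_family s -> box_family t -> s != [::] -> t != [::] -> HO s t.
Proof.
have [N] := ubnP (size s + size t)%N; elim: N s t => // N IH s t sN fs ft s0 t0.
have [s1|s1] := ltnP 1 (size s).
  apply: HO_step => // s' t' fs' ft' s'0 t'0 ss' tt'; apply: IH => //.
  by rewrite (leq_trans _ (ltnSE sN))// -addSn leq_add.
have [t1|t1] := ltnP 1 (size t).
  apply/HO_sym/HO_step => // t' s' ft' fs' t'0 s'0 tt' ss'; apply/HO_sym/IH => //.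
  by rewrite (leq_trans _ (ltnSE sN))// -addnS leq_add.
case: s s0 s1 fs {sN} => [|p [|]]//= _ _ /andP[/=/andP[np _] _].
case: t t0 t1 ft => [|q [|]]//= _ _ /andP[/=/andP[nq _] _].
exact: HO_base.
Qed.

End BrunnMinkowski.

(** * From boxes to compact sumsets *)

Section CompactBrunnMinkowski.
Variables (R : realType) (m : nat).
Local Notation n := m.+1.
Local Notation V := 'rV[R]_n.
Local Notation lam := (@lebesgue_outer R n).
Implicit Types (A B C : set V) (a b v x y : V) (i j : 'I_n) (c e M r : R) (p q : V * V)
  (s t : seq (V * V)).

Definition thicken (d : R) A : set V :=
  [set y | exists2 x, A x & forall i, `|y ord0 i - x ord0 i| <= d].

Lemma bnd_thicken d A : bnd A -> bnd (thicken d A).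
Proof.
move=> [M AM]; exists (d + M) => y [x Ax xy] i.
by rewrite -[y ord0 i](subrK (x ord0 i)) (le_trans (ler_normD _ _))// lerD// AM.
Qed.

Lemma vol_le_tvol s A : bnd A -> all (@box_nondeg R m) s ->
  (forall x, A x -> exists2 p, p \in s & box p.1 p.2 x) -> vol A <= tvol s.
Proof.
elim: s A => [|p s IH] A bA nd cov.
  rewrite /tvol big_nil (_ : A = set0) ?vol0//.
  by apply/seteqP; split => x // /cov[].
have /andP[/forallP np ns] := nd.
rewrite /tvol big_cons -/(tvol s).
have bb : bnd (A `&` box p.1 p.2) by exact: bndI.
have bc : bnd (A `\` box p.1 p.2) by exact: bndI.
apply: (@le_trans _ _ (vol (A `&` box p.1 p.2) + vol (A `\` box p.1 p.2))).
  rewrite -[X in vol X <= _](setUIDK A (box p.1 p.2)).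
  exact: volU_le.
apply: lerD; last first.
  apply: IH => // x [/cov [q]]; rewrite inE => /orP[/eqP-> //|qs xq _].
  by exists q.
rewrite -lee_fin -lam_fin//; apply: le_trans (lam_box_le _); last by move=> i; exact/ltW.
by apply: le_lam => x [].
Qed.

(** Cells of side [d] of a cubical grid, keeping those that meet [A]: they cover [A] and stay within
    distance [d] of it. *)
Lemma grid_cover (d : R) A : 0 < d -> bnd A -> A !=set0 ->
  exists s, [/\ box_family s, s != [::], vol A <= tvol s &
    forall p x, p \in s -> open_box p.1 p.2 x -> thicken d A x].
Proof.
move=> d0 bA [x0 Ax0]; have [M AM] := bA.
have [N Nd] : exists N : nat, (M + M) / d < N.+1%:R.
  by exists (Num.truncn ((M + M) / d)); exact: truncnS_gt.
pose cell (k : {ffun 'I_n -> 'I_N.+1}) : V * V :=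
  (\row_i (- M + (k i)%:R * d), \row_i (- M + (k i).+1%:R * d)).
pose s := [seq cell k | k <- enum {ffun 'I_n -> 'I_N.+1} &
  `[< exists2 x, A x & box (cell k).1 (cell k).2 x >]].
have cov x : A x -> exists2 p, p \in s & box p.1 p.2 x.
  move=> Ax.
  have xi i : 0 <= (x ord0 i + M) / d < N.+1%:R.
    have := AM x Ax i; rewrite ler_norml => /andP[h1 h2].
    rewrite divr_ge0 ?(ltW d0)//=; last by lra.
    rewrite (le_lt_trans _ Nd)// ler_pM2r ?invr_gt0//; lra.
  pose k := [ffun i => inord (Num.truncn ((x ord0 i + M) / d)) : 'I_N.+1].
  have kE i : (k i : nat) = Num.truncn ((x ord0 i + M) / d).
    rewrite ffunE inordK// ltnS truncn_le_nat; by case/andP: (xi i).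
  have bx : box (cell k).1 (cell k).2 x.
    move=> i; rewrite !mxE kE; have /andP[h1 h2] := xi i.
    have /andP[] := truncn_itv h1; rewrite ler_pdivlMr// ltr_pdivrMr// => h3 h4.
    by apply/andP; split; lra.
  exists (cell k) => //; apply/mapP; exists k => //.
  by rewrite mem_filter mem_enum andbT; apply/asboolP; exists x.
have nd : all (@box_nondeg R m) s.
  apply/allP => _ /mapP[k _ ->]; apply/forallP => i /=; rewrite !mxE ltrD2l ltr_pM2r//.
  by rewrite ltr_nat.
exists s; split.
- rewrite /box_family nd /= pairwise_map.
  have : uniq [seq k <- enum {ffun 'I_n -> 'I_N.+1} | `[< exists2 x, A x & box (cell k).1 (cell k).2 x >]].
    by rewrite filter_uniq// enum_uniq.
  rewrite uniq_pairwise; apply: sub_pairwise => k l /= kl.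
  have [i kli] : exists i, k i != l i.
    apply/existsP; rewrite -negb_forall; apply: contra kl => /forallP h.
    by apply/eqP/ffunP => i; apply/eqP.
  apply/existsP; exists i; rewrite !mxE !lerD2l !ler_pM2r// !ler_nat.
  by move: kli; rewrite neq_ltn.
- by have [p + _] := cov x0 Ax0; case: (s).
- exact: vol_le_tvol.
- move=> p x /mapP[k]; rewrite mem_filter => /andP[/asboolP[a Aa ba] _] -> xk.
  exists a => // i; have := ba i; have := xk i; rewrite !mxE -natr1 mulrDl mul1r.
  move=> /andP[h1 h2] /andP[h3 h4]; rewrite ler_norml; lra.
Qed.

Lemma box_vol_thicken a b e : 0 < e -> (forall i, a ord0 i <= b ord0 i) ->
  exists2 d : R, 0 < d & box_vol (a - const_mx d) (b + const_mx d) <= box_vol a b + e.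
Proof.
move=> e0 ab.
have E d : box_vol (a - const_mx d) (b + const_mx d) = \prod_(i < n) (b ord0 i - a ord0 i + 2 * d).
  by apply: eq_bigr => i _; rewrite !mxE; ring.
have cont : continuous (fun d : R => \prod_(i < n) (b ord0 i - a ord0 i + 2 * d)).
  have gen (l : seq 'I_n) : continuous (fun d : R => \prod_(i <- l) (b ord0 i - a ord0 i + 2 * d)).
    move=> x; elim: l => [|i l IH].
      by under eq_fun do rewrite big_nil; exact: cvg_cst.
    under eq_fun do rewrite big_cons; apply: cvgM; last exact: IH.
    apply: cvgD; first exact: cvg_cst.
    apply: cvgM; [exact: cvg_cst|exact: cvg_id].
  exact: gen.
have [d /= d0 dP] : exists2 d : R, 0 < d & forall z, `|0 - z| < d ->
    `|\prod_(i < n) (b ord0 i - a ord0 i + 2 * 0) - \prod_(i < n) (b ord0 i - a ord0 i + 2 * z)| < e.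
  have /cvgrPdist_lt/(_ _ e0)/nbhs_ballP[d d0 dP] := cont 0.
  by exists d => // z zd; exact: dP.
exists (d / 2); first by rewrite divr_gt0.
have hd : d / 2 < d by lra.
have := dP (d / 2); rewrite sub0r normrN ger0_norm ?divr_ge0 ?(ltW d0)// => /(_ hd)/ltW.
rewrite ler_distlC E => /andP[_]; rewrite /box_vol => /le_trans; apply.
rewrite lerD2r; apply: ler_prod => i _; rewrite mulr0 addr0 lexx subr_ge0 ab //.
Qed.

(** A nearly optimal cover of [C] is enlarged by a summable amount. Each point of [C] then has room
    around it inside one enlarged box, and compactness makes that room uniform. *)
Lemma vol_thicken_compact C e : compact C -> bnd C -> 0 < e ->
  exists2 d : R, 0 < d & vol (thicken d C) <= vol C + e.
Proof.
move=> cC bC e0.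
have e2 : 0 < e / 2 by rewrite divr_gt0.
have fC : lam C \is a fin_num by rewrite lam_fin.
have [_ [a [b [ab Cc ->]]] abC] := lb_ereal_inf_adherent e2 fC.
have /choice[d dP] : forall k, exists d : R, 0 < d /\
    box_vol (a k - const_mx d) (b k + const_mx d) <= box_vol (a k) (b k) + e / 2 / (2 ^ k.+1)%:R.
  move=> k; have ek : 0 < e / 2 / (2 ^ k.+1)%:R by rewrite divr_gt0// ltr0n expn_gt0.
  by have [d d0 dP] := box_vol_thicken ek (ab k); exists d.
pose U := \bigcup_k box (a k - const_mx (d k)) (b k + const_mx (d k)).
have [r r0 rU] : exists2 r : R, 0 < r & thicken r C `<=` U.
  have /compact_near_coveringP/(_ R (0^'+) (fun r x => forall y, (forall i, `|y ord0 i - x ord0 i| <= r) -> U y)) := cC.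
  move=> /(_ _)[].
    move=> x /Cc[k _ xk]; have [dk0 _] := dP k.
    near=> x' r => y yx'; exists k => // i; rewrite !mxE.
    have /andP[h1 h2] := xk i.
    (* Half of the margin [d k] is spent on moving the centre from [x] to [x'], the other half on
       the radius [r]. *)
    have h3 : `|x' ord0 i - x ord0 i| < d k / 2.
      have : `|x - x'| < d k / 2.
        by near: x'; apply: cvgr_dist_lt; [exact: cvg_id|rewrite divr_gt0].
      rewrite distrC; apply: le_lt_trans; have := coord_le_norm (x' - x) i.
      by rewrite !mxE.
    have h4 : r <= d k / 2.
      by near: r; apply: nbhs_right_le; rewrite divr_gt0.
    move: (yx' i) h3 => /=; rewrite ler_norml ltr_norml => /andP[h5 h6] /andP[h7 h8].
    by apply/andP; split; lra.
  move=> r /= r0 H; exists (r / 2); first by rewrite divr_gt0.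
  move=> y [x Cx xy]; apply: (H (r / 2)) Cx _ xy; last by rewrite divr_gt0.
  by rewrite /= sub0r normrN gtr0_norm ?divr_gt0//; lra.
exists r => //.
rewrite -lee_fin -(lam_fin (bnd_thicken _ bC)) EFinD -(lam_fin bC).
apply: le_trans (le_lam rU) _.
apply: le_trans (lam_le_cover _ (@subset_refl _ U)) _.
  by move=> k i; rewrite !mxE; have [dk0 _] := dP k; have := ab k i; lra.
apply: (@le_trans _ _ (\sum_(0 <= k <oo) ((box_vol (a k) (b k))%:E + (e / 2 / (2 ^ k.+1)%:R)%:E))%E).
  apply: lee_nneseries => k _.
    move=> _; rewrite lee_fin box_vol_ge0// => i; rewrite !mxE.
    by have [dk0 _] := dP k; have := ab k i; lra.
  by rewrite -EFinD lee_fin; have [] := dP k.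
apply: le_trans (epsilon_trick _ _ (ltW e2)) _.
  by move=> k; rewrite lee_fin box_vol_ge0.
by apply: le_trans (leeD (ltW abC) (lexx _)) _; rewrite -addeA -EFinD -splitr.
Unshelve. all: by end_near. Qed.

(** [A] and [B] are replaced by grid cells within [d / 2] of them; the sums of these cells lie in
    [thicken d C], whose volume tends to that of [C] by compactness. *)
Lemma brunn_minkowski A B C (al be : R) : bnd A -> bnd B -> compact C -> bnd C ->
  A !=set0 -> B !=set0 -> (forall x y, A x -> B y -> C (x + y)) ->
  0 <= al -> 0 <= be -> al ^+ n <= vol A -> be ^+ n <= vol B ->
  (al + be) ^+ n <= vol C.
Proof.
move=> bA bB cC bC A0 B0 ABC al0 be0 alA beB.
apply/ler_addgt0Pr => e e0.
have [d d0 dC] := vol_thicken_compact cC bC e0.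
have d2 : 0 < d / 2 by rewrite divr_gt0.
have [s [fs s0 As sA]] := grid_cover d2 bA A0.
have [t [ft t0 Bt tB]] := grid_cover d2 bB B0.
have [al' al'0 alE] := @nth_root_ex R m _ (le_trans (vol_ge0 _) As).
have [be' be'0 beE] := @nth_root_ex R m _ (le_trans (vol_ge0 _) Bt).
apply: le_trans dC; apply: (@le_trans _ _ ((al' + be') ^+ n)).
  rewrite lerXn2r ?nnegrE ?addr_ge0// lerD//.
    by rewrite -(@ler_pXn2r _ n)// ?nnegrE// alE (le_trans alA).
  by rewrite -(@ler_pXn2r _ n)// ?nnegrE// beE (le_trans beB).
apply: (HO_all fs ft s0 t0) => //; first exact: bnd_thicken.
move=> p q x y ps qt /(sA _ _ ps)[a Aa xa] /(tB _ _ qt)[b Bb yb].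
exists (a + b); first exact: ABC.
move=> i; rewrite !mxE; have := xa i; have := yb i; rewrite !ler_norml.
by move=> /andP[h1 h2] /andP[h3 h4]; apply/andP; split; lra.
Qed.

End CompactBrunnMinkowski.

(** * Needles *)

Section Growth.
Variable R : realType.

(** A continuity argument on the supremum of the points where the bound holds. It replaces
    integration of a derivative: to the right, a single arbitrarily short good step suffices, which
    is all that the failure of a lower density bound provides. *)
Lemma growth_le (f : R -> R) (p q : R) : p <= q ->
  (forall s, p <= s < q -> forall d0 : R, 0 < d0 ->
     exists d : R, 0 < d < d0 /\ f (s + d) <= f s) ->
  (forall s, p < s <= q -> forall e : R, 0 < e ->
     exists2 d0 : R, 0 < d0 & forall r, p <= r -> s - d0 < r < s -> f s <= f r + e) ->
  f q <= f p.
Proof.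
move=> pq step lsc.
pose T := [set s | p <= s <= q /\ f s <= f p].
have Tp : T p by split => //; rewrite lexx.
have supT : has_sup T by split; [exists p|exists q => s [/andP[_]]].
have ps : p <= sup T by exact: ub_le_sup supT.2 _ Tp.
have sq : sup T <= q by apply: ge_sup => [|s [/andP[_]]//]; exists p.
have Tsup : f (sup T) <= f p.
  move: ps; rewrite le_eqVlt => /orP[/eqP<-//|ps].
  apply/ler_addgt0Pr => e e0.
  have [|d0 d00 lscd] := lsc (sup T) _ e e0; first by rewrite ps.
  have [s Ts sd] := sup_adherent d00 supT.
  have [/andP[ps' _] fs] := Ts.
  have := ub_le_sup supT.2 Ts; rewrite le_eqVlt => /orP[/eqP<-|ss].
    by rewrite (le_trans fs)// lerDl ltW.
  by rewrite (le_trans (lscd s _ _))// ?sd// lerD2r.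
move: sq; rewrite le_eqVlt => /orP[/eqP<-//|sq].
have [||d [/andP[d0 dq] fd]] := step (sup T) _ (q - sup T); first by rewrite ps.
  by rewrite subr_gt0.
have Td : T (sup T + d).
  split; last exact: le_trans Tsup.
  by apply/andP; split; lra.
have := ub_le_sup supT.2 Td; lra.
Qed.

End Growth.

(** * Mass distribution of a truncated cone *)

Section AffinePrimitive.
Variables (R : realType) (m : nat) (A k : R).
Let l (s : R) := A + k * s.

(** A primitive of [s |-> (A + k * s) ^+ m]. *)
Definition affine_prim (s : R) : R :=
  if k == 0 then A ^+ m * s else l s ^+ m.+1 / (m.+1%:R * k).

Lemma hom_sum_diag (u : R) : hom_sum m u u = m.+1%:R * u ^+ m.
Proof.
rewrite /hom_sum (eq_bigr (fun=> u ^+ m)); last first.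
  by move=> i _; rewrite -exprD subnK// -ltnS.
by rewrite sumr_const card_ord mulr_natl.
Qed.

Lemma affine_primB p q :
  affine_prim q - affine_prim p = (q - p) * (hom_sum m (l p) (l q) / m.+1%:R).
Proof.
rewrite /affine_prim; case: eqP => [k0|/eqP k0].
  by rewrite /l k0 !mul0r !addr0 hom_sum_diag; field.
rewrite -mulrBl.
have -> : l q ^+ m.+1 - l p ^+ m.+1 = (k * (q - p)) * hom_sum m (l p) (l q).
  rewrite subrXX /l; congr (_ * _); first by ring.
  rewrite /hom_sum (reindex_inj rev_ord_inj) /=; apply: eq_bigr => i _.
  by rewrite subSS subKn 1?mulrC// -ltnS.
by field; rewrite k0 ?nat1r ?natr1 ?pnatr_eq0.
Qed.

Lemma hom_sum_ge (a u v : R) : 0 <= a -> a <= u -> a <= v ->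
  m.+1%:R * a ^+ m <= hom_sum m u v.
Proof.
move=> a0 au av; rewrite -hom_sum_diag; apply: ler_sum => i _.
by apply: ler_pM; rewrite ?exprn_ge0// lerXn2r ?nnegrE// (le_trans a0).
Qed.

Lemma affine_prim_ge (a p q : R) : p <= q -> 0 <= a -> a <= l p -> a <= l q ->
  (q - p) * a ^+ m <= affine_prim q - affine_prim p.
Proof.
move=> pq a0 ap aq; rewrite affine_primB ler_wpM2l ?subr_ge0//.
by rewrite ler_pdivlMr// mulrC hom_sum_ge.
Qed.

(** The [m.+1]-th power of an affine function is itself affine in the primitive, hence interpolates
    between its end values with the masses as weights. *)
Lemma affine_prim_mean (t : R) : let al := affine_prim t - affine_prim 0 in
  let be := affine_prim 1 - affine_prim t in
  (al + be) * l t ^+ m.+1 = be * l 0 ^+ m.+1 + al * l 1 ^+ m.+1.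
Proof.
rewrite /= /affine_prim; case: eqP => [k0|/eqP k0].
  by rewrite /l k0 !mul0r !addr0; ring.
by field; rewrite k0 ?nat1r ?natr1 ?pnatr_eq0.
Qed.

End AffinePrimitive.

(** * Density bound at a point of a truncated cone *)

Section NeedleBound.
Variables (R : realType) (m : nat) (x c : R).
Hypothesis x0 : 0 < x.
Hypothesis x12 : x <= 2^-1.
Hypothesis c0 : 0 < c.
Hypothesis Hc : forall u v : R, 0 <= u -> 0 <= v ->
  (c * (hom_sum m u v / m.+1%:R)) ^+ m.+1 <= ((1 - x) * u ^+ m.+1 + x * v ^+ m.+1) ^+ m.

Lemma hom_sumC (u v : R) : hom_sum m u v = hom_sum m v u.
Proof.
rewrite /hom_sum (reindex_inj rev_ord_inj) /=; apply: eq_bigr => i _.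
by rewrite subSS subKn 1?mulrC// -ltnS.
Qed.

Lemma mix_ge0 (u v : R) : 0 <= u -> 0 <= v -> 0 <= (1 - x) * u ^+ m.+1 + x * v ^+ m.+1.
Proof.
move=> u0 v0; have x1 : 0 <= 1 - x by move: x12; lra.
by rewrite addr_ge0// mulr_ge0 ?exprn_ge0// ltW.
Qed.

(** With [th = al / (x * M) <= 1], interpolation gives [th] times the mixture of [Hc] as a lower
    bound for [y ^+ m.+1]. Raising it to the power [m] and using [th ^+ m.+1 <= th ^+ m] leaves a
    bound that is linear in [al]. *)
Lemma needle_bound_side (u v y al be : R) : 0 <= u -> 0 <= v -> 0 <= y ->
  0 <= al -> 0 <= be -> 0 < al + be -> al + be = hom_sum m u v / m.+1%:R ->
  (al + be) * y ^+ m.+1 = be * u ^+ m.+1 + al * v ^+ m.+1 ->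
  al <= x * (al + be) -> c * (al / x) <= y ^+ m.
Proof.
move=> u0 v0 y0 al0 be0 M0 ME yE alx.
set M := al + be in M0 ME yE alx.
pose th := al / M / x.
have th0 : 0 <= th by rewrite !divr_ge0 ?(ltW M0) ?(ltW x0).
have th1 : th <= 1 by rewrite ler_pdivrMr// mul1r ler_pdivrMr.
have un : 0 <= u ^+ m.+1 by exact: exprn_ge0.
have yB : th * ((1 - x) * u ^+ m.+1 + x * v ^+ m.+1) <= y ^+ m.+1.
  have -> : y ^+ m.+1 = (be / M) * u ^+ m.+1 + (al / M) * v ^+ m.+1.
    apply: (mulfI (lt0r_neq0 M0)); rewrite yE; field; exact: lt0r_neq0.
  have -> : al / M = th * x by rewrite /th divfK// gt_eqF.
  have -> : be / M = 1 - th * x.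
    by rewrite /th divfK ?gt_eqF// /M; field; exact: lt0r_neq0.
  by nra.
rewrite -(@ler_pXn2r _ m.+1)// ?nnegrE ?exprn_ge0//; last first.
  by rewrite mulr_ge0 ?divr_ge0 ?(ltW c0) ?(ltW x0).
have -> : c * (al / x) = th * (c * M).
  by rewrite /th; field; rewrite !gt_eqF.
rewrite exprAC exprMn.
have B0 : 0 <= (1 - x) * u ^+ m.+1 + x * v ^+ m.+1.
  exact: mix_ge0.
apply: (@le_trans _ _ (th ^+ m * ((1 - x) * u ^+ m.+1 + x * v ^+ m.+1) ^+ m)); last first.
  by rewrite -exprMn lerXn2r ?nnegrE ?(mulr_ge0 th0 B0) ?exprn_ge0.
have cM0 : 0 <= c * M by rewrite mulr_ge0 ?(ltW c0) ?(ltW M0).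
apply: ler_pM; rewrite ?exprn_ge0//.
- by rewrite exprS ler_piMl// exprn_ge0.
- by rewrite ME; exact: Hc.
Qed.

(** Here [al] and [be] are the masses of a majorant on the two sides of a point with true masses [p]
    and [1 - p]. The total [al + be] may exceed [1], hence the distinction by the fraction of it
    that each side carries. *)
Lemma needle_bound (u v y al be p : R) : 0 <= u -> 0 <= v -> 0 <= y ->
  al + be = hom_sum m u v / m.+1%:R ->
  (al + be) * y ^+ m.+1 = be * u ^+ m.+1 + al * v ^+ m.+1 ->
  0 <= p <= 1 -> p <= al -> 1 - p <= be ->
  c * Num.min 1 (Num.min (p / x) ((1 - p) / x)) <= y ^+ m.
Proof.
move=> u0 v0 y0 ME yE /andP[p0 p1] pal pbe.
have al0 : 0 <= al by lra.
have be0 : 0 <= be by lra.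
have M1 : 1 <= al + be by lra.
have M0 : 0 < al + be by lra.
have min_le (z : R) : (1 <= z \/ p / x <= z) \/ (1 - p) / x <= z ->
    c * z <= y ^+ m -> c * Num.min 1 (Num.min (p / x) ((1 - p) / x)) <= y ^+ m.
  move=> h; apply: le_trans; rewrite ler_pM2l// !ge_min.
  by case: h => [[|]|] ->; rewrite ?orbT.
have [h1|h1] := leP al (x * (al + be)).
  apply: (min_le (al / x)); last by apply: (@needle_bound_side u v y al be).
  by left; right; rewrite ler_pM2r ?invr_gt0.
have [h2|h2] := leP be (x * (al + be)).
  apply: (min_le (be / x)); first by right; rewrite ler_pM2r ?invr_gt0.
  apply: (@needle_bound_side v u y be al) => //; rewrite ?(addrC be)//.
  - by rewrite hom_sumC.
  - by rewrite yE addrC.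
apply: (min_le (al + be)); first by left; left.
rewrite -(@ler_pXn2r _ m.+1)// ?nnegrE ?exprn_ge0//; last first.
  by rewrite mulr_ge0// ltW.
rewrite exprAC ME.
(* Both sides carry more than the fraction [x], so giving weight [x] to the larger end and [1 - x]
   to the smaller one can only lower the mixture. *)
have [uv|vu] := leP u v.
  apply: le_trans (Hc u0 v0) _.
  rewrite lerXn2r ?nnegrE ?exprn_ge0//.
    exact: mix_ge0.
  have uvn : u ^+ m.+1 <= v ^+ m.+1 by rewrite lerXn2r.
  rewrite -(ler_pM2l M0) yE; nra.
rewrite hom_sumC; apply: le_trans (Hc v0 u0) _.
rewrite lerXn2r ?nnegrE ?exprn_ge0//.
  exact: mix_ge0.
have uvn : v ^+ m.+1 <= u ^+ m.+1 by rewrite lerXn2r ?nnegrE// ltW.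
rewrite -(ler_pM2l M0) yE; nra.
Qed.

End NeedleBound.

(* Distribution functions on [0, 1] of the 1/n-concave probability measures. *)
Record needle (R : realType) (m : nat) (F : R -> R) : Prop := Needle {
  needle0 : F 0 = 0;
  needle1 : F 1 = 1;
  needle_mono : forall p q : R, 0 <= p -> p <= q -> q <= 1 -> F p <= F q;
  needle_lip : exists2 C : R, 0 <= C &
    forall p q : R, 0 <= p -> p <= q -> q <= 1 -> F q - F p <= C * (q - p);
  needle_bm : forall p q p' q' s al be : R, 0 <= p -> p <= q -> q <= 1 ->
    0 <= p' -> p' <= q' -> q' <= 1 -> 0 <= s <= 1 -> 0 <= al -> 0 <= be ->
    al ^+ m.+1 <= F q - F p -> be ^+ m.+1 <= F q' - F p' ->
    (s * al + (1 - s) * be) ^+ m.+1 <= F (s * q + (1 - s) * q') - F (s * p + (1 - s) * p')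
}.

(** * Concavity of the [m]-th root of the density *)

Section NeedleSlope.
Variables (R : realType) (m : nat) (F : R -> R).
Hypothesis HF : needle m F.

(* [slope t r]: the density of the needle at [t] is at least [r ^+ m]. *)
Definition slope (t r : R) : Prop := 0 <= r /\
  exists2 d0 : R, 0 < d0 & forall d : R, 0 < d < d0 -> r ^+ m * d <= F (t + d) - F t.

Lemma convex_comb_lt1 (la s t : R) : 0 <= la -> la <= 1 -> s < 1 -> t < 1 ->
  la * s + (1 - la) * t < 1.
Proof.
move=> la0 la1 s1 t1; have [st|ts] := leP s t.
  apply: le_lt_trans t1; nra.
apply: le_lt_trans s1; nra.
Qed.

(** Infinitesimal Brunn-Minkowski: intervals at [s] and [t] are taken with lengths proportional to
    [r] and [r'], which improves [1/m.+1]-concavity of masses to [1/m]-concavity of densities. *)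
Lemma slope_convex (s t r r' la : R) : (0 < m)%N -> 0 <= s < 1 -> 0 <= t < 1 -> 0 <= la <= 1 ->
  slope s r -> slope t r' -> slope (la * s + (1 - la) * t) (la * r + (1 - la) * r').
Proof.
move=> m0 /andP[s0 s1] /andP[t0 t1] /andP[la0 la1] [r0 [d1 d10 H1]] [r'0 [d2 d20 H2]].
set z := la * s + _; set w := la * r + _.
have z0 : 0 <= z by rewrite /z; nra.
have z1 : z < 1 by exact: convex_comb_lt1.
have w0 : 0 <= w by rewrite /w; nra.
split => //.
have [->|wn0] := eqVneq w 0.
  exists (1 - z); first by rewrite subr_gt0.
  move=> d /andP[dp dz]; rewrite expr0n gtn_eqF// mul0r subr_ge0.
  by apply: (needle_mono HF) => //; lra.
have wp : 0 < w by rewrite lt_def wn0.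
have bound (a b : R) : 0 < b -> 0 <= a -> exists2 e : R, 0 < e & forall d : R, 0 < d < e -> d / w * a < b.
  move=> b0 a0; exists (b * w / (a + 1)); first by rewrite divr_gt0 ?(mulr_gt0 b0 wp)// ltr_wpDl.
  move=> d /andP[dp]; rewrite ltr_pdivlMr ?ltr_wpDl// => h.
  rewrite mulrAC ltr_pdivrMr//; nra.
have [e1 e10 h1] := bound r d1 d10 r0.
have [e2 e20 h2] := bound r' d2 d20 r'0.
have s1' : 0 < 1 - s by rewrite subr_gt0.
have t1' : 0 < 1 - t by rewrite subr_gt0.
have [e3 e30 h3] := bound r (1 - s) s1' r0.
have [e4 e40 h4] := bound r' (1 - t) t1' r'0.
exists (Num.min (Num.min e1 e2) (Num.min e3 e4)).
  by rewrite !lt_min e10 e20 e30.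
move=> d /andP[dp]; rewrite !lt_min => /andP[/andP[de1 de2] /andP[de3 de4]].
have eta0 : 0 < d / w by rewrite divr_gt0.
set eta := d / w in eta0 *.
(* An interval of length [eta * a] at density [a ^+ m] has mass [eta * a ^+ m.+1], that is
   [(rh * a) ^+ m.+1]. *)
have [rh rh0 rhE] := @nth_root_ex R m eta (ltW eta0).
have g1 : eta * r < d1 by apply: h1; rewrite dp.
have g2 : eta * r' < d2 by apply: h2; rewrite dp.
have g3 : eta * r < 1 - s by apply: h3; rewrite dp.
have g4 : eta * r' < 1 - t by apply: h4; rewrite dp.
have inc (y a dd : R) : 0 <= a -> (forall d : R, 0 < d < dd -> a ^+ m * d <= F (y + d) - F y) ->
    eta * a < dd -> (rh * a) ^+ m.+1 <= F (y + eta * a) - F y.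
  move=> a0 H ha; have [->|an0] := eqVneq a 0.
    by rewrite !mulr0 expr0n/= addr0 subrr.
  have -> : (rh * a) ^+ m.+1 = a ^+ m * (eta * a) by rewrite exprMn rhE exprS; ring.
  by apply: H; rewrite ha andbT mulr_gt0// lt_def an0.
have := needle_bm HF s0 _ _ t0 _ _ _ _ _ (inc s r d1 r0 H1 g1) (inc t r' d2 r'0 H2 g2).
have sq : s <= s + eta * r by rewrite lerDl mulr_ge0// ltW.
have tq : t <= t + eta * r' by rewrite lerDl mulr_ge0// ltW.
move=> /(_ la sq _ tq _).
have -> : la * (rh * r) + (1 - la) * (rh * r') = rh * w by rewrite /w; ring.
have -> : la * (s + eta * r) + (1 - la) * (t + eta * r') = z + d.
  have : eta * w = d by rewrite /eta divfK// gt_eqF.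
  by rewrite /z /w; lra.
have -> : (rh * w) ^+ m.+1 = w ^+ m * d.
  by rewrite exprMn rhE exprS /eta; field; rewrite gt_eqF.
rewrite -/z; apply; rewrite ?la0 ?mulr_ge0//; lra.
Qed.

Definition slopes t : set R := [set r | slope t r].
(** The [m]-th root of the lower right derivative of [F], which avoids assuming a density. *)
Definition dens_root t : R := sup (slopes t).

Lemma slope_has_sup (t : R) : (0 < m)%N -> 0 <= t < 1 -> has_sup (slopes t).
Proof.
move=> m0 /andP[t0 t1]; split.
  exists 0; split => //; exists (1 - t); first by rewrite subr_gt0.
  move=> d /andP[d0 dt]; rewrite expr0n gtn_eqF// mul0r subr_ge0.
  by apply: (needle_mono HF) => //; lra.
have [C C0 CF] := needle_lip HF; exists (C + 1) => r [r0 [d0 d00 H]].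
rewrite leNgt; apply/negP => rC.
pose d := Num.min (d0 / 2) ((1 - t) / 2).
have dd : 0 < d by rewrite lt_min !divr_gt0// subr_gt0.
have d1 : d <= d0 / 2 by rewrite ge_min lexx.
have d2 : d <= (1 - t) / 2 by rewrite ge_min lexx orbT.
have h1 : r ^+ m * d <= F (t + d) - F t by apply: H; rewrite dd /=; lra.
have h2 : F (t + d) - F t <= C * (t + d - t) by apply: CF; lra.
have := le_trans h1 h2; rewrite (addrC t) addrK ler_pM2r//.
have r1 : 1 <= r by lra.
have : r <= r ^+ m by apply: ler_eXnr.
lra.
Qed.

Lemma dens_root_ge0 (t : R) : (0 < m)%N -> 0 <= t < 1 -> 0 <= dens_root t.
Proof.
move=> m0 t01; have [[r rs] ub] := slope_has_sup m0 t01.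
by apply: le_trans (ub_le_sup ub rs); case: rs.
Qed.

Lemma dens_root_concave (s t la : R) : (0 < m)%N -> 0 <= s < 1 -> 0 <= t < 1 -> 0 <= la <= 1 ->
  la * dens_root s + (1 - la) * dens_root t <= dens_root (la * s + (1 - la) * t).
Proof.
move=> m0 s01 t01 la01; apply/ler_addgt0Pr => e e0.
have [r rs re] := sup_adherent e0 (slope_has_sup m0 s01).
have [r' rt re'] := sup_adherent e0 (slope_has_sup m0 t01).
have z01 : 0 <= la * s + (1 - la) * t < 1.
  by case/andP: s01 => ? ?; case/andP: t01 => ? ?; case/andP: la01 => ? ?; rewrite convex_comb_lt1// andbT; nra.
have h : la * r + (1 - la) * r' <= dens_root (la * s + (1 - la) * t) :=
  ub_le_sup (slope_has_sup m0 z01).2 (slope_convex m0 s01 t01 la01 rs rt).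
rewrite -/(dens_root s) -/(dens_root t) in re re'.
case/andP: la01 => la0 la1.
have h1 : la * (dens_root s - e) <= la * r by rewrite ler_wpM2l// ltW.
have h2 : (1 - la) * (dens_root t - e) <= (1 - la) * r'.
  by rewrite ler_wpM2l ?subr_ge0// ltW.
lra.
Qed.

(* The affine majorant is the tangent line of the concave function [dens_root]. *)
Lemma dens_root_tangent (t : R) : (0 < m)%N -> 0 < t < 1 ->
  exists k : R, forall s : R, 0 <= s < 1 -> dens_root s <= dens_root t + k * (s - t).
Proof.
move=> m0 /andP[t0 t1].
have three s s' : 0 <= s < t -> t < s' < 1 ->
    (dens_root s' - dens_root t) / (s' - t) <= (dens_root t - dens_root s) / (t - s).
  move=> /andP[s0 st] /andP[ts' s'1].
  pose la := (s' - t) / (s' - s).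
  have d0 : 0 < s' - s by lra.
  have la01 : 0 <= la <= 1.
    by rewrite divr_ge0 ?ler_pdivrMr//=; lra.
  have s01 : 0 <= s < 1 by apply/andP; split; lra.
  have s'01 : 0 <= s' < 1 by apply/andP; split; lra.
  have := dens_root_concave m0 s01 s'01 la01.
  have -> : la * s + (1 - la) * s' = t by rewrite /la; field; rewrite gt_eqF.
  have laE : la * (s' - s) = s' - t by rewrite /la divfK// gt_eqF.
  rewrite -(ler_pM2r d0) => h.
  rewrite ler_pdivrMr ?subr_gt0// [leRHS]mulrAC ler_pdivlMr ?subr_gt0//.
  move: h.
  have -> : (la * dens_root s + (1 - la) * dens_root s') * (s' - s) =
    (s' - t) * dens_root s + (t - s) * dens_root s'.
    transitivity ((la * (s' - s)) * dens_root s +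
      (s' - s - la * (s' - s)) * dens_root s'); first by ring.
    by rewrite laE; ring.
  lra.
pose Sl := [set (dens_root s - dens_root t) / (s - t) | s in [set s | t < s < 1]].
have st0 : 0 <= (0 : R) < t by rewrite lexx t0.
have hS : has_sup Sl.
  split; first by exists ((dens_root ((t + 1) / 2) - dens_root t) / ((t + 1) / 2 - t)),
    ((t + 1) / 2) => //=; apply/andP; split; lra.
  by exists ((dens_root t - dens_root 0) / (t - 0)) => _ [s /= ts <-]; exact: three.
exists (sup Sl) => s /andP[s0 s1].
have [->|st] := eqVneq s t; first by rewrite subrr mulr0 addr0.
have [ts|ts] := ltP t s.
  rewrite -lerBlDl -ler_pdivrMr ?subr_gt0//; apply: (ub_le_sup hS.2).
  by exists s => //=; rewrite ts.
have {ts}st : s < t by rewrite lt_neqAle st.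
have : sup Sl <= (dens_root t - dens_root s) / (t - s).
  apply: ge_sup; first exact: hS.1.
  by move=> _ [s' /= ts <-]; apply: three => //; rewrite s0.
rewrite ler_pdivlMr ?subr_gt0//; lra.
Qed.

(** The tangent to [dens_root] at [t], raised by [2 * e]: one [e] ensures that [dens_root s + e] is
    not a slope at [s], the other absorbs the variation of the affine function over a short step.
    [growth_le] turns this local comparison into one of masses. *)
Lemma needle_affine_majorant (t e : R) : (0 < m)%N -> 0 < t < 1 -> 0 < e -> exists A k : R,
  [/\ 0 <= A, 0 <= A + k, A + k * t = dens_root t + 2 * e &
   forall p q : R, 0 <= p -> p <= q -> q <= 1 ->
     F q - F p <= affine_prim m A k q - affine_prim m A k p].
Proof.
move=> m0 t01 e0; have [k tan] := dens_root_tangent m0 t01.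
pose A := dens_root t - k * t + 2 * e.
have lge s : 0 <= s < 1 -> dens_root s + 2 * e <= A + k * s.
  by move=> /tan; rewrite /A; lra.
have l0 s : 0 <= s < 1 -> 2 * e <= A + k * s.
  move=> s01; apply: le_trans (lge s s01); rewrite lerDr.
  exact: dens_root_ge0.
(* The tangent bound is available on [[0, 1)] only; the end [1] is reached by continuity of the
   affine function. *)
have l1 : 2 * e <= A + k * 1.
  rewrite leNgt; apply/negP => h.
  have kp : 0 < `|k| + 1 by rewrite ltr_wpDl.
  pose d := Num.min (1 / 2) ((2 * e - (A + k * 1)) / (`|k| + 1) / 2).
  have g0 : 0 < (2 * e - (A + k * 1)) / (`|k| + 1) by rewrite divr_gt0// subr_gt0.
  have d0 : 0 < d by rewrite lt_min !divr_gt0// ?subr_gt0.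
  have d1 : d <= 1 / 2 by rewrite ge_min lexx.
  have d2 : d <= (2 * e - (A + k * 1)) / (`|k| + 1) / 2 by rewrite ge_min lexx orbT.
  have d3 : d * (`|k| + 1) < 2 * e - (A + k * 1).
    by rewrite -ltr_pdivlMr//; lra.
  have h1 : 0 <= 1 - d < 1 by apply/andP; split; lra.
  have := l0 _ h1; have := ler_norm (- k); rewrite normrN => nk.
  by nra.
have l2 s : 0 <= s <= 1 -> 2 * e <= A + k * s.
  move=> /andP[s0]; rewrite le_eqVlt => /orP[/eqP->//|s1].
  by apply: l0; rewrite s0.
have [C C0 CF] := needle_lip HF.
exists A, k; split.
- have := l2 0; rewrite lexx ler01 mulr0 addr0 => /(_ isT); lra.
- have := l1; rewrite mulr1; lra.
- by rewrite /A; ring.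
move=> p q p0 pq q1.
have : F q - affine_prim m A k q <= F p - affine_prim m A k p; last by lra.
apply: (@growth_le _ (fun s => F s - affine_prim m A k s)) => //.
  move=> s /andP[ps sq] d0 d00.
  have s01 : 0 <= s < 1 by apply/andP; split; lra.
  pose r := dens_root s + e.
  have r0 : 0 <= r by rewrite addr_ge0 ?dens_root_ge0// ltW.
  have nr : ~ slope s r.
    move=> sr; have := ub_le_sup (slope_has_sup m0 s01).2 sr.
    by rewrite -/(dens_root s) /r; lra.
  pose d1 := Num.min d0 (Num.min (1 - s) (e / (`|k| + 1))).
  have kp : 0 < `|k| + 1 by rewrite ltr_wpDl.
  have d10 : 0 < d1.
    by rewrite !lt_min d00 divr_gt0// andbT subr_gt0; case/andP: s01.
  have [d [/andP[dp dd1] hd]] : exists d : R, 0 < d < d1 /\ F (s + d) - F s < r ^+ m * d.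
    apply: contrapT => hn; apply: nr; split => //; exists d1 => // d dd1.
    by rewrite leNgt; apply/negP => hd; apply: hn; exists d.
  move: dd1; rewrite !lt_min => /and3P[dd0 ds dk].
  exists d; split; first by rewrite dp.
  have : (s + d - s) * r ^+ m <= affine_prim m A k (s + d) - affine_prim m A k s.
    apply: affine_prim_ge => //; first by rewrite lerDl ltW.
      by have := lge s s01; rewrite /r; lra.
    have := lge s s01; rewrite /r; move: dk; rewrite ltr_pdivlMr// => dk.
    have := ler_norm (- k); rewrite normrN => nk; nra.
  rewrite (addrC s) addrK (addrC _ s); lra.
move=> s /andP[ps sq] e' e'0; exists (e' / (C + 1)).
  by rewrite divr_gt0// ltr_wpDl.
move=> r pr /andP[rs1 rs2].
have h1 : F s - F r <= C * (s - r) by apply: CF; lra.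
have h2 : C * (s - r) <= e'.
  have : (s - r) * (C + 1) < e' by rewrite -ltr_pdivlMr ?ltr_wpDl//; lra.
  by nra.
have : (s - r) * 0 ^+ m <= affine_prim m A k s - affine_prim m A k r.
  apply: affine_prim_ge => //; first exact: ltW.
    by have := l2 r; rewrite (_ : 0 <= r <= 1); [move=> /(_ isT); lra|apply/andP; split; lra].
  by have := l2 s; rewrite (_ : 0 <= s <= 1); [move=> /(_ isT); lra|apply/andP; split; lra].
rewrite expr0n gtn_eqF// mulr0; lra.
Qed.

End NeedleSlope.

(** * Mass gained along an interval of a needle *)

Section NeedleIsoperimetry.
Variables (R : realType) (m : nat) (x c : R) (F : R -> R).
Hypothesis x0 : 0 < x.
Hypothesis x12 : x <= 2^-1.
Hypothesis c0 : 0 < c.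
Hypothesis Hc : forall u v : R, 0 <= u -> 0 <= v ->
  (c * (hom_sum m u v / m.+1%:R)) ^+ m.+1 <= ((1 - x) * u ^+ m.+1 + x * v ^+ m.+1) ^+ m.
Hypothesis HF : needle m F.

Definition profile_lb (p : R) : R := c * Num.min 1 (Num.min (p / x) ((1 - p) / x)).

Lemma needle_01 p : 0 <= p <= 1 -> 0 <= F p <= 1.
Proof.
move=> /andP[p0 p1]; apply/andP; split.
  by rewrite -(needle0 HF); apply: (needle_mono HF).
by rewrite -(needle1 HF); apply: (needle_mono HF).
Qed.

Lemma needle_density (t k : R) : 0 < t < 1 -> k < profile_lb (F t) ->
  exists2 d0 : R, 0 < d0 & forall d : R, 0 < d < d0 -> k * d <= F (t + d) - F t.
Proof.
move=> t01 kpsi; have /andP[t0 t1] := t01.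
(* In dimension one [dens_root] carries no information. There, Brunn-Minkowski between [[0, 1]] and
   a single point already gives density at least [1], while [Hc] forces [c <= 1]. *)
have [m0|m0] := posnP m.
  have c1 : c <= 1.
    have := Hc ler01 ler01; rewrite m0 /hom_sum big_ord_recl big_ord0 /= !expr0 expr1.
    by rewrite addr0 mulr1 divr1 mulr1.
  have k1 : k <= 1.
    apply: le_trans (ltW kpsi) _; apply: le_trans c1.
    by rewrite /profile_lb ger_pMr// ge_min lexx.
  exists (1 - t); first by rewrite subr_gt0.
  move=> d /andP[d0 dt]; have dn : 0 < 1 - d by lra.
  have p'1 : t / (1 - d) <= 1 by rewrite ler_pdivrMr//; lra.
  have p'0 : 0 <= t / (1 - d) by rewrite divr_ge0// ltW.
  have E : (1 - d) * (t / (1 - d)) = t by rewrite mulrC divfK// gt_eqF.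
  have := @needle_bm _ _ _ HF 0 1 (t / (1 - d)) (t / (1 - d)) d 1 0.
  rewrite (needle0 HF) (needle1 HF) m0 !expr1 !mulr0 !mulr1 !subr0 subrr add0r.
  rewrite addr0 E (addrC d) => H.
  apply: (@le_trans _ _ d); first by rewrite ler_piMl// ltW.
  by apply: H => //; lra.
have [kn|k0] := ltP k 0.
  exists (1 - t); first by rewrite subr_gt0.
  move=> d /andP[d0 dt]; apply: (@le_trans _ _ 0); first by rewrite nmulr_rle0// ltW.
  by rewrite subr_ge0; apply: (needle_mono HF); lra.
apply: contrapT => hn.
have [m' mE] : exists m', m = m'.+1 by case: (m) m0 => // m' _; exists m'.
have [rk rk0 rkE] := @nth_root_ex R m' k k0.
have psi0 : 0 <= profile_lb (F t) by apply: le_trans (ltW kpsi).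
have [rp rp0 rpE] := @nth_root_ex R m' _ psi0.
have rkp : rk < rp.
  by rewrite -(@ltr_pXn2r _ m'.+1)// rkE rpE.
have t01' : 0 <= t < 1 by rewrite ltW.
have le_rk : dens_root m F t <= rk.
  apply: ge_sup; first by case: (slope_has_sup HF m0 t01').
  move=> r [r0 [d0 d00 H]]; rewrite leNgt; apply/negP => rkr; apply: hn.
  exists d0 => // d dd; apply: le_trans (H d dd); rewrite ler_wpM2r//.
    by case/andP: dd => /ltW.
  by rewrite mE -rkE lerXn2r ?nnegrE// ltW.
(* With this margin the majorant at [t] is at most halfway from [rk] to [rp], whereas [needle_bound]
   forces it up to [rp]. *)
have e0 : 0 < (rp - rk) / 4 by rewrite divr_gt0// subr_gt0.
have [A [l [A0 Al lt maj]]] := needle_affine_majorant HF m0 t01 e0.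
have y0 : 0 <= A + l * t by rewrite lt addr_ge0 ?(dens_root_ge0 HF)// mulr_ge0// ltW.
have p01 : 0 <= F t <= 1 by apply: needle_01; apply/andP; split; lra.
have := @needle_bound R m x c x0 x12 c0 Hc A (A + l) (A + l * t)
  (affine_prim m A l t - affine_prim m A l 0) (affine_prim m A l 1 - affine_prim m A l t)
  (F t) A0 Al y0 _ _ p01 _ _.
have -> : affine_prim m A l t - affine_prim m A l 0 + (affine_prim m A l 1 - affine_prim m A l t) =
    hom_sum m A (A + l) / m.+1%:R.
  transitivity (affine_prim m A l 1 - affine_prim m A l 0); first by ring.
  by rewrite affine_primB subr0 mul1r mulr0 addr0 mulr1.
have mean := affine_prim_mean m A l t.
have E1 : hom_sum m A (A + l) / m.+1%:R = affine_prim m A l t - affine_prim m A l 0 + (affine_prim m A l 1 - affine_prim m A l t).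
  transitivity (affine_prim m A l 1 - affine_prim m A l 0); last by ring.
  by rewrite affine_primB subr0 mul1r mulr0 addr0 mulr1.
move=> H; have {}H : profile_lb (F t) <= (A + l * t) ^+ m.
  apply: H => //.
  - by rewrite E1 [LHS]mean /= mulr0 addr0 mulr1.
  - by have := maj 0 t (lexx 0) (ltW t0) (ltW t1); rewrite (needle0 HF) subr0.
  - by have := maj t 1 (ltW t0) (ltW t1) (lexx 1); rewrite (needle1 HF).
have : rp <= A + l * t.
  by rewrite -(@ler_pXn2r _ m'.+1)// ?nnegrE// rpE -mE.
rewrite lt; lra.
Qed.

(** On [[b, b + r]] the mass to the left is at least [F b] and the mass to the right at least
    [1 - F (b + r)], so one density bound serves the whole interval; [growth_le] integrates it. *)
Lemma needle_stretch (b r : R) : 0 <= b -> 0 <= r -> b + r <= 1 ->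
  r * (c * Num.min 1 (Num.min (F b / x) ((1 - F (b + r)) / x))) <= F (b + r) - F b.
Proof.
move=> b0 r0 br; set k := c * _.
have brb : b <= b + r by rewrite lerDl.
have [b00|bn0] := eqVneq b 0.
  apply: (@le_trans _ _ 0); last by rewrite subr_ge0; apply: (needle_mono HF).
  apply: mulr_ge0_le0 => //; apply: mulr_ge0_le0; first exact: ltW.
  by rewrite !ge_min b00 (needle0 HF) mul0r lexx orbT.
have bp : 0 < b by rewrite lt_def bn0.
have [C C0 CF] := needle_lip HF.
suff key k' : k' < k -> k' * r <= F (b + r) - F b.
  move: r0; rewrite le_eqVlt => /orP[/eqP<-|rp].
    by rewrite mul0r addr0 subrr.
  rewrite mulrC -ler_pdivlMr//; apply/ler_addgt0Pr => e e0.
  by rewrite -lerBlDr ler_pdivlMr// key//; lra.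
move=> k'k.
have : k' * (b + r) - F (b + r) <= k' * b - F b; last by lra.
apply: (@growth_le _ (fun s => k' * s - F s)) => //.
  move=> s /andP[bs sb] d0 d00.
  have s01 : 0 < s < 1 by apply/andP; split; lra.
  have Fbs : F b <= F s by apply: (needle_mono HF) => //; lra.
  have Fsb : F s <= F (b + r) by apply: (needle_mono HF) => //; lra.
  have [|d1 d10 H] := @needle_density s k' s01.
    apply: (lt_le_trans k'k); rewrite /k /profile_lb ler_pM2l// !le_min !ge_min lexx /=.
    apply/andP; split; apply/orP; right; apply/orP.
      by left; rewrite ler_pM2r ?invr_gt0.
    by right; rewrite ler_pM2r ?invr_gt0// lerB.
  exists (Num.min d0 d1 / 2).
  have dm : 0 < Num.min d0 d1 by rewrite lt_min d00.
  have l0 : Num.min d0 d1 <= d0 by rewrite ge_min lexx.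
  have l1 : Num.min d0 d1 <= d1 by rewrite ge_min lexx orbT.
  split; first by apply/andP; split; lra.
  have := H (Num.min d0 d1 / 2) ltac:(apply/andP; split; lra); lra.
move=> s /andP[bs sb] e e0; exists (e / (`|k'| + 1)); first by rewrite divr_gt0// ltr_wpDl.
move=> s' bs' /andP[h1 h2].
have Fs : F s' <= F s by apply: (needle_mono HF) => //; lra.
have : (s - s') * (`|k'| + 1) < e by rewrite -ltr_pdivlMr ?ltr_wpDl//; lra.
have := ler_norm k'; nra.
Qed.

(** If the gain is below [r * c], then [F (b + r) < x + r * c], so at least [x - r * c] remains to
    the right because [x <= 1/2]. Subtracting [r * c] thus makes [F b] control the whole minimum. *)
Lemma left_stretch (b r : R) : 0 <= b -> 0 <= r -> b + r <= 1 -> F b <= x ->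
  Num.min (r * c) (r * c * ((F b - r * c) / x)) <= F (b + r) - F b.
Proof.
move=> b0 r0 br bx; have := needle_stretch b0 r0 br.
rewrite ge_min; have [_ //|h] := leP (r * c) (F (b + r) - F b).
have rc : 0 <= r * c by rewrite mulr_ge0// ltW.
rewrite orFb => H; apply: le_trans H.
rewrite -mulrA ler_wpM2l// ler_pM2l// !le_min.
have x12' := x12.
apply/and3P; split.
- by rewrite ler_pdivrMr// mul1r; lra.
- by rewrite ler_pM2r ?invr_gt0//; lra.
- by rewrite ler_pM2r ?invr_gt0//; lra.
Qed.

Lemma right_stretch (b r : R) : 0 <= b -> 0 <= r -> b + r <= 1 -> 1 - F (b + r) <= x ->
  Num.min (r * c) (r * c * ((1 - F (b + r) - r * c) / x)) <= F (b + r) - F b.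
Proof.
move=> b0 r0 br bx; have := needle_stretch b0 r0 br.
rewrite ge_min; have [_ //|h] := leP (r * c) (F (b + r) - F b).
have rc : 0 <= r * c by rewrite mulr_ge0// ltW.
rewrite orFb => H; apply: le_trans H.
rewrite -mulrA ler_wpM2l// ler_pM2l// !le_min.
have x12' := x12.
apply/and3P; split.
- by rewrite ler_pdivrMr// mul1r; lra.
- by rewrite ler_pM2r ?invr_gt0//; lra.
- by rewrite ler_pM2r ?invr_gt0//; lra.
Qed.

Lemma middle_stretch (b r : R) : 0 <= b -> 0 <= r -> b + r <= 1 ->
  x <= F b -> F (b + r) <= 1 - x -> r * c <= F (b + r) - F b.
Proof.
move=> b0 r0 br xb bx; apply: le_trans (needle_stretch b0 r0 br).
apply: ler_wpM2l => //; apply: ler_peMr; first exact: ltW.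
by rewrite !le_min lexx !ler_pdivlMr// !mul1r xb /= lerBrDr addrC -lerBrDr.
Qed.

Lemma needle_ivt (p q y : R) : 0 <= p -> p <= q -> q <= 1 -> F p <= y <= F q ->
  exists2 s : R, p <= s <= q & F s = y.
Proof.
move=> p0 pq q1 /andP[py yq].
have [C C0 CF] := needle_lip HF.
pose T := [set s | p <= s <= q /\ F s <= y].
have Tp : T p by split => //; rewrite lexx.
have supT : has_sup T by split; [exists p|exists q => s [/andP[_]]].
have ps : p <= sup T by exact: ub_le_sup supT.2 _ Tp.
have sq : sup T <= q by apply: ge_sup => [|s [/andP[_]]//]; exists p.
exists (sup T); first by rewrite ps.
have Cp : 0 < C + 1 by rewrite ltr_wpDl.
apply/eqP; rewrite eq_le; apply/andP; split; apply/ler_addgt0Pr => e e0.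
  have eC : 0 < e / (C + 1) by rewrite divr_gt0.
  have [s Ts sd] := sup_adherent eC supT.
  have [/andP[ps' _] Fs] := Ts; have ss := ub_le_sup supT.2 Ts.
  have h : F (sup T) - F s <= C * (sup T - s) by apply: CF => //; lra.
  have : (sup T - s) * (C + 1) < e by rewrite -ltr_pdivlMr//; lra.
  nra.
move: sq; rewrite le_eqVlt => /orP[/eqP->|sq]; first by lra.
pose d := Num.min (q - sup T) (e / (C + 1)).
have d0 : 0 < d by rewrite lt_min subr_gt0 sq divr_gt0.
have d1 : d <= q - sup T by rewrite ge_min lexx.
have d2 : d * (C + 1) <= e by rewrite -ler_pdivlMr// ge_min lexx orbT.
have h : F (sup T + d) - F (sup T) <= C * (sup T + d - sup T) by apply: CF; lra.
have : y < F (sup T + d).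
  rewrite ltNge; apply/negP => h'; have Td : T (sup T + d).
    by split => //; apply/andP; split; lra.
  have := ub_le_sup supT.2 Td; lra.
nra.
Qed.

End NeedleIsoperimetry.

(** * Gaps and neighbourhoods in the unit interval *)

Section LineSets.
Variable R : realType.
Implicit Types (A : set R) (r y q z : R).

Definition unit_nbhd A r : set R := [set y | 0 <= y <= 1 /\ exists2 s, A s & `|y - s| <= r].
Definition mirror A : set R := [set s | A (1 - s)].

Lemma mirror_nbhd A r y : unit_nbhd (mirror A) r y <-> unit_nbhd A r (1 - y).
Proof.
split=> -[/andP[y0 y1] [s As ys]]; (split; first by apply/andP; split; lra).
  by exists (1 - s) => //; rewrite (_ : 1 - y - (1 - s) = - (y - s)) ?normrN//; ring.
exists (1 - s); first by rewrite /mirror /= opprB addrC subrK.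
by rewrite (_ : y - (1 - s) = - (1 - y - s)) ?normrN//; ring.
Qed.

(** Here [c1] is the supremum of the part of [A] left of [y0]. As [y0] is farther than [r] from [A],
    the stretch of length [r] after [c1] stops before [y0]. If that part is empty, both ends are set
    to [0]. *)
Lemma left_gap A r y0 : 0 < r -> A `<=` [set s | 0 <= s <= 1] -> 0 <= y0 <= 1 ->
  ~ unit_nbhd A r y0 -> exists c1 r1 : R,
  [/\ [/\ 0 <= c1, c1 <= r1 & r1 <= y0], forall a, A a -> a <= y0 -> a <= c1,
   forall y, c1 < y < r1 -> unit_nbhd A r y &
   [/\ c1 = 0, r1 = 0 & forall a, A a -> ~ a <= y0] \/
   (r1 = c1 + r /\ forall u, (forall a, A a -> a <= y0 -> a <= u) -> c1 <= u)].
Proof.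
move=> r0 A01 /andP[y00 y01] ny.
pose T := [set a | A a /\ a <= y0].
have [T0|/set0P/negP/negPn/eqP T0] := pselect (T !=set0); last first.
  exists 0, 0; split => //.
  - by move=> a Aa ay; have : T a by []; rewrite T0.
  - by move=> y /andP[h1 h2]; have := lt_trans h1 h2; rewrite ltxx.
  - by left; split => // a Aa ay; have : T a by []; rewrite T0.
have far a : T a -> a <= y0 - r.
  move=> [Aa ay]; rewrite leNgt; apply/negP => h; apply: ny; split; first by rewrite y00.
  by exists a => //; rewrite ger0_norm ?subr_ge0//; lra.
have supT : has_sup T by split => //; exists (y0 - r) => a /far.
exists (sup T), (sup T + r); split.
- have [a Ta] := T0; have := ub_le_sup supT.2 Ta; have [/A01/andP[a0 _] _] := Ta => aT.
  split; [lra|lra|]; rewrite -lerBrDr; exact: ge_sup.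
- by move=> a Aa ay; apply: (ub_le_sup supT.2).
- move=> y /andP[h1 h2].
  have e0 : 0 < sup T - (y - r) by lra.
  have [a Ta aT] := sup_adherent e0 supT.
  have aS := ub_le_sup supT.2 Ta.
  have [/[dup] Aa /A01/andP[a0 _] _] := Ta.
  have : sup T <= y0 - r by apply: ge_sup => // a' /far.
  move=> sy; split; first by apply/andP; split; lra.
  by exists a => //; rewrite ger0_norm; lra.
- by right; split => // u ub; apply: ge_sup => // a [Aa ay]; exact: ub.
Qed.

(** Here [b1] is the supremum of the points before [q] that are not near [A], so nothing of [A] lies
    within [r] of it, up to the end points. The extra point [z] lets the left and the mirrored use
    share one point of [A] separating their two stretches. *)
Lemma left_boundary A r q z : 0 < r -> A `<=` [set s | 0 <= s <= 1] -> 0 <= q <= 1 -> q <= z ->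
  exists b1 r1 : R,
  [/\ [/\ 0 <= b1, b1 <= q & b1 <= r1], forall y, b1 < y < q -> unit_nbhd A r y,
   forall y, b1 < y < r1 -> ~ A y, forall s, A s -> `|s - z| <= r -> r1 <= s &
   (b1 = 0 /\ r1 = 0) \/ r1 = b1 + r].
Proof.
move=> r0 A01 /andP[q0 q1] qz.
pose T := [set y | 0 <= y < q /\ ~ unit_nbhd A r y].
have [T0|/set0P/negP/negPn/eqP T0] := pselect (T !=set0); last first.
  exists 0, 0; split => //.
  - move=> y /andP[h1 h2]; apply: contrapT => ny.
    have : T y by split => //; rewrite h2 ltW.
    by rewrite T0.
  - by move=> y /andP[h1 h2]; have := lt_trans h1 h2; rewrite ltxx.
  - by move=> s /A01/andP[].
  - by left.
have supT : has_sup T by split => //; exists q => y [/andP[_ /ltW]].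
have Sq : sup T <= q by apply: ge_sup => // y [/andP[_ /ltW]].
have S0 : 0 <= sup T.
  have [y Ty] := T0; have := ub_le_sup supT.2 Ty; case: Ty => /andP[y0 _] _; lra.
have near_sup a : a < sup T -> exists2 y, T y & a < y <= sup T.
  move=> aS; have e0 : 0 < sup T - a by rewrite subr_gt0.
  have [y Ty yS] := sup_adherent e0 supT; exists y => //.
  by rewrite (ub_le_sup supT.2 Ty) andbT; lra.
have far s : A s -> ~ (sup T - r < s < sup T + r).
  move=> As /andP[h1 h2]; have [|y [/andP[y0 yq] ny] /andP[h3 h4]] := near_sup (s - r); first by lra.
  apply: ny; split; first by apply/andP; split; lra.
  by exists s => //; rewrite ler_norml; apply/andP; split; lra.
exists (sup T), (sup T + r); split.
- by split => //; lra.
- move=> y /andP[h1 h2]; apply: contrapT => ny.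
  have Ty : T y by split => //; apply/andP; split; lra.
  have := ub_le_sup supT.2 Ty; lra.
- by move=> y /andP[h1 h2] Ay; apply: (far y) => //; apply/andP; split; lra.
- move=> s As; rewrite ler_norml => /andP[h1 h2]; rewrite leNgt; apply/negP => h3.
  have [h4|h4] := ltP (sup T - r) s; first by apply: (far s) => //; rewrite h4.
  have sE : s = sup T - r by lra.
  have [|y [/andP[y0 yq] ny] /andP[h5 h6]] := near_sup (sup T - r); first by lra.
  apply: ny; split; first by apply/andP; split; lra.
  by exists s => //; rewrite ler_norml; apply/andP; split; lra.
- by right.
Qed.

End LineSets.

(** * The isoperimetric alternative on a needle *)

Section NeedleSets.
Variables (R : realType) (m : nat) (x c : R) (F : R -> R) (A : set R) (r : R).
Hypothesis x0 : 0 < x.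
Hypothesis x12 : x <= 2^-1.
Hypothesis c0 : 0 < c.
Hypothesis Hc : forall u v : R, 0 <= u -> 0 <= v ->
  (c * (hom_sum m u v / m.+1%:R)) ^+ m.+1 <= ((1 - x) * u ^+ m.+1 + x * v ^+ m.+1) ^+ m.
Hypothesis HF : needle m F.
Hypothesis r0 : 0 < r.
Hypothesis A01 : A `<=` [set s | 0 <= s <= 1].
Hypothesis HA : forall c1 c2 : R, 0 <= c1 -> c1 <= c2 -> c2 <= 1 ->
  A `<=` [set s | s <= c1 \/ c2 <= s] -> x <= F c1 + (1 - F c2).

(** Each of the two side stretches loses [r * c] in its density bound, and the outer masses may fall
    short of [x] by [r * c]: hence the factor [3] in the second-order loss. *)
Definition gain : R := r * c * (1 - 3 * (r * c) / x).

Lemma gain_sum (p1 p2 g1 g2 : R) : 0 <= g1 -> 0 <= g2 ->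
  Num.min (r * c) (r * c * ((p1 - r * c) / x)) <= g1 ->
  Num.min (r * c) (r * c * ((p2 - r * c) / x)) <= g2 ->
  x - r * c <= p1 + p2 -> gain <= g1 + g2.
Proof.
move=> g10 g20; have rc : 0 <= r * c by rewrite mulr_ge0 ?ltW ?r0 ?c0.
have gle : gain <= r * c.
  by rewrite /gain ger_pMr ?mulr_gt0// gerBl divr_ge0 ?(ltW x0)// mulr_ge0.
rewrite !ge_min => /orP[h1 _ _|h1 /orP[h2 _|h2 h]]; [lra|lra|].
apply: le_trans (lerD h1 h2); rewrite /gain -mulrDr ler_wpM2l//.
rewrite -mulrDl ler_pdivlMr// mulrBl mul1r divfK ?gt_eqF//; lra.
Qed.

Lemma gain_le : gain <= r * c.
Proof.
have rc : 0 <= r * c by rewrite mulr_ge0 ?ltW ?r0 ?c0.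
by rewrite /gain ger_pMr ?mulr_gt0// gerBl divr_ge0 ?(ltW x0)// mulr_ge0.
Qed.

(** Covers a side on which the stretch has collapsed to an end of [[0, 1]]. *)
Lemma gain_degenerate : Num.min (r * c) (r * c * ((0 - r * c) / x)) <= 0.
Proof.
have rc : 0 < r * c by rewrite mulr_gt0 ?r0 ?c0.
rewrite ge_min sub0r mulNr mulrN oppr_le0; apply/orP; right.
by rewrite mulr_ge0 ?divr_ge0 ?(ltW rc) ?(ltW x0).
Qed.

Lemma two_sided_gain (l1 r1 l2 r2 : R) : 0 <= l1 <= r1 -> r1 <= 1 -> 0 <= l2 -> l2 <= r2 <= 1 ->
  l1 = 0 /\ r1 = 0 \/ r1 = l1 + r -> l2 = 1 /\ r2 = 1 \/ r2 = l2 + r ->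
  F l1 <= x -> 1 - F r2 <= x -> x - r * c <= F l1 + (1 - F r2) ->
  gain <= (F r1 - F l1) + (F r2 - F l2).
Proof.
move=> /andP[l10 lr1] r11 l20 /andP[lr2 r21] alt1 alt2 Fl1 Fr2.
have mono := needle_mono HF.
have l11 := le_trans lr1 r11; have r20 := le_trans l20 lr2.
apply: (@gain_sum (F l1) (1 - F r2)) => //; rewrite ?subr_ge0 ?mono//.
  case: alt1 => [[-> ->]|r1E]; first by rewrite (needle0 HF) subrr gain_degenerate.
  by move: r11; rewrite r1E => r11; apply: (@left_stretch R m x c F); rewrite ?(ltW r0).
case: alt2 => [[-> ->]|r2E]; first by rewrite (needle1 HF) !subrr gain_degenerate.
move: r21 Fr2; rewrite r2E => r21 Fr2.
by apply: (@right_stretch R m x c F); rewrite ?(ltW r0).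
Qed.

Let MA := mirror A.

Lemma mirror_sub01 : MA `<=` [set s | 0 <= s <= 1].
Proof. by move=> s /A01 /= /andP[h1 h2]; apply/andP; split; lra. Qed.

Section Quantiles.
Variables q q' : R.
Hypothesis q0 : 0 <= q.
Hypothesis qq' : q <= q'.
Hypothesis q'1 : q' <= 1.
Hypothesis Fq : F q = x.
Hypothesis Fq' : F q' = 1 - x.

Lemma middle_gain (b : R) : q <= b -> b + r <= q' -> gain <= F (b + r) - F b.
Proof.
move=> qb bq; apply: le_trans gain_le _; have b0 := le_trans q0 qb.
have br1 := le_trans bq q'1.
apply: (@middle_stretch R m x c F); rewrite ?(ltW r0)//.
  by rewrite -Fq (needle_mono HF)// (le_trans _ br1)// lerDl ltW.
by rewrite -Fq' (needle_mono HF)// addr_ge0// ltW.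
Qed.

(** The run of points near [A] is extended beyond both quantiles. If its mass is below [x + gain],
    the mass outside is at least [x - r * c] because [x <= 1/2], which feeds the gain of the two
    boundary stretches. *)
Lemma core_near : (forall y, q <= y <= q' -> unit_nbhd A r y) ->
  (exists b1 b2 : R, [/\ 0 <= b1, b1 <= b2, b2 <= 1,
     forall y, b1 < y < b2 -> unit_nbhd A r y & x + gain <= F b2 - F b1]) \/
  (exists l1 r1 l2 r2 : R, [/\ [/\ 0 <= l1, l1 <= r1, r1 <= l2, l2 <= r2 & r2 <= 1],
     forall y, l1 < y < r1 -> unit_nbhd A r y /\ ~ A y,
     forall y, l2 < y < r2 -> unit_nbhd A r y /\ ~ A y &
     gain <= (F r1 - F l1) + (F r2 - F l2)]).
Proof.
move=> Q; have mono := needle_mono HF.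
have q01 : 0 <= q <= 1 by rewrite q0 (le_trans qq').
have q'01 : 0 <= 1 - q' <= 1 by rewrite subr_ge0 q'1 gerBl (le_trans q0).
have [b1 [r1 [[b10 b1q b1r1] nb1 nA1 sr1 alt1]]] := left_boundary r0 A01 q01 (lexx q).
have [b2 [r2 [[b20 b2q b2r2] nb2 nA2 sr2 alt2]]] :=
  left_boundary r0 mirror_sub01 q'01 (lerB (lexx 1) qq').
have inner y : b1 < y < 1 - b2 -> unit_nbhd A r y.
  move=> /andP[h1 h2]; have [yq|yq] := ltP y q; first by apply: nb1; rewrite h1.
  have [yq'|yq'] := leP y q'; first by apply: Q; rewrite yq.
  have /nb2/mirror_nbhd : b2 < 1 - y < 1 - q' by rewrite ltrBrDr addrC -ltrBrDr h2 ltrD2l ltrN2.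
  by rewrite opprB addrC subrK.
have [_ [s As sq]] : unit_nbhd A r q by apply: Q; rewrite lexx.
have h1 : r1 <= s by apply: sr1 => //; rewrite distrC.
have h2 : r2 <= 1 - s.
  apply: sr2; first by rewrite /MA /mirror /= opprB addrC subrK.
  by rewrite (_ : 1 - s - (1 - q) = q - s) //; ring.
have /andP[s0 s1] := A01 As.
have b2q' : q' <= 1 - b2 by rewrite lerBrDr addrC -lerBrDr.
have b21 : 1 - b2 <= 1 by rewrite gerBl.
have Fb1 : F b1 <= x by rewrite -Fq mono// (le_trans qq').
have Fb2 : 1 - F (1 - b2) <= x.
  by rewrite lerBlDr -lerBlDl -Fq' mono// (le_trans q0).
have r1r2 : r1 <= 1 - r2 by move: h1 h2; lra.
have r2b2 : 1 - r2 <= 1 - b2 by rewrite lerB.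
have r20 := le_trans b20 b2r2.
have [big|small] := leP (x + gain) (F (1 - b2) - F b1).
  by left; exists b1, (1 - b2); split => //; exact: le_trans (le_trans b1q qq') b2q'.
right; exists b1, r1, (1 - r2), (1 - b2); split => //.
- move=> y /andP[h3 h4]; split; last by apply: nA1; rewrite h3.
  by apply: inner; rewrite h3 (lt_le_trans h4)// (le_trans r1r2).
- move=> y /andP[h3 h4]; split.
    by apply: inner; rewrite h4 (le_lt_trans _ h3)// (le_trans b1r1).
  move=> Ay; apply: (nA2 (1 - y)); last by rewrite /MA /mirror /= opprB addrC subrK.
  by move: h3 h4; move=> *; apply/andP; split; lra.
- apply: two_sided_gain; rewrite ?b10 ?r2b2 ?(le_trans h1)//.
  + by rewrite (le_trans (le_trans b10 b1r1)).
  + case: alt2 => [[-> ->]|->]; first by left; rewrite subr0.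
    by right; ring.
  + by move: gain_le small x12; lra.
Qed.

(** If [A] meets the core [[q, q']], the gap between such a point and [y0] contains a stretch within
    the core, where the density is at least [c]. Otherwise [A] lies outside the core and [HA] bounds
    the two outer masses from below by [x]. *)
Lemma core_far (y0 : R) : q <= y0 <= q' -> ~ unit_nbhd A r y0 ->
  exists l1 r1 l2 r2 : R, [/\ [/\ 0 <= l1, l1 <= r1, r1 <= l2, l2 <= r2 & r2 <= 1],
     forall y, l1 < y < r1 -> unit_nbhd A r y /\ ~ A y,
     forall y, l2 < y < r2 -> unit_nbhd A r y /\ ~ A y &
     gain <= (F r1 - F l1) + (F r2 - F l2)].
Proof.
move=> /andP[qy yq'] ny0; have mono := needle_mono HF.
have rc : 0 < r * c by rewrite mulr_gt0 ?r0 ?c0.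
have y00 := le_trans q0 qy; have y01 := le_trans yq' q'1.
have y001 : 0 <= y0 <= 1 by rewrite y00.
have y001' : 0 <= 1 - y0 <= 1 by rewrite subr_ge0 y01 gerBl.
have ny0' : ~ unit_nbhd MA r (1 - y0).
  by move=> /mirror_nbhd; rewrite opprB addrC subrK.
have [c1 [r1 [[c10 c1r1 r1y] ub1 nb1 alt1]]] := left_gap r0 A01 y001 ny0.
have [c2 [r2 [[c20 c2r2 r2y] ub2 nb2 alt2]]] := left_gap r0 mirror_sub01 y001' ny0'.
have r2y' : y0 <= 1 - r2 by rewrite lerBrDr addrC -lerBrDr.
have r12 := le_trans r1y r2y'.
have rc2 : 1 - r2 <= 1 - c2 by rewrite lerB.
have c21 : 1 - c2 <= 1 by rewrite gerBl.
have ub2' a : A a -> y0 <= a -> 1 - c2 <= a.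
  move=> Aa ya; have := ub2 (1 - a); rewrite /MA /mirror /= opprB addrC subrK => /(_ Aa).
  by move: ya; lra.
have nA1 y : c1 < y < r1 -> unit_nbhd A r y /\ ~ A y.
  move=> /andP[h1 h2]; split; first by apply: nb1; rewrite h1.
  by move=> Ay; have := ub1 y Ay (le_trans (ltW h2) r1y); rewrite leNgt h1.
have nA2 y : 1 - r2 < y < 1 - c2 -> unit_nbhd A r y /\ ~ A y.
  move=> /andP[h1 h2]; split.
    have /nb2/mirror_nbhd : c2 < 1 - y < r2.
      by move: h1 h2; move=> *; apply/andP; split; lra.
    by rewrite opprB addrC subrK.
  by move=> Ay; have := ub2' y Ay (le_trans r2y' (ltW h1)); rewrite leNgt h2.
have empty (P : Prop) (b y : R) : b < y < b -> P.
  by move=> /andP[h1 h2]; have := lt_trans h1 h2; rewrite ltxx.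
have [[s [As qs sq']]|nAQ] := pselect (exists s : R, [/\ A s, q <= s & s <= q']).
  have [sy|ys] := leP s y0.
    case: alt1 => [[_ _ /(_ s As)]//|[r1E _]].
    exists c1, r1, r1, r1; split => //; first by rewrite lexx (le_trans r1y).
      by move=> y; exact: empty.
    rewrite subrr addr0 r1E; apply: middle_gain; first by rewrite (le_trans qs)// ub1.
    by rewrite -r1E (le_trans r1y).
  case: alt2 => [[_ _ /(_ (1 - s))]|[r2E _]].
    by rewrite /MA /mirror /= opprB addrC subrK lerB ?(ltW ys)// => /(_ As).
  have c2E : 1 - c2 = 1 - r2 + r by rewrite r2E; ring.
  exists (1 - r2), (1 - r2), (1 - r2), (1 - c2); split => //.
  - by split => //; exact: le_trans y00 r2y'.
  - by move=> y; exact: empty.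
  - rewrite subrr add0r c2E; apply: middle_gain; first exact: le_trans qy r2y'.
    by rewrite -c2E (le_trans _ sq')// ub2' ?(ltW ys).
have c1q : c1 <= q.
  case: alt1 => [[-> _ _]//|[_]]; apply => a Aa ay.
  rewrite leNgt; apply/negP => qa; apply: nAQ; exists a; split => //; first exact: ltW.
  exact: le_trans ay yq'.
have c2q : q' <= 1 - c2.
  case: alt2 => [[-> _ _]|[_ H]]; first by rewrite subr0.
  rewrite lerBrDr addrC -lerBrDr; apply: H => a Aa ay.
  rewrite leNgt; apply/negP => qa; apply: nAQ; exists (1 - a); split => //.
    by apply: le_trans qy _; move: ay; lra.
  by move: qa; lra.
have r10 := le_trans c10 c1r1.
exists c1, r1, (1 - r2), (1 - c2); split => //.
apply: two_sided_gain; rewrite ?c10 ?rc2 ?(le_trans r1y)//.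
- exact: le_trans y00 r2y'.
- by case: alt1 => [[-> ->]|[->]]; [left|right].
- case: alt2 => [[-> -> _]|[-> _]]; first by left; rewrite subr0.
  by right; ring.
- by rewrite -Fq mono// (le_trans qq').
- by rewrite lerBlDr -lerBlDl -Fq' mono// (le_trans q0).
- apply: (@le_trans _ _ x); first by rewrite gerBl ltW.
  apply: HA => //; first exact: le_trans (le_trans c1q qq') c2q.
  move=> a Aa /=.
  by have [ay|ay] := leP a y0; [left; exact: ub1|right; apply: ub2' => //; exact: ltW].
Qed.

End Quantiles.

(** The alternative reflects that [A] is only a projection: a long run of slices is enough by
    itself, whereas stretches disjoint from [A] are to be added to a set living over [A]. *)
Lemma needle_isoperimetry :
  (exists b1 b2 : R, [/\ 0 <= b1, b1 <= b2, b2 <= 1,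
     forall y, b1 < y < b2 -> unit_nbhd A r y & x + gain <= F b2 - F b1]) \/
  (exists l1 r1 l2 r2 : R, [/\ [/\ 0 <= l1, l1 <= r1, r1 <= l2, l2 <= r2 & r2 <= 1],
     forall y, l1 < y < r1 -> unit_nbhd A r y /\ ~ A y,
     forall y, l2 < y < r2 -> unit_nbhd A r y /\ ~ A y &
     gain <= (F r1 - F l1) + (F r2 - F l2)]).
Proof.
have x1 : 0 <= x <= 1 by move: x0 x12; move=> *; apply/andP; split; lra.
have [q /andP[q0 q1] Fq] : exists2 q : R, 0 <= q <= 1 & F q = x.
  by apply: (needle_ivt HF) => //; rewrite (needle0 HF) (needle1 HF).
have [q' /andP[qq' q'1] Fq'] : exists2 q' : R, q <= q' <= 1 & F q' = 1 - x.
  apply: (needle_ivt HF) => //; rewrite Fq (needle1 HF).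
  by move: x0 x12; move=> *; apply/andP; split; lra.
have [Q|nQ] := pselect (forall y : R, q <= y <= q' -> unit_nbhd A r y).
  exact: core_near q0 qq' q'1 Fq Fq' Q.
right; have [y0 qyq' ny0] : exists2 y0 : R, q <= y0 <= q' & ~ unit_nbhd A r y0.
  by apply: contrapT => h; apply: nQ => y yq; apply: contrapT => ny; apply: h; exists y.
exact: core_far q0 qq' q'1 Fq Fq' _ qyq' ny0.
Qed.

End NeedleSets.

(** * Localization *)

Section Localization.
Variables (R : realType) (m : nat).
Local Notation n := m.+1.
Local Notation V := 'rV[R]_n.
Implicit Types (E K S U : set V) (x y u v : V) (i j : 'I_n) (c al be e M : R).

Lemma lfB i j al be x y : lf i j al be (x - y) = lf i j al be x - lf i j al be y.
Proof. by rewrite /lf !mxE; ring. Qed.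

Lemma lfZ i j al be (t : R) x : lf i j al be (t *: x) = t * lf i j al be x.
Proof. by rewrite /lf !mxE; ring. Qed.

Lemma lf_dual i j al be : i != j -> al != 0 \/ be != 0 ->
  exists u : V, forall t : R, lf i j al be (t *: u) = t.
Proof.
move=> ij ab; have d0 : al ^+ 2 + be ^+ 2 != 0.
  rewrite paddr_eq0 ?sqr_ge0// !sqrf_eq0.
  by apply/negP => /andP[/eqP a0 /eqP b0]; case: ab; rewrite ?a0 ?b0 eqxx.
exists (\row_k ((if k == i then al else if k == j then be else 0) / (al ^+ 2 + be ^+ 2))).
move=> t; rewrite lfZ -[RHS]mulr1; congr (_ * _).
rewrite /lf !mxE eqxx eq_sym (negbTE ij) eqxx.
by field.
Qed.

Lemma lf_null E i j al be c : i != j -> al != 0 \/ be != 0 -> bnd E ->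
  vol (E `&` [set x | lf i j al be x = c]) = 0.
Proof.
move=> ij ab; have [u uZ] := lf_dual ij ab.
exact: (vol_hyperplane (@lfB i j al be) uZ (lt_lf_meas i j al be)).
Qed.

Lemma vol_lf_split E i j al be c : i != j -> al != 0 \/ be != 0 -> bnd E ->
  vol E = vol (E `&` [set x | c <= lf i j al be x]) + vol (E `&` [set x | lf i j al be x <= c]).
Proof.
move=> ij ab bE; rewrite (vol_split bE (lt_lf_meas i j al be c)) addrC; congr (_ + _).
  by congr vol; congr (_ `&` _); apply/seteqP; split => x /=; rewrite leNgt => /negP.
apply/eqP; rewrite eq_le; apply/andP; split.
  by apply: le_vol; [move=> x [Ex /= /ltW]|exact: bndI].
have -> : E `&` [set x | lf i j al be x <= c] =
    (E `&` [set x | lf i j al be x < c]) `|` (E `&` [set x | lf i j al be x = c]).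
  rewrite -setIUr; congr (_ `&` _); apply/seteqP; split => x /=.
    by rewrite le_eqVlt => /orP[/eqP|]; [right|left].
  by case=> [/ltW//|->].
apply: le_trans (volU_le _ _) _; [exact: bndI|exact: bndI|].
by rewrite lf_null// addr0.
Qed.

(** The normal [(1 - 2t, t(1 - t))] is a polynomial half turn from [(1, 0)] to [(-1, 0)] that never
    vanishes. For [t] near [t0] the half-spaces differ on [E] only inside a thin slab around the
    hyperplane at [t0]. *)
Lemma vol_halfspace_cont E i j (c1 c2 : R) : i != j -> bnd E ->
  continuous (fun t : R => vol (E `&`
    [set x | (1 - 2 * t) * c1 + t * (1 - t) * c2 <= lf i j (1 - 2 * t) (t * (1 - t)) x])).
Proof.
move=> ij bE t0; have [M EM] := bE.
have ab0 : 1 - 2 * t0 != 0 \/ t0 * (1 - t0) != 0.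
  have [h|] := eqVneq (1 - 2 * t0) 0; last by left.
  right; have -> : t0 = 2^-1 by lra.
  by rewrite mulf_neq0 ?invr_eq0//; apply: lt0r_neq0; lra.
have [u uZ] := lf_dual ij ab0.
pose f (t : R) (x : V) := lf i j (1 - 2 * t) (t * (1 - t)) x - ((1 - 2 * t) * c1 + t * (1 - t) * c2).
have HE t : [set x | (1 - 2 * t) * c1 + t * (1 - t) * c2 <= lf i j (1 - 2 * t) (t * (1 - t)) x] =
    [set x | 0 <= f t x].
  by apply/seteqP; split => x /=; rewrite subr_ge0.
apply/cvgrPdist_le => e e0.
have [eta eta0 slab] := slab_small (@lfB i j _ _) uZ (lt_lf_meas i j _ _) M e0.
(* A Lipschitz constant in [t] for [f t x], uniform over [x] in [E]. *)
pose B := 2 * (M + `|c1|) + (2 + 2 * `|t0|) * (M + `|c2|) + 1.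
have [M0|Mn] := leP 0 M; last first.
  have E0 : E = set0.
    apply/seteqP; split => // x /EM/(_ i) h.
    by have := le_lt_trans (le_trans (normr_ge0 _) h) Mn; rewrite ltxx.
  by near=> t; rewrite E0 !set0I subrr normr0 ltW.
have B0 : 0 < B.
  by rewrite ltr_wpDl// addr_ge0// mulr_ge0// addr_ge0// mulr_ge0.
have dist t x : E x -> `|t0 - t| <= 1 -> `|f t0 x - f t x| <= `|t0 - t| * B.
  move=> Ex tt; have -> : f t0 x - f t x = (t0 - t) *
      (- 2 * (x ord0 i - c1) + (1 - t - t0) * (x ord0 j - c2)) by rewrite /f /lf; ring.
  rewrite normrM ler_wpM2l// (le_trans (ler_normD _ _))// !normrM normrN.
  rewrite (@ger0_norm _ 2)//.
  have h1 : `|x ord0 i - c1| <= M + `|c1| by rewrite (le_trans (ler_normB _ _))// lerD2r EM.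
  have h2 : `|x ord0 j - c2| <= M + `|c2| by rewrite (le_trans (ler_normB _ _))// lerD2r EM.
  have h3 : `|1 - t - t0| <= 2 + 2 * `|t0|.
    have -> : 1 - t - t0 = 1 + (t0 - t) - 2 * t0 by ring.
    rewrite (le_trans (ler_normB _ _))// normrM (@ger0_norm _ 2)// lerD2r.
    by rewrite (le_trans (ler_normD _ _))// normr1; lra.
  have h4 : `|1 - t - t0| * `|x ord0 j - c2| <= (2 + 2 * `|t0|) * (M + `|c2|).
    by apply: ler_pM.
  by rewrite /B; lra.
near=> t.
have tt : `|t0 - t| <= 1.
  by near: t; apply: cvgr_dist_le => //; exact: cvg_id.
have tB : `|t0 - t| * B < eta / 2.
  rewrite -ltr_pdivlMr//; near: t; apply: cvgr_dist_lt; first exact: cvg_id.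
  by rewrite !divr_gt0.
have T0 : vol (E `&` [set x | - (eta / 2) <= f t0 x < eta / 2]) <= e.
  apply: le_trans (slab (- (eta / 2) + ((1 - 2 * t0) * c1 + t0 * (1 - t0) * c2))).
  apply: le_vol; last by apply: bndI; exact: bnd_cube.
  move=> x [Ex /= /andP[h1 h2]]; split; first by move=> k; exact: EM.
  by rewrite /f in h1 h2; apply/andP; split; lra.
have close s s' : (forall x, E x -> `|f s x - f s' x| < eta / 2) -> s = t0 \/ s' = t0 ->
    vol (E `&` [set x | 0 <= f s x]) <= vol (E `&` [set x | 0 <= f s' x]) + e.
  move=> ss' st.
  apply: (@le_trans _ _ (vol (E `&` [set x | 0 <= f s' x]) +
     vol (E `&` [set x | - (eta / 2) <= f t0 x < eta / 2]))); last by rewrite lerD2l.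
  apply: le_trans (volU_le _ _); [|exact: bndI|exact: bndI].
  apply: le_vol; last by apply: bndU; exact: bndI.
  move=> x [Ex /= fs]; have [h|h] := leP 0 (f s' x); [by left|right; split => //=].
  have := ss' x Ex; rewrite ltr_norml => /andP[h1 h2].
  by case: st => <-; apply/andP; split; lra.
have d1 x : E x -> `|f t0 x - f t x| < eta / 2.
  by move=> Ex; apply: le_lt_trans (dist t x Ex tt) tB.
have d2 x : E x -> `|f t x - f t0 x| < eta / 2 by move=> Ex; rewrite distrC d1.
rewrite !HE ler_norml; apply/andP; split.
  by have := close t t0 d2 (or_intror erefl); lra.
by have := close t0 t d1 (or_introl erefl); lra.
Unshelve. all: by end_near. Qed.

(* Rotating a hyperplane about the codimension-two flat [x i = c1, x j = c2]
   by a half turn swaps its two sides, so some position halves the balance. *)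
Lemma balanced_cut K S (x c1 c2 : R) i j : i != j -> bnd K ->
  vol (S `&` K) = x * vol K -> exists al be : R, [/\ al != 0 \/ be != 0,
    vol (S `&` (K `&` [set y | al * c1 + be * c2 <= lf i j al be y])) =
      x * vol (K `&` [set y | al * c1 + be * c2 <= lf i j al be y]) &
    vol (S `&` (K `&` [set y | lf i j al be y <= al * c1 + be * c2])) =
      x * vol (K `&` [set y | lf i j al be y <= al * c1 + be * c2])].
Proof.
move=> ij bK SK; have bSK : bnd (S `&` K) by apply: bnd_sub bK; exact: subIsetr.
pose cc (t : R) := (1 - 2 * t) * c1 + t * (1 - t) * c2.
pose H (t : R) : set V := [set y | cc t <= lf i j (1 - 2 * t) (t * (1 - t)) y].
pose D (t : R) := vol ((S `&` K) `&` H t) - x * vol (K `&` H t).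
have cD : continuous D.
  move=> t; apply: cvgB; first exact: vol_halfspace_cont.
  by apply: cvgM; [exact: cvg_cst|exact: vol_halfspace_cont].
have D01 : D 0 + D 1 = 0.
  have e1 : (1 : R) != 0 \/ (0 : R) != 0 by left; exact: oner_neq0.
  have h0 : H 0 = [set y | c1 <= lf i j 1 0 y].
    by apply/seteqP; split => y; rewrite /H /cc /= mulr0 subr0 !mul0r mul1r addr0.
  have h1 : H 1 = [set y | lf i j 1 0 y <= c1].
    by apply/seteqP; split => y; rewrite /H /cc /lf /= mulr1 subrr mulr0 !mul0r !addr0; lra.
  rewrite /D h0 h1.
  have sp1 := vol_lf_split c1 ij e1 bK; have sp2 := vol_lf_split c1 ij e1 bSK.
  rewrite SK sp1 mulrDr in sp2; lra.
have [t _ Dt] : exists2 t, t \in `[(0 : R), 1] & D t = 0.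
  apply: IVT => //; first by apply: continuous_subspaceT => t; exact: cD.
  by rewrite ge_min le_max; have [h|h] := leP (D 0) 0; rewrite /= ?orbT; lra.
have ab : 1 - 2 * t != 0 \/ t * (1 - t) != 0.
  have [h|] := eqVneq (1 - 2 * t) 0; last by left.
  right; have -> : t = 2^-1 by lra.
  by rewrite mulf_neq0 ?invr_eq0//; apply: lt0r_neq0; lra.
exists (1 - 2 * t), (t * (1 - t)); split => //.
  by move/eqP: Dt; rewrite /D subr_eq0 -setIA => /eqP.
have sp1 := vol_lf_split (cc t) ij ab bK; have sp2 := vol_lf_split (cc t) ij ab bSK.
move/eqP: Dt; rewrite /D /H subr_eq0 => /eqP Dt.
rewrite SK sp1 mulrDr Dt in sp2; rewrite setIA.
by move/addrI: sp2 => <-.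
Qed.

Lemma lf_cont i j al be : continuous (lf i j al be : V -> R).
Proof.
rewrite (_ : lf i j al be = (fun y : V => al * y ord0 i + be * y ord0 j))//.
have FF := @nbhs_filter (V : topologicalType).
by move=> y; apply: (cvgD (FF := FF y)); apply: (cvgMl_tmp (FF := FF y)); exact: coord_continuous.
Qed.

Lemma convex_body_ge K i j al be c : convex_body K ->
  convex_body (K `&` [set y | c <= lf i j al be y]).
Proof.
move=> [cK bK coK]; split.
- apply: closedI => //; apply: (@preimage_closed _ _ (lf i j al be) [set t | c <= t]).
    by move=> y _; exact: lf_cont.
  exact: closed_ge.
- by move: bK => [M [Mr KM]]; exists M; split => // z Mz y [Ky _]; exact: KM.
- move=> y z t [Ky hy] [Kz hz] t01; split; first exact: coK.
  have /andP[t0 t1] := t01; move: hy hz => /=.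
  have -> : lf i j al be (t *: y + (1 - t) *: z) = t * lf i j al be y + (1 - t) * lf i j al be z.
    by rewrite /lf !mxE; ring.
  by move=> hy hz; nra.
Qed.

Lemma convex_body_le K i j al be c : convex_body K ->
  convex_body (K `&` [set y | lf i j al be y <= c]).
Proof.
move=> cb; have := convex_body_ge i j (- al) (- be) (- c) cb.
congr convex_body; congr (_ `&` _).
by apply/seteqP; split => y; rewrite /lf /= => h; lra.
Qed.

Lemma bnd_bounded K : bounded_set K -> bnd K.
Proof.
move=> [M [_ KM]]; exists (M + 1) => y Ky i.
by rewrite (le_trans (coord_le_norm _ _))// KM// ltrDl.
Qed.

Local Notation flat := (('I_n * 'I_n) * (R * R))%type.

(* [K] lies on one side of a hyperplane containing the flat. *)
Definition pushed (q : flat) K : Prop := exists al be : R, (al != 0 \/ be != 0) /\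
  forall y, K y -> 0 <= al * (y ord0 q.1.1 - q.2.1) + be * (y ord0 q.1.2 - q.2.2).

(** Each flat of [L] doubles the number of pieces; being [pushed] passes to subsets, so later cuts
    keep what earlier ones achieved. Both sides of the desired inequality are additive under a
    cut. *)
Lemma localization (K0 S U : set V) (x Phi : R) (L : seq flat) :
  (forall q, q \in L -> q.1.1 != q.1.2) ->
  (forall K, convex_body K -> K `<=` K0 -> vol (S `&` K) = x * vol K ->
    (forall q, q \in L -> pushed q K) -> Phi * vol K <= vol (U `&` K)) ->
  forall K, convex_body K -> K `<=` K0 -> vol (S `&` K) = x * vol K ->
    Phi * vol K <= vol (U `&` K).
Proof.
elim: L => [|q L IH] Lq base; first by move=> K cK KK0 SK; apply: base.
apply: IH => [q' q'L|K cK KK0 SK sat]; first by apply: Lq; rewrite inE q'L orbT.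
have bK : bnd K by apply: bnd_bounded; case: cK.
have ij : q.1.1 != q.1.2 by apply: Lq; rewrite inE eqxx.
have [al [be [ab h1 h2]]] := balanced_cut q.2.1 q.2.2 ij bK SK.
set c := al * _ + _ in h1 h2.
have bUK : bnd (U `&` K) by apply: bnd_sub bK; exact: subIsetr.
rewrite (vol_lf_split c ij ab bK) (vol_lf_split c ij ab bUK) mulrDr -!setIA.
have mono K' q' : K' `<=` K -> q' \in L -> pushed q' K'.
  by move=> K'K /sat[a [b [nz ab']]]; exists a, b; split => // y /K'K; exact: ab'.
apply: lerD; apply: base => //.
- exact: convex_body_ge.
- by apply: subset_trans KK0; exact: subIsetl.
- move=> q'; rewrite inE => /orP[/eqP->|]; last by apply: mono; exact: subIsetl.
  by exists al, be; split => // y [_ /=]; rewrite /c /lf; lra.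
- exact: convex_body_le.
- by apply: subset_trans KK0; exact: subIsetl.
- move=> q'; rewrite inE => /orP[/eqP->|]; last by apply: mono; exact: subIsetl.
  exists (- al), (- be); split; first by rewrite !oppr_eq0.
  by move=> y [_ /=]; rewrite /c /lf; lra.
Qed.

End Localization.

(** * Coordinate marginals of convex bodies *)

Section ThinPieces.
Variables (R : realType) (m : nat).
Local Notation n := m.+1.
Local Notation V := 'rV[R]_n.
Implicit Types (E K S U : set V) (x y u v : V) (i j : 'I_n) (c al be e M : R).

Lemma slab_box K i : bnd K -> exists2 C : R, 0 <= C & forall lo hi, lo <= hi ->
  vol (K `&` [set y | lo <= y ord0 i <= hi]) <= C * (hi - lo).
Proof.
move=> bK; have [M0 KM0] := bK; pose M := `|M0|.
have KM y : K y -> forall j, `|y ord0 j| <= M.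
  by move=> Ky j; rewrite (le_trans (KM0 y Ky j))// ler_norm.
exists (\prod_(j < n | j != i) (M + M)); first by apply: prodr_ge0 => j _; apply: addr_ge0; exact: normr_ge0.
move=> lo hi lohi.
pose a : V := upd (const_mx (- M)) i lo; pose b : V := upd (const_mx M) i hi.
have ab j : a ord0 j <= b ord0 j.
  by rewrite !mxE; case: eqP => // _; rewrite -subr_ge0 opprK addr_ge0 ?normr_ge0.
rewrite -lee_fin -lam_fin; last exact: bndI.
apply: le_trans (le_lam (y := box a b) _) _.
  move=> y [Ky /= yi] j; rewrite !mxE; case: eqP => [->//|_].
  by rewrite -ler_norml KM.
apply: le_trans (lam_box_le ab) _; rewrite lee_fin /box_vol (bigD1 i)//= !mxE eqxx mulrC.
rewrite le_eqVlt; apply/orP; left; apply/eqP; congr (_ * _).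
by apply: eq_bigr => j /negbTE ji; rewrite !mxE ji opprK.
Qed.

Lemma coord_null K i c : bnd K -> vol (K `&` [set y | y ord0 i = c]) = 0.
Proof.
move=> bK; have [C C0 H] := slab_box i bK.
apply/eqP; rewrite eq_le vol_ge0 andbT.
have := H c c (lexx c); rewrite subrr mulr0; apply: le_trans.
by apply: le_vol; [move=> y [Ky /= ->]; split => //=; rewrite lexx|exact: bndI].
Qed.

Definition below K i c : R := vol (K `&` [set y | y ord0 i <= c]).

Lemma half_slab K i lo hi : bnd K -> lo <= hi ->
  vol (K `&` [set y | lo < y ord0 i <= hi]) = below K i hi - below K i lo.
Proof.
move=> bK lohi; rewrite /below (vol_split (bndI [set y : V | y ord0 i <= hi] bK) (le_coord_meas i lo)).
have -> : K `&` [set y | y ord0 i <= hi] `&` [set y | y ord0 i <= lo] = K `&` [set y | y ord0 i <= lo].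
  by apply/seteqP; split => y /=; [move=> [[Ky _] h]|move=> [Ky h]; split => //; split => //; exact: le_trans lohi].
rewrite addrAC subrr add0r; congr vol; apply/seteqP; split => y /=.
  by move=> [Ky /andP[h1 h2]]; split => //; apply/negP; rewrite -ltNge.
by move=> [[Ky h2] /negP]; rewrite -ltNge => h1; split => //=; rewrite h1.
Qed.

Lemma closed_slab K i lo hi : bnd K -> lo <= hi ->
  vol (K `&` [set y | lo <= y ord0 i <= hi]) = below K i hi - below K i lo.
Proof.
move=> bK lohi; rewrite -half_slab//; apply/eqP; rewrite eq_le; apply/andP; split.
  rewrite -[leRHS]addr0 -(coord_null i lo bK).
  apply: le_trans (volU_le _ _); [|exact: bndI|exact: bndI].
  apply: le_vol; last by apply: bndU; exact: bndI.
  move=> y [Ky /= /andP[]]; rewrite le_eqVlt => /orP[/eqP h|h1] h2; first by right.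
  by left; split => //=; rewrite h1.
by apply: le_vol; [move=> y [Ky /= /andP[/ltW h1 h2]]; split => //=; rewrite h1|exact: bndI].
Qed.

Lemma open_slab K i lo hi : bnd K -> lo <= hi ->
  vol (K `&` [set y | lo < y ord0 i < hi]) = below K i hi - below K i lo.
Proof.
move=> bK lohi; rewrite -half_slab//; apply/eqP; rewrite eq_le; apply/andP; split.
  by apply: le_vol; [move=> y [Ky /= /andP[h2 /ltW h1]]; split => //=; rewrite h1 h2|exact: bndI].
rewrite -[leRHS]addr0 -(coord_null i hi bK).
apply: le_trans (volU_le _ _); [|exact: bndI|exact: bndI].
apply: le_vol; last by apply: bndU; exact: bndI.
move=> y [Ky /= /andP[h1]]; rewrite le_eqVlt => /orP[/eqP h|h2]; first by right.
by left; split => //=; rewrite h1.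
Qed.

Lemma upper_slab K i c : bnd K ->
  vol (K `&` [set y | c <= y ord0 i]) = vol K - below K i c.
Proof.
move=> bK; rewrite (vol_split bK (le_coord_meas i c)) -/(below K i c) addrAC subrr add0r.
apply/eqP; rewrite eq_le; apply/andP; split.
  rewrite -[leRHS]addr0 -(coord_null i c bK).
  apply: le_trans (volU_le _ _); [|exact: bndI|exact: bndI].
  apply: le_vol; last by apply: bndU; exact: bndI.
  move=> y [Ky /=]; rewrite le_eqVlt => /orP[/eqP h|h]; first by right.
  by left; split => //; apply/negP; rewrite -ltNge.
by apply: le_vol; [move=> y [Ky /= /negP]; rewrite -ltNge => /ltW|exact: bndI].
Qed.

Lemma open_slab_meas i lo hi : lebesgue_measurable [set y : V | lo < y ord0 i < hi].
Proof.
rewrite (_ : mkset _ = ~` [set y : V | y ord0 i <= lo] `&` [set y | y ord0 i < hi]).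
  by apply: measI; [exact/measC/le_coord_meas|exact: lt_coord_meas].
apply/seteqP; split => y /=.
  by move=> /andP[h1 h2]; split => //; apply/negP; rewrite -ltNge.
by move=> [/negP]; rewrite -ltNge => -> ->.
Qed.

(* Brunn-Minkowski applied to the slabs of [K]. *)
Lemma coord_needle K i (a b : V) : convex_body K -> 0 < vol K -> K a -> K b ->
  a ord0 i < b ord0 i -> (forall y, K y -> a ord0 i <= y ord0 i <= b ord0 i) ->
  needle m (fun t => below K i (a ord0 i + t * (b ord0 i - a ord0 i)) / vol K).
Proof.
move=> cK V0 Ka Kb ab Kab; have [clK bdK coK] := cK.
have bK := bnd_bounded bdK.
set l := b ord0 i - a ord0 i; have l0 : 0 < l by rewrite subr_gt0.
have lev p q : p <= q -> a ord0 i + p * l <= a ord0 i + q * l.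
  by move=> pq; rewrite lerD2l ler_wpM2r// ltW.
have FB p q : p <= q -> below K i (a ord0 i + q * l) / vol K - below K i (a ord0 i + p * l) / vol K =
    vol (K `&` [set y | a ord0 i + p * l <= y ord0 i <= a ord0 i + q * l]) / vol K.
  by move=> pq; rewrite -mulrBl closed_slab// lev.
split.
- rewrite mul0r addr0 /below (_ : _ `&` _ = K `&` [set y | y ord0 i = a ord0 i]).
    by rewrite coord_null// mul0r.
  apply/seteqP; split => y [Ky /=]; last by move=> ->.
  by move=> h; split => //=; apply/eqP; rewrite eq_le h; case/andP: (Kab y Ky).
- rewrite mul1r addrC subrK /below (_ : _ `&` _ = K) ?divff ?gt_eqF//.
  by apply/seteqP; split => y; [case|move=> Ky; split => //; case/andP: (Kab y Ky)].
- move=> p q _ pq _; rewrite -subr_ge0 FB// divr_ge0// vol_ge0 //.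
- have [C C0 H] := slab_box i bK; exists (C * l / vol K).
    by rewrite divr_ge0 ?vol_ge0// mulr_ge0// ltW.
  move=> p q _ pq _; rewrite FB// mulrAC ler_pM2r ?invr_gt0//.
  apply: le_trans (H _ _ (lev p q pq)) _.
  by rewrite le_eqVlt; apply/orP; left; apply/eqP; ring.
- move=> p q p' q' s al be p0 pq q1 p'0 pq' q'1 /andP[s0 s1] al0 be0 hal hbe.
  (* The end values are treated apart because the slabs are rescaled by [s] and [1 - s], which must
     be positive. *)
  have [s00|sn0] := eqVneq s 0.
    by rewrite s00 !mul0r !subr0 !mul1r !add0r.
  have [s11|sn1] := eqVneq s 1.
    by rewrite s11 !mul1r !subrr !mul0r !addr0.
  have sp : 0 < s by rewrite lt_def sn0.
  have sp' : 0 < 1 - s by rewrite subr_gt0 lt_neqAle sn1.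
  have pqs : s * p + (1 - s) * p' <= s * q + (1 - s) * q'.
    by rewrite lerD// ler_wpM2l// ltW.
  rewrite FB//; rewrite FB// in hal; rewrite FB// in hbe.
  set slab := fun p q => K `&` [set y | a ord0 i + p * l <= y ord0 i <= a ord0 i + q * l].
  rewrite -/(slab _ _) in hal hbe *.
  have [w w0 wE] := @nth_root_ex R m (vol K) (ltW V0).
  have bs p1 q1' : bnd (slab p1 q1') by exact: bndI.
  have ne p1 q1' : 0 <= p1 -> p1 <= q1' -> q1' <= 1 -> slab p1 q1' !=set0.
    move=> h1 h2 h3; exists (p1 *: b + (1 - p1) *: a); split.
      by apply: coK => //; apply/andP; split => //; exact: le_trans h3.
    have e : (p1 *: b + (1 - p1) *: a) ord0 i = a ord0 i + p1 * l.
      by rewrite !mxE /l; ring.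
    by rewrite /= e lexx lev.
  have scal (r : R) (p1 q1' t : R) : 0 < r -> 0 <= p1 -> p1 <= q1' -> q1' <= 1 -> 0 <= t ->
      t ^+ n <= vol (slab p1 q1') / vol K ->
      [/\ bnd [set y | slab p1 q1' (r^-1 *: (y - 0))], [set y | slab p1 q1' (r^-1 *: (y - 0))] !=set0
        & (r * t * w) ^+ n <= vol [set y | slab p1 q1' (r^-1 *: (y - 0))]].
    move=> r0 h1 h2 h3 t0 ht; split; first exact: bnd_scale.
      have [y sy] := ne _ _ h1 h2 h3; exists (r *: y); rewrite /= subr0 scalerA mulVf ?gt_eqF//.
      by rewrite scale1r.
    rewrite vol_scale// -mulrA exprMn ler_pM2l ?exprn_gt0// exprMn wE.
    by rewrite -ler_pdivlMr.
  have [bA neA vA] := scal s p q al sp p0 pq q1 al0 hal.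
  have [bB neB vB] := scal (1 - s) p' q' be sp' p'0 pq' q'1 be0 hbe.
  pose C := slab (s * p + (1 - s) * p') (s * q + (1 - s) * q').
  have cbC : convex_body C.
    have := convex_body_ge i i 1 0 (a ord0 i + (s * p + (1 - s) * p') * l) cK.
    move/(convex_body_le i i 1 0 (a ord0 i + (s * q + (1 - s) * q') * l)).
    congr convex_body; rewrite -setIA; congr (_ `&` _); apply/seteqP; split => y /=.
      by rewrite /lf !mul1r !mul0r !addr0 => -[-> ->].
    by rewrite /lf !mul1r !mul0r !addr0 => /andP[-> ->].
  have cC : compact C by apply: bounded_closed_compact; case: cbC.
  have bC : bnd C by exact: bs.
  have := brunn_minkowski bA bB cC bC neA neB _ _ _ vA vB.
  rewrite -mulrDl exprMn wE ler_pdivlMr//; apply.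
  + move=> y z [/= Ky /andP[y1 y2]] [/= Kz /andP[z1 z2]]; rewrite !subr0 in Ky y1 y2 Kz z1 z2.
    rewrite !mxE in y1 y2 z1 z2.
    have -> : y + z = s *: (s^-1 *: y) + (1 - s) *: ((1 - s)^-1 *: z).
      by rewrite !scalerA !divff ?gt_eqF// !scale1r.
    split; first by apply: coK => //; rewrite s0.
    rewrite /= !mxE; apply/andP; split; nra.
  + by rewrite !mulr_ge0 ?(ltW sp).
  + by rewrite !mulr_ge0 ?(ltW sp').
Qed.

End ThinPieces.

(** * Thin pieces and their needles *)

Section NeedlePieces.
Variables (R : realType) (m : nat).
Local Notation n := m.+1.
Local Notation V := 'rV[R]_n.
Implicit Types (E K S U : set V) (u v : V) (i j : 'I_n) (M : R).

(** Applies the needle alternative to the projection of the part of [S] in [K]. Gaps off that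
    projection are slabs disjoint from [S], so their volume adds to the [x * vol K] already occupied
    by [S]. *)
Lemma needle_piece K S U i (a b : V) (x c rho : R) : 0 < x -> x <= 2^-1 -> 0 < c ->
  (forall u v : R, 0 <= u -> 0 <= v ->
    (c * (hom_sum m u v / n%:R)) ^+ n <= ((1 - x) * u ^+ n + x * v ^+ n) ^+ m) ->
  convex_body K -> 0 < vol K -> K a -> K b -> a ord0 i < b ord0 i ->
  (forall y, K y -> a ord0 i <= y ord0 i <= b ord0 i) ->
  vol (S `&` K) = x * vol K -> 0 < rho -> S `&` K `<=` U ->
  (forall y s, K y -> S s -> K s ->
    `|y ord0 i - s ord0 i| <= rho * (b ord0 i - a ord0 i) -> U y) ->
  (x + gain x c rho) * vol K <= vol (U `&` K).
Proof.
move=> x0 x12 c0 Hc cK V0 Ka Kb ab Kab SK rho0 SU KU.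
have bK : bnd K by apply: bnd_bounded; case: cK.
have HF := coord_needle cK V0 Ka Kb ab Kab.
set l := b ord0 i - a ord0 i in HF KU; have l0 : 0 < l by rewrite subr_gt0.
set F := (fun t : R => _) in HF.
pose A := [set t : R | 0 <= t <= 1 /\ exists s, [/\ S s, K s & s ord0 i = a ord0 i + t * l]].
have A01 : A `<=` [set s | 0 <= s <= 1] by move=> t [].
have bSK : bnd (S `&` K) by apply: bnd_sub bK; exact: subIsetr.
have bUK : bnd (U `&` K) by apply: bnd_sub bK; exact: subIsetr.
have lev p q : (a ord0 i + p * l <= a ord0 i + q * l) = (p <= q) by rewrite lerD2l ler_pM2r.
have levt p q : (a ord0 i + p * l < a ord0 i + q * l) = (p < q) by rewrite ltrD2l ltr_pM2r.
have coordP y : K y -> exists2 t : R, 0 <= t <= 1 & y ord0 i = a ord0 i + t * l.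
  move=> /Kab /andP[h1 h2]; exists ((y ord0 i - a ord0 i) / l).
    by rewrite divr_ge0 ?ler_pdivrMr ?mul1r ?(ltW l0)// ?subr_ge0// /l lerD2r.
  by rewrite divfK ?gt_eqF// addrC subrK.
(* The slabs outside [(c1, c2)] contain the part of [S] in [K], so their volume is at least
   [x * vol K]. *)
have HA c1 c2 : 0 <= c1 -> c1 <= c2 -> c2 <= 1 ->
    A `<=` [set s | s <= c1 \/ c2 <= s] -> x <= F c1 + (1 - F c2).
  move=> c10 c12 c21 Ac.
  have : vol (S `&` K) <= below K i (a ord0 i + c1 * l) + vol (K `&` [set y | a ord0 i + c2 * l <= y ord0 i]).
    apply: le_trans (volU_le _ _); [|exact: bndI|exact: bndI].
    apply: le_vol; last by apply: bndU; exact: bndI.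
    move=> s [Ss Ks]; have [t t01 st] := coordP s Ks.
    have At : A t by split => //; exists s.
    by case: (Ac t At) => h; [left|right]; split => //=; rewrite st lev.
  rewrite upper_slab// SK -ler_pdivlMr// => /le_trans; apply.
  by rewrite /F mulrDl mulrBl divff ?gt_eqF.
have slabF p q : p <= q -> vol (K `&` [set y | a ord0 i + p * l < y ord0 i < a ord0 i + q * l]) =
    (F q - F p) * vol K.
  by move=> pq; rewrite open_slab ?lev// /F -mulrBl divfK// gt_eqF.
have nbU t y : unit_nbhd A rho t -> K y -> y ord0 i = a ord0 i + t * l -> U y.
  move=> [_ [t' [_ [s [Ss Ks sE]]] tt']] Ky yE; apply: (KU y s) => //.
  rewrite yE sE (_ : _ - _ = (t - t') * l); last by ring.
  by rewrite normrM (gtr0_norm l0) ler_wpM2r// ltW.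
have slabT p q y : K y -> a ord0 i + p * l < y ord0 i < a ord0 i + q * l ->
    exists2 t, p < t < q & y ord0 i = a ord0 i + t * l.
  by move=> Ky; have [t _ ->] := coordP y Ky; rewrite !levt; exists t.
have [[b1 [b2 [b10 b12 b21 nb g]]]|[l1 [r1 [l2 [r2 [[l10 l1r1 r1l2 l2r2 r21] nb1 nb2 g]]]]]] :=
    needle_isoperimetry x0 x12 c0 Hc HF rho0 A01 HA.
  apply: (@le_trans _ _ ((F b2 - F b1) * vol K)); first by rewrite ler_pM2r.
  rewrite -slabF//; apply: le_vol => // y [Ky /= yb]; split => //.
  by have [t tb yt] := slabT _ _ _ Ky yb; apply: (nbU t) => //; exact: nb.
pose W1 := [set y : V | a ord0 i + l1 * l < y ord0 i < a ord0 i + r1 * l].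
pose W2 := [set y : V | a ord0 i + l2 * l < y ord0 i < a ord0 i + r2 * l].
rewrite (vol_split bUK (open_slab_meas i (a ord0 i + l1 * l) (a ord0 i + r1 * l))) -/W1.
have bUK1 : bnd (U `&` K `&` ~` W1) by exact: bndI.
rewrite (vol_split bUK1 (open_slab_meas i (a ord0 i + l2 * l) (a ord0 i + r2 * l))) -/W2.
have e1 : (F r1 - F l1) * vol K <= vol (U `&` K `&` W1).
  rewrite -slabF//; apply: le_vol; last exact: bndI.
  move=> y [Ky yW]; split => //; split => //.
  by have [t tb yt] := slabT _ _ _ Ky yW; apply: (nbU t) => //; have [] := nb1 t tb.
have e2 : (F r2 - F l2) * vol K <= vol (U `&` K `&` ~` W1 `&` W2).
  rewrite -slabF//; apply: le_vol; last exact: bndI.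
  move=> y [Ky yW]; split => //; split.
    split => //; have [t tb yt] := slabT _ _ _ Ky yW.
    by apply: (nbU t) => //; have [] := nb2 t tb.
  move=> /andP[_]; have /andP[+ _] := yW => h1 h2; have := lt_trans h1 h2.
  by rewrite levt ltNge r1l2.
have e3 : x * vol K <= vol (U `&` K `&` ~` W1 `&` ~` W2).
  rewrite -SK; apply: le_vol; last by apply: bndI.
  have AS y : S y -> K y -> exists2 t, A t & y ord0 i = a ord0 i + t * l.
    by move=> Sy Ky; have [t t01 yt] := coordP y Ky; exists t => //; split => //; exists y.
  move=> y [Sy Ky]; have [t At yt] := AS y Sy Ky; split.
    split; first by split => //; apply: SU.
    by rewrite /W1 /= yt !levt => /nb1[_]; apply.
  by rewrite /W2 /= yt !levt => /nb2[_]; apply.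
have : gain x c rho * vol K <= (F r1 - F l1 + (F r2 - F l2)) * vol K by rewrite ler_pM2r.
move: e1 e2 e3; lra.
Qed.

Lemma grid_point (M e lo hi : R) (N : nat) : 0 < e -> (M + M) / e + 1 < N%:R ->
  - M <= lo -> hi <= M -> e < hi - lo -> exists k : 'I_N, lo < - M + k%:R * e < hi.
Proof.
move=> e0 Ne Mlo hiM lohi.
have h0 : 0 <= (lo + M) / e by rewrite divr_ge0 ?(ltW e0)//; lra.
have /andP[h1 h2] := truncn_itv h0.
have kN : ((Num.truncn ((lo + M) / e)).+1 < N)%N.
  rewrite -(ltr_nat R) -natr1; apply: le_lt_trans Ne; rewrite lerD2r.
  apply: le_trans h1 _; rewrite ler_pM2r ?invr_gt0//; lra.
exists (Ordinal kN); rewrite /= -natr1.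
move: h1 h2; rewrite -natr1 ler_pdivlMr// ltr_pdivrMr// => h1 h2.
by apply/andP; split; lra.
Qed.

(* The triangle with base [p q] and apex [y] contains no grid point in its interior. *)
Lemma thin_triangle K i j (p q y : V) (M e mu : R) (N : nat) :
  convex_body K -> (forall z, K z -> forall k, `|z ord0 k| <= M) ->
  0 < e -> (M + M) / e + 1 < N%:R ->
  (forall k l : 'I_N, pushed ((i, j), (- M + k%:R * e, - M + l%:R * e)) K) ->
  K p -> K q -> K y -> 2^-1 <= mu <= 1 -> y ord0 i - p ord0 i = mu * (q ord0 i - p ord0 i) ->
  8 * e < `|q ord0 i - p ord0 i| ->
  `|y ord0 j - (p ord0 j + mu * (q ord0 j - p ord0 j))| <= 8 * e.
Proof.
move=> [_ _ coK] KM e0 Ne push Kp Kq Ky /andP[mu0 mu1] yE big.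
rewrite leNgt; apply/negP => dbig.
have midK (z1 z2 : V) (t : R) : K z1 -> K z2 -> 0 <= t <= 1 -> K (z1 + t *: (z2 - z1)).
  move=> K1 K2 t01; have -> : z1 + t *: (z2 - z1) = t *: z2 + (1 - t) *: z1.
    by apply/rowP => k; rewrite !mxE; ring.
  exact: coK.
have between (s t : R) : 2 * e < `|t - s| -> - M <= s <= M -> - M <= t <= M ->
    exists k : 'I_N, (s < - M + k%:R * e < t) || (t < - M + k%:R * e < s).
  move=> st /andP[s1 s2] /andP[t1 t2]; have [h|h] := leP s t.
    rewrite ger0_norm ?subr_ge0// in st.
    have [k kP] := @grid_point M e s t N e0 Ne s1 t2 ltac:(lra).
    by exists k; rewrite kP.
  rewrite ltr0_norm ?subr_lt0// in st.
  have [k kP] := @grid_point M e t s N e0 Ne t1 s2 ltac:(lra).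
  by exists k; rewrite kP orbT.
have coordM (z : V) k : K z -> - M <= z ord0 k <= M.
  by move=> Kz; rewrite -ler_norml KM.
have yp : 4 * e < `|y ord0 i - p ord0 i|.
  by rewrite yE normrM (@ger0_norm _ mu); [nra|lra].
have Khalf : K (p + 2^-1 *: (y - p)) by apply: midK => //; apply/andP; split; lra.
(* A grid value in the half of the edge nearer to [y]; there the triangle keeps more than half of
   its defect in coordinate [j]. *)
have [k kP] := between ((p + 2^-1 *: (y - p)) ord0 i) (y ord0 i) ltac:(
  rewrite !mxE (_ : y ord0 i - (p ord0 i + 2^-1 * (y ord0 i - p ord0 i)) = 2^-1 * (y ord0 i - p ord0 i)); [|by field];
  rewrite normrM ger0_norm//; lra) (coordM _ _ Khalf) (coordM _ _ Ky).
set c1 := - M + k%:R * e in kP.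
have yp0 : y ord0 i - p ord0 i != 0 by rewrite -normr_gt0; lra.
pose th := (c1 - p ord0 i) / (y ord0 i - p ord0 i).
have thE : c1 = p ord0 i + th * (y ord0 i - p ord0 i).
  by rewrite /th divfK// addrC subrK.
have /andP[th1 th2] : 2^-1 < th < 1.
  move: kP; rewrite thE !mxE.
  have [h|h] := ltP 0 (y ord0 i - p ord0 i).
    case/orP => /andP[h1 h2]; first by apply/andP; split; nra.
    by exfalso; nra.
  have {}h : y ord0 i - p ord0 i < 0 by rewrite lt_neqAle yp0.
  case/orP => /andP[h1 h2]; last by apply/andP; split; nra.
  by exfalso; nra.
have K1 : K (p + th *: (y - p)) by apply: midK => //; apply/andP; split; lra.
have K2 : K (p + (th * mu) *: (q - p)) by apply: midK => //; apply/andP; split; nra.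
(* At abscissa [c1] the segments from [p] to [y] and to [q] differ by more than [4 * e] in
   coordinate [j], so a grid value lies strictly between them. *)
have [l lP] := between ((p + th *: (y - p)) ord0 j) ((p + (th * mu) *: (q - p)) ord0 j) ltac:(
  rewrite distrC !mxE (_ : _ - _ = th * (y ord0 j - (p ord0 j + mu * (q ord0 j - p ord0 j)))); [|by ring];
  rewrite normrM (@ger0_norm _ th); [nra|lra]) (coordM _ _ K1) (coordM _ _ K2).
have [al [be [ab H]]] := push k l; rewrite /= -/c1 in H.
set c2 := - M + l%:R * e in lP H.
have H1 := H _ K1; have H2 := H _ K2.
have i1 : (p + th *: (y - p)) ord0 i = c1 by rewrite !mxE thE.
have i2 : (p + (th * mu) *: (q - p)) ord0 i = c1 by rewrite !mxE thE yE; ring.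
rewrite i1 subrr mulr0 add0r in H1; rewrite i2 subrr mulr0 add0r in H2.
set z1 := (p + th *: (y - p)) ord0 j in lP H1.
set z2 := (p + (th * mu) *: (q - p)) ord0 j in lP H2.
(* Two points of [K] with [i]-coordinate [c1] lie strictly on either side of the flat, so the
   supporting form cannot depend on coordinate [j]. *)
have be0 : be = 0.
  apply/eqP; rewrite eq_le; apply/andP; split; rewrite leNgt; apply/negP => hb;
    case/orP: lP => /andP[h1 h2]; nra.
have H3 := H _ Kp; have H4 := H _ Ky.
rewrite be0 mul0r addr0 in H3; rewrite be0 mul0r addr0 in H4.
(* The points [p] and [y] lie strictly on opposite sides of [x i = c1], so the form vanishes, a
   contradiction. *)
have al0 : al = 0.
  have e3 : p ord0 i - c1 = - th * (y ord0 i - p ord0 i) by rewrite thE; ring.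
  have e4 : y ord0 i - c1 = (1 - th) * (y ord0 i - p ord0 i) by rewrite thE; ring.
  rewrite e3 in H3; rewrite e4 in H4.
  have : al * (y ord0 i - p ord0 i) = 0.
    by apply/eqP; rewrite eq_le; apply/andP; split; nra.
  by move/eqP; rewrite mulf_eq0 (negbTE yp0) orbF => /eqP.
by case: ab; rewrite ?al0 ?be0 eqxx.
Qed.

Lemma widest_coord K : convex_body K -> 0 < vol K -> exists i (a b : V),
  [/\ K a, K b, a ord0 i < b ord0 i,
   (forall y, K y -> a ord0 i <= y ord0 i <= b ord0 i) &
   (forall y z j, K y -> K z -> `|y ord0 j - z ord0 j| <= b ord0 i - a ord0 i)].
Proof.
move=> [clK bdK coK] V0; have bK := bnd_bounded bdK.
have cK := bounded_closed_compact bdK clK.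
have K0 : K !=set0.
  by apply/set0P/eqP => K0; rewrite K0 vol0 ltxx in V0.
have cont i : {within K, continuous (fun y : V => y ord0 i)}.
  by apply: continuous_subspaceT; exact: coord_continuous.
have /choice[a aP] : forall i, exists a, K a /\ forall y, K y -> a ord0 i <= y ord0 i.
  move=> i; have [a /set_mem Ka H] := EVT_min_rV K0 cK (cont i).
  by exists a; split => // y /mem_set; exact: H.
have /choice[b bP] : forall i, exists b, K b /\ forall y, K y -> y ord0 i <= b ord0 i.
  move=> i; have [b /set_mem Kb H] := EVT_max_rV K0 cK (cont i).
  by exists b; split => // y /mem_set; exact: H.
pose w i := b i ord0 i - a i ord0 i.
have [i _ wmax] := @arg_maxP _ _ _ ord0 xpredT w isT.
have [Ka Ha] := aP i; have [Kb Hb] := bP i.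
exists i, (a i), (b i); split => //.
- rewrite ltNge; apply/negP => ba.
  have [C C0 H] := slab_box i bK.
  have := H (a i ord0 i) (a i ord0 i) (lexx _); rewrite subrr mulr0 leNgt => /negP; apply.
  rewrite (_ : _ `&` _ = K)//; apply/seteqP; split => y; first by case.
  move=> Ky; split => //=; rewrite Ha// (le_trans (Hb y Ky)) //.
- by move=> y Ky; rewrite Ha// Hb.
- move=> y z j Ky Kz; apply: (@le_trans _ _ (w j)); last exact: wmax.
  have [_ Haj] := aP j; have [_ Hbj] := bP j.
  have := Haj y Ky; have := Haj z Kz; have := Hbj y Ky; have := Hbj z Kz.
  by rewrite /w ler_norml => *; apply/andP; split; lra.
Qed.

Lemma thin_piece K (M e : R) (N : nat) : convex_body K -> 0 < vol K ->
  (forall z, K z -> forall k, `|z ord0 k| <= M) -> 0 < e -> (M + M) / e + 1 < N%:R ->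
  (forall i j (k l : 'I_N), i != j -> pushed ((i, j), (- M + k%:R * e, - M + l%:R * e)) K) ->
  exists i (a b : V), [/\ K a, K b, a ord0 i < b ord0 i,
    (forall y, K y -> a ord0 i <= y ord0 i <= b ord0 i) &
    forall y, K y -> forall j, `|y ord0 j - (a ord0 j +
       (y ord0 i - a ord0 i) / (b ord0 i - a ord0 i) * (b ord0 j - a ord0 j))| <= 8 * e].
Proof.
move=> cK V0 KM e0 Ne push.
have [i [a [b [Ka Kb ab Kab wide]]]] := widest_coord cK V0.
exists i, a, b; split => // y Ky j.
set l := b ord0 i - a ord0 i in wide *; have l0 : 0 < l by rewrite subr_gt0.
pose mu := (y ord0 i - a ord0 i) / l; rewrite -/mu.
have muE : y ord0 i - a ord0 i = mu * l by rewrite /mu divfK// gt_eqF.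
have /andP[y1 y2] := Kab y Ky.
have mu0 : 0 <= mu by rewrite divr_ge0 ?(ltW l0)// subr_ge0.
have mu1 : mu <= 1 by rewrite ler_pdivrMr// mul1r /l lerD2r.
have [ij|ij] := eqVneq j i.
  have -> : y ord0 j - (a ord0 j + mu * (b ord0 j - a ord0 j)) = 0.
    by rewrite ij -/l -muE; ring.
  by rewrite normr0 mulr_ge0// ltW.
(* If even the widest coordinate is short, the piece is small in every direction and the estimate is
   immediate. *)
have [small|big] := leP l (8 * e).
  apply: le_trans small; have [_ _ coK] := cK.
  have Kz : K (mu *: b + (1 - mu) *: a) by apply: coK => //; rewrite mu0.
  have := wide y _ j Ky Kz; rewrite !mxE.
  by rewrite (_ : mu * b ord0 j + (1 - mu) * a ord0 j = a ord0 j + mu * (b ord0 j - a ord0 j)); last by ring.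
have ji : i != j by rewrite eq_sym.
(* The triangle is based at whichever end of the chord is farther from [y], so that the parameter is
   at least [1/2]. *)
have [h|h] := leP 2^-1 mu.
  apply: (@thin_triangle K i j a b y M e mu N) => //.
  - by move=> k k'; exact: push.
  - by rewrite h.
  - by rewrite -/l ger0_norm// ltW.
have -> : a ord0 j + mu * (b ord0 j - a ord0 j) = b ord0 j + (1 - mu) * (a ord0 j - b ord0 j) by ring.
apply: (@thin_triangle K i j b a y M e (1 - mu) N) => //.
- by move=> k k'; exact: push.
- by apply/andP; split; lra.
- have -> : a ord0 i - b ord0 i = - l by rewrite /l; ring.
  have -> : y ord0 i - b ord0 i = (y ord0 i - a ord0 i) - l by rewrite /l; ring.
  by rewrite muE; ring.
- by rewrite distrC -/l ger0_norm// ltW.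
Qed.

End NeedlePieces.

(** * The lower bound *)

Section LowerBound.
Variables (R : realType) (m : nat).
Local Notation n := m.+1.
Local Notation V := 'rV[R]_n.
Variable N : V -> R.
Hypothesis HN : is_norm N.
Implicit Types (K S U : set V) (M : R).

Lemma norm_zero : N 0 = 0.
Proof. by have [_ _ NZ _] := HN; rewrite -(scale0r (0 : V)) NZ normr0 mul0r. Qed.

Definition norm_const : R := \sum_(j < n) N 'e_j.

Lemma norm_const_ge0 : 0 <= norm_const.
Proof. by have [N0 _ _ _] := HN; apply: sumr_ge0 => j _; exact: N0. Qed.

Lemma norm_le (y : V) (M : R) : (forall j, `|y ord0 j| <= M) -> N y <= M * norm_const.
Proof.
have [N0 _ NZ NT] := HN; move=> yM.
have sumN (I : Type) (s : seq I) (f : I -> V) : N (\sum_(i <- s) f i) <= \sum_(i <- s) N (f i).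
  elim: s => [|i s IH]; first by rewrite !big_nil norm_zero.
  by rewrite !big_cons (le_trans (NT _ _))// lerD2l.
rewrite [y]row_sum_delta (le_trans (sumN _ _ _))// /norm_const mulr_sumr.
by apply: ler_sum => j _; rewrite NZ ler_wpM2r.
Qed.

Lemma norm_le_diam K (a b : V) : bnd K -> K a -> K b -> N (b - a) <= diam N K.
Proof.
move=> [M KM] Ka Kb; apply: ub_le_sup; last by exists b => //; exists a.
exists ((M + M) * norm_const) => _ [y Ky [z Kz ->]]; apply: norm_le => j.
by rewrite !mxE (le_trans (ler_normB _ _))// lerD// KM.
Qed.

Lemma diam_gt0 K : convex_body K -> 0 < vol K -> 0 < diam N K.
Proof.
move=> cK V0; have bK : bnd K by apply: bnd_bounded; case: cK.
have [i [a [b [Ka Kb ab _ _]]]] := widest_coord cK V0.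
apply: lt_le_trans (norm_le_diam bK Ka Kb).
have [N0 Neq0 _ _] := HN; rewrite lt_def N0 andbT; apply/eqP => /Neq0 ba.
have : (b - a) ord0 i = 0 by rewrite ba mxE.
by rewrite !mxE => /eqP; rewrite subr_eq0 => /eqP bai; rewrite bai ltxx in ab.
Qed.

Lemma profile_bound (x c w : R) : 0 < x < 1 -> 0 < c -> 1 <= w -> extremal_ratio m x w ->
  c ^+ n * geo n w ^+ n = n%:R ^+ n * (1 - x + x * w ^+ n) ^+ m ->
  forall u v : R, 0 <= u -> 0 <= v ->
  (c * (hom_sum m u v / n%:R)) ^+ n <= ((1 - x) * u ^+ n + x * v ^+ n) ^+ m.
Proof.
move=> x01 c0 w1 Rel cE u v u0 v0; have w0 : 0 < w by apply: lt_le_trans w1.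
have := extremal_ratio_le x01 w0 Rel u0 v0.
set A := 1 - x + _ in cE *; set B := _ + x * v ^+ n.
have A0 : 0 < A.
  by case/andP: x01 => x0 x1; rewrite /A addr_gt0 ?subr_gt0// mulr_gt0// exprn_gt0.
have P0 : 0 < n%:R ^+ n * A ^+ m by rewrite mulr_gt0 ?exprn_gt0.
move=> h; rewrite -(ler_pM2l P0).
have -> : n%:R ^+ n * A ^+ m * (c * (hom_sum m u v / n%:R)) ^+ n =
    c ^+ n * (hom_sum m u v ^+ n * A ^+ m).
  have nn : n%:R ^+ n != 0 :> R by rewrite expf_neq0// pnatr_eq0.
  rewrite exprMn expr_div_n; move: nn; set d := n%:R ^+ n => nn.
  by field.
by rewrite -cE -mulrA ler_pM2l// exprn_gt0.
Qed.

(** A displacement inside a thin piece splits into a part along the chord, allotted [(1 - eta) * h],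
    and a transverse error, allotted [eta * h]. Chord lengths are bounded by the diameter of [K],
    which gives the same [rho] for every piece. *)
Lemma vol_nbhd_ge K S (x c h eta : R) : convex_body K -> 0 < vol K ->
  0 < x -> x <= 2^-1 -> 0 < c ->
  (forall u v : R, 0 <= u -> 0 <= v ->
    (c * (hom_sum m u v / n%:R)) ^+ n <= ((1 - x) * u ^+ n + x * v ^+ n) ^+ m) ->
  vol (S `&` K) = x * vol K -> 0 < h -> 0 < eta < 1 ->
  (x + gain x c ((1 - eta) * h / diam N K)) * vol K <= vol (nbhd_h N S h `&` K).
Proof.
move=> cK V0 x0 x12 c0 Hc SK h0 /andP[eta0 eta1].
have bK : bnd K by apply: bnd_bounded; case: cK.
have [M KM] := bK; have D0 := diam_gt0 cK V0; set D := diam N K in D0 *.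
have C0 := norm_const_ge0.
have [N0 _ NZ NT] := HN.
have C1 : 0 < 16 * (norm_const + 1) by rewrite mulr_gt0// ltr_wpDl.
(* Both points deviate from the chord by at most [8 * e] per coordinate, hence the factor [16]. *)
pose e := eta * h / (16 * (norm_const + 1)).
have e0 : 0 < e by rewrite divr_gt0// mulr_gt0.
pose k := (Num.truncn ((M + M) / e + 1)).+1.
have Nk : (M + M) / e + 1 < k%:R by exact: truncnS_gt.
pose rho := (1 - eta) * h / D.
have rho0 : 0 < rho by rewrite divr_gt0// mulr_gt0// subr_gt0.
pose fl (p : 'I_n * 'I_n) (q : 'I_k * 'I_k) : ('I_n * 'I_n) * (R * R) :=
  (p, (- M + q.1%:R * e, - M + q.2%:R * e)).
pose L := [seq fl p q | p <- [seq p <- enum {: 'I_n * 'I_n} | p.1 != p.2], q <- enum {: 'I_k * 'I_k}].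
apply: (@localization R m K S _ x _ L) => //.
  by move=> q /allpairsP[[p q'] /= [+ _ ->]]; rewrite mem_filter => /andP[].
move=> K' cK' K'K SK' pushL.
have [V'0|V'n0] := eqVneq (vol K') 0; first by rewrite V'0 mulr0 vol_ge0.
have {V'n0}V'0 : 0 < vol K' by rewrite lt_def V'n0 vol_ge0.
have [|i [a [b [Ka Kb ab Kab thin]]]] := thin_piece cK' V'0 (fun z K'z => KM z (K'K z K'z)) e0 Nk.
  move=> i j q1 q2 ij; apply: (pushL (fl (i, j) (q1, q2))).
  by apply: allpairs_f; rewrite ?mem_enum// mem_filter ij mem_enum.
apply: (needle_piece x0 x12 c0 Hc cK' V'0 Ka Kb ab Kab SK' rho0).
  by move=> y [Sy _]; exists y => //; rewrite subrr norm_zero ltW.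
move=> y s Ky Ss Ks; set l := b ord0 i - a ord0 i => ys.
have l0 : 0 < l by rewrite subr_gt0.
exists s => //.
pose t := (y ord0 i - s ord0 i) / l.
have -> : y - s = t *: (b - a) + (y - s - t *: (b - a)) by rewrite [RHS]addrC subrK.
rewrite (le_trans (NT _ _))// NZ.
have h1 : `|t| * N (b - a) <= (1 - eta) * h.
  apply: (@le_trans _ _ (rho * D)); last by rewrite /rho divfK// gt_eqF.
  apply: ler_pM => //; last by apply: norm_le_diam => //; exact: K'K.
  by rewrite /t normrM normfV (gtr0_norm l0) ler_pdivrMr.
have h2 : N (y - s - t *: (b - a)) <= (16 * e) * norm_const.
  apply: norm_le => j.
  have := thin y Ky j; have := thin s Ks j; rewrite -/l => hs hy.
  have -> : (y - s - t *: (b - a)) ord0 j =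
      (y ord0 j - (a ord0 j + (y ord0 i - a ord0 i) / l * (b ord0 j - a ord0 j))) -
      (s ord0 j - (a ord0 j + (s ord0 i - a ord0 i) / l * (b ord0 j - a ord0 j))).
    by rewrite !mxE /t; field; rewrite gt_eqF.
  by rewrite (le_trans (ler_normB _ _))//; lra.
have h3 : (16 * e) * norm_const <= eta * h.
  have : e * (16 * (norm_const + 1)) = eta * h by rewrite /e divfK// gt_eqF.
  by nra.
by move: h1 h2 h3; clear; lra.
Qed.

Theorem diam_boundary_ge K : convex_body K -> (0 < lebesgue_outer K)%E ->
  forall S, S `<=` K -> lebesgue_measurable S -> 0 < unif K S <= 2^-1 ->
  forall L : R, boundary_measure N K S L ->
  unif K S * G n (unif K S)^-1 <= diam N K * L.
Proof.
move=> cK lK S SK mS x012 L HL.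
have bK : bnd K by apply: bnd_bounded; case: cK.
have V0 : 0 < vol K by rewrite -lte_fin -lam_fin.
have uE A : unif K A = vol (A `&` K) / vol K by [].
set x := unif K S in x012 *.
have [w [w1 Rel]] := G_extremal m x012; set c := x * _ => c0 cE.
have /andP[x0 x12] := x012.
have x01 : 0 < x < 1 by apply/andP; split; lra.
have Hc := profile_bound x01 c0 w1 Rel cE.
have SKx : vol (S `&` K) = x * vol K by rewrite /x uE divfK// gt_eqF.
have D0 := diam_gt0 cK V0; set D := diam N K in D0 *.
(* [B] collects the loss from the thinness allowance and the quadratic loss in [gain], both of order
   [h] after division by [h]. *)
pose k := c / D; pose B := k + 3 * k ^+ 2 / x.
have k0 : 0 < k by rewrite divr_gt0.
have B0 : 0 < B by rewrite addr_gt0// divr_gt0// mulr_gt0// exprn_gt0.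
have low h : 0 < h < 1 -> k - h * B <= unif K (nbhd_h N S h `\` S) / h.
  move=> /andP[h0 h1].
  (* The allowance [eta] is taken equal to [h], so that its effect vanishes in the limit. *)
  have h01 : 0 < h < 1 by rewrite h0.
  have := vol_nbhd_ge cK V0 x0 x12 c0 Hc SKx h0 h01; rewrite -/D.
  set rho := _ * h / D => big.
  have bUK : bnd (nbhd_h N S h `&` K) by apply: bnd_sub bK; exact: subIsetr.
  have sub : vol (nbhd_h N S h `&` K `&` S) <= x * vol K.
    rewrite -SKx; apply: le_vol; last by apply: bnd_sub bK; exact: subIsetr.
    by move=> y [[_ Ky] Sy].
  have gainV : gain x c rho * vol K <= vol ((nbhd_h N S h `\` S) `&` K).
    rewrite (vol_split bUK mS) in big.
    have -> : (nbhd_h N S h `\` S) `&` K = nbhd_h N S h `&` K `&` ~` S.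
      by rewrite setDE setIAC.
    by move: big sub; clear; lra.
  rewrite uE ler_pdivlMr//; apply: (@le_trans _ _ (gain x c rho)); last by rewrite ler_pdivlMr.
  have rc : rho * c = (1 - h) * h * k by rewrite /rho /k; field; rewrite gt_eqF.
  rewrite /gain rc /B.
  have -> : (1 - h) * h * k * (1 - 3 * ((1 - h) * h * k) / x) =
    h * ((1 - h) * k) - (1 - h) ^+ 2 * (h ^+ 2 * (3 * k ^+ 2 / x)) by ring.
  have -> : (k - h * (k + 3 * k ^+ 2 / x)) * h = h * ((1 - h) * k) - h ^+ 2 * (3 * k ^+ 2 / x) by ring.
  rewrite lerD2l lerN2 ler_piMl//; last by rewrite expr_le1//; lra.
  by rewrite mulr_ge0 ?exprn_ge0 ?(ltW h0)// divr_ge0 ?(ltW x0)// mulr_ge0 ?exprn_ge0 ?(ltW k0).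
have kL : k <= L.
  apply/ler_addgt0Pr => e e0; rewrite -lerBlDr.
  apply: (cvgr_to_ge HL); near=> h.
  have h0 : 0 < h by near: h; exact: nbhs_right_gt.
  have h1 : h < 1 by near: h; exact: nbhs_right_lt.
  have hB : h * B <= e.
    by rewrite -ler_pdivlMr//; near: h; apply: nbhs_right_le; rewrite divr_gt0.
  apply: le_trans (low h _); last by rewrite h0.
  by rewrite lerB.
by rewrite mulrC -ler_pdivrMr.
Unshelve. all: by end_near. Qed.

End LowerBound.

(** * Sharpness *)

Section Sharpness.
Variables (R : realType) (m : nat).
Local Notation n := m.+1.
Local Notation V := 'rV[R]_n.
Local Notation o := (@ord0 m).
Variable N : V -> R.
Hypothesis HN : is_norm N.
Implicit Types (K S U : set V).

Lemma norm_cont (y : (V : topologicalType)) : N z @[z --> y] --> N y.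
Proof.
have [N0 _ NZ NT] := HN; have C0 := norm_const_ge0 HN.
have FF := @nbhs_filter (V : topologicalType) y.
apply/(cvgrPdist_le (FF := FF)) => e e0.
have C1 : 0 < norm_const N + 1 by rewrite ltr_wpDl.
have Nlip (a b : V) : N a - N b <= `|a - b| * norm_const N.
  rewrite lerBlDr -[X in N X <= _](subrK b a) (le_trans (NT _ _))// lerD2r.
  by apply: norm_le => // j; exact: coord_le_norm.
apply/nbhs_ballP; exists (e / (norm_const N + 1)) => /= [|z]; first by rewrite divr_gt0.
rewrite -ball_normE /= ltr_pdivlMr// => /ltW yz'.
have yz : `|y - z| * norm_const N <= e.
  by apply: le_trans yz'; rewrite ler_wpM2l// lerDl.
have h1 := Nlip y z; have h2 := Nlip z y; rewrite distrC in h2.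
by rewrite ler_norml; apply/andP; split; lra.
Qed.

(* [v] is a direction in which the coordinate [o] attains its dual norm. *)
Lemma norming_vector : exists (k : R) (v : V),
  [/\ 0 < k, v ord0 o = 1, N v = k & forall y : V, k * `|y ord0 o| <= N y].
Proof.
have [N0 Neq0 NZ NT] := HN.
have Npos y : y != 0 -> 0 < N y.
  by move=> y0; rewrite lt_def N0 andbT; apply: contra y0 => /eqP/Neq0 ->.
pose A := [set y : V | `|y| = 1].
have nz y : A y -> y != 0.
  by rewrite /A /= => Ay; apply/eqP => y0; move: Ay; rewrite y0 normr0 => /eqP; rewrite eq_sym oner_eq0.
have cA : compact A.
  apply: bounded_closed_compact.
    exists 1; split => // M M1 y Ay; apply: le_trans (ltW M1).
    by rewrite le_eqVlt; apply/orP; left; apply/eqP; exact: Ay.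
  apply: (@preimage_closed _ _ (fun y : V => `|y|) [set 1 : R]); last exact: closed_eq.
  by move=> y _; exact: norm_continuous.
pose e : V := 'e_o.
have e1 : e ord0 o = 1 by rewrite mxE !eqxx.
have en0 : e != 0 by apply/eqP => e0; move: e1; rewrite e0 mxE => /eqP; rewrite eq_sym oner_eq0.
pose nrm (y : V) := `|y|^-1 *: y.
have An y : y != 0 -> A (nrm y).
  by move=> y0; rewrite /A /= /nrm normrZ normfV normr_id mulVf// normr_eq0.
(* A maximiser of this ratio on the compact unit sphere of the sup norm attains the dual norm of the
   coordinate; [k] is the inverse of the maximum. *)
pose f (y : V) := y ord0 o / N y.
have fnrm y : y != 0 -> f (nrm y) = f y.
  move=> y0; rewrite /f /nrm mxE NZ normfV normr_id.
  by field; rewrite normr_eq0 y0 (gt_eqF (Npos y y0)).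
have cf : {within A, continuous f}.
  apply: continuous_in_subspaceT => y /set_mem/nz y0.
  have FF := @nbhs_filter (V : topologicalType) y.
  apply: (cvgM (FF := FF)); first exact: coord_continuous.
  by apply: (cvgV (FF := FF)); [rewrite gt_eqF ?Npos|exact: norm_cont].
have [y /set_mem Ay ymax] := EVT_max_rV (ex_intro _ _ (An e en0)) cA cf.
have y0 := nz y Ay; have Ny := Npos y y0.
have fy : 0 < f y.
  apply: lt_le_trans (ymax _ (mem_set (An e en0))); rewrite fnrm// /f e1.
  by rewrite divr_gt0// Npos.
have yo : 0 < y ord0 o.
  by have := fy; rewrite /f pmulr_lgt0// invr_gt0.
exists (N y / y ord0 o), ((y ord0 o)^-1 *: y); split.
- by rewrite divr_gt0.
- by rewrite mxE mulVf// gt_eqF.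
- by rewrite NZ normfV gtr0_norm// mulrC.
have bound (z : V) : N y / y ord0 o * z ord0 o <= N z.
  have [->|z0] := eqVneq z 0; first by rewrite mxE mulr0.
  have := ymax _ (mem_set (An z z0)); rewrite fnrm// /f.
  rewrite ler_pdivrMr ?Npos// mulrAC ler_pdivlMr// => h.
  by rewrite mulrAC ler_pdivrMr// mulrC (mulrC (N z)).
move=> z; have [h|h] := leP 0 (z ord0 o); first by rewrite ger0_norm.
have Nneg : N (- z) = N z by rewrite -scaleN1r NZ normrN1 mul1r.
by rewrite ltr0_norm// -Nneg (le_trans _ (bound _))// mxE.
Qed.

End Sharpness.

(** * Thin cones about an axis *)

Section TruncatedCone.
Variables (R : realType) (m : nat).
Local Notation n := m.+1.
Local Notation V := 'rV[R]_n.
Local Notation o := (@ord0 m).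
Variables (v : V) (e : R).
Hypothesis v1 : v ord0 o = 1.
Hypothesis e0 : 0 < e.
Implicit Types (K S U : set V) (y z : V) (s t w : R).

(** A cone with apex [0], axis [v] and cubical sections of half-width [e] per unit height. The index
    [o] itself gives nonnegative height, since [v ord0 o = 1]. *)
Definition cone : set V := [set y | forall j, `|y ord0 j - y ord0 o * v ord0 j| <= e * y ord0 o].
Definition cone_cap t : set V := cone `&` [set y | y ord0 o <= t].
Definition cone_slab s t : set V := cone `&` [set y | s <= y ord0 o <= t].

Lemma cone_coord_ge0 y : cone y -> 0 <= y ord0 o.
Proof. by move=> /(_ o); rewrite v1 mulr1 subrr normr0 pmulr_rge0. Qed.

Lemma bnd_cone_cap t : bnd (cone_cap t).
Proof.
exists (t * (`|v| + e)) => y [Cy /= yt] j; have y0 := cone_coord_ge0 Cy.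
rewrite -[y ord0 j](subrK (y ord0 o * v ord0 j)) (le_trans (ler_normD _ _))//.
rewrite mulrDr addrC lerD//.
  by rewrite normrM (ger0_norm y0) ler_pM// coord_le_norm.
by apply: le_trans (Cy j) _; rewrite mulrC ler_wpM2r// ltW.
Qed.

Lemma bnd_cone_slab s t : bnd (cone_slab s t).
Proof. by apply: bnd_sub (bnd_cone_cap t) => y [Cy /andP[_ yt]]. Qed.

Lemma vol_cone_cap t : 0 < t -> vol (cone_cap t) = t ^+ n * vol (cone_cap 1).
Proof.
move=> t0; rewrite -(vol_scale 0 t0 (bnd_cone_cap 1)); congr vol.
have ti : 0 < t^-1 by rewrite invr_gt0.
apply/seteqP; split => y [Cy yt]; split => [j|].
- rewrite subr0 !mxE -mulrA -mulrBr normrM gtr0_norm// mulrCA ler_pM2l//; exact: Cy.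
- by rewrite /= subr0 mxE mulrC ler_pdivrMr// mul1r.
- have := Cy j; rewrite subr0 !mxE -mulrA -mulrBr normrM gtr0_norm// mulrCA ler_pM2l//.
- by move: yt; rewrite /= subr0 mxE mulrC ler_pdivrMr// mul1r.
Qed.

Lemma vol_cone_cap1_gt0 : 0 < vol (cone_cap 1).
Proof.
pose d := Num.min (4^-1) (e / 2 / (`|v| + 1)).
have vp : 0 < `|v| + 1 by rewrite ltr_wpDl.
have d0 : 0 < d by rewrite lt_min invr_gt0 ltr0n /= !divr_gt0.
have d1 : d <= 4^-1 by rewrite ge_min lexx.
have d2 : d * (`|v| + 1) <= e / 2 by rewrite -ler_pdivlMr// ge_min lexx orbT.
pose a : V := (3 / 4) *: v - const_mx d; pose b : V := (3 / 4) *: v + const_mx d.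
have ab j : a ord0 j <= b ord0 j by rewrite !mxE lerD2l ge0_cp// ltW.
have sub : open_box a b `<=` cone_cap 1.
  move=> y yab; have yo : 3 / 4 - d < y ord0 o < 3 / 4 + d.
    by have := yab o; rewrite !mxE v1 mulr1.
  have /andP[y1 y2] := yo; split; last by rewrite /=; lra.
  move=> j; have := yab j; rewrite !mxE => /andP[h1 h2].
  have -> : y ord0 j - y ord0 o * v ord0 j =
    (y ord0 j - 3 / 4 * v ord0 j) + (3 / 4 - y ord0 o) * v ord0 j by ring.
  rewrite (le_trans (ler_normD _ _))//.
  have n1 : `|y ord0 j - 3 / 4 * v ord0 j| <= d by rewrite ler_norml; apply/andP; split; lra.
  have n2 : `|(3 / 4 - y ord0 o) * v ord0 j| <= d * `|v|.
    rewrite normrM ler_pM// ?coord_le_norm// ler_norml; apply/andP; split; lra.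
  have n3 : e / 2 <= e * y ord0 o by rewrite ler_pM2l//; lra.
  by move: n1 n2 n3 d2; clear; lra.
apply: lt_le_trans (le_vol sub (bnd_cone_cap 1)).
rewrite -lte_fin -lam_fin; last exact: bnd_sub sub (bnd_cone_cap 1).
apply: lt_le_trans (lam_open_box_ge ab); rewrite lte_fin.
by apply: prodr_gt0 => j _; rewrite !mxE; lra.
Qed.

Lemma below_cone_slab s t : 0 < s -> s <= t -> vol (cone_slab s t) = (t ^+ n - s ^+ n) * vol (cone_cap 1).
Proof.
move=> s0 st; have t0 : 0 < t by apply: lt_le_trans st.
rewrite mulrBl -!vol_cone_cap//.
have -> : cone_slab s t = cone_cap t `&` [set y | s <= y ord0 o <= t].
  apply/seteqP; split => y; first by move=> [Cy /andP[h1 h2]]; split => //; rewrite /= h1.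
  by move=> [[Cy _] h].
rewrite closed_slab//; last exact: bnd_cone_cap.
rewrite /below; congr (_ - _); congr vol; apply/seteqP; split => y.
- by case.
- by move=> h; split => //; case: h.
- by move=> [[Cy _] h]; split.
- by move=> [Cy h]; split => //; split => //; exact: le_trans st.
Qed.

(** Expressed by two-coordinate forms, the slab inherits closedness and measurability from [lf]. *)
Lemma cone_slabE s t : cone_slab s t =
  \bigcap_(j in [set: 'I_n]) ([set y | 0 <= lf j o 1 (- v ord0 j + e) y] `&`
    [set y | 0 <= lf j o (- 1) (v ord0 j + e) y]) `&`
  ([set y | s <= lf o o 1 0 y] `&` [set y | lf o o 1 0 y <= t]).
Proof.
apply/seteqP; split => y.
  move=> [Cy /andP[h1 h2]]; split; last by rewrite /lf /= mul1r mul0r addr0.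
  move=> j _; have := Cy j; rewrite ler_norml /lf /= => /andP[h3 h4]; split; lra.
move=> [H]; rewrite /lf /= mul1r mul0r addr0 => -[h1 h2]; split; last by rewrite /= h1.
move=> j; have [] := H j I; rewrite /lf /= => h3 h4; rewrite ler_norml; apply/andP; split; lra.
Qed.

Lemma ge_lf_meas i j (al be c : R) : lebesgue_measurable [set y : V | c <= lf i j al be y].
Proof.
rewrite (_ : mkset _ = ~` [set y | lf i j al be y < c]); first exact/measC/lt_lf_meas.
by apply/seteqP; split => y /=; rewrite leNgt => /negP.
Qed.

Lemma cone_slab_meas s t : lebesgue_measurable (cone_slab s t).
Proof.
rewrite cone_slabE; apply: measI; last by apply: measI; [exact: ge_lf_meas|exact: le_lf_meas].
rewrite (_ : \bigcap_(j in _) _ = ~` \bigcup_(k : nat) ~` (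
    [set y | 0 <= lf (inord k) o 1 (- v ord0 (inord k) + e) y] `&`
    [set y | 0 <= lf (inord k) o (- 1) (v ord0 (inord k) + e) y])).
  apply: measC; apply: meas_bigcup => k; apply: measC; apply: measI; exact: ge_lf_meas.
apply/seteqP; split => y.
  by move=> H [k _]; apply; exact: H.
move=> H j _; apply: contrapT => h; apply: H; exists (j : nat) => //.
by rewrite inord_val.
Qed.

Lemma cone_slab_convex_body s t : convex_body (cone_slab s t).
Proof.
split.
- rewrite cone_slabE.
  have clo i j (al be c : R) : closed [set y : V | c <= lf i j al be y].
    apply: (@preimage_closed _ _ (lf i j al be : V -> R) [set r | c <= r]); last exact: closed_ge.
    by move=> y _; exact: lf_cont.
  apply: closedI; first by apply: closed_bigI => j _; apply: closedI; exact: clo.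
  apply: closedI; first exact: clo.
  apply: (@preimage_closed _ _ (lf o o 1 0 : V -> R) [set r | r <= t]); last exact: closed_le.
  by move=> y _; exact: lf_cont.
- have [M KM] := bnd_cone_slab s t; exists `|M|; split => // M' MM' y Ky.
  apply: le_trans (ltW MM'); rewrite [leLHS]/Num.norm /= mx_normrE.
  apply/bigmax_leP; split => // -[i j] _ /=; rewrite (ord1 i).
  by rewrite (le_trans (KM y Ky j))// ler_norm.
- move=> y z r [Cy /andP[y1 y2]] [Cz /andP[z1 z2]] /andP[r0 r1]; split.
    move=> j; rewrite !mxE.
    have -> : r * y ord0 j + (1 - r) * z ord0 j - (r * y ord0 o + (1 - r) * z ord0 o) * v ord0 j =
      r * (y ord0 j - y ord0 o * v ord0 j) + (1 - r) * (z ord0 j - z ord0 o * v ord0 j) by ring.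
    have r1' : 0 <= 1 - r by rewrite subr_ge0.
    rewrite (le_trans (ler_normD _ _))// !normrM (ger0_norm r0) (ger0_norm r1').
    have h1 := ler_wpM2l r0 (Cy j); have h2 := ler_wpM2l r1' (Cz j).
    by move: h1 h2; clear; lra.
  by rewrite /= !mxE; apply/andP; split; nra.
Qed.

Lemma bnd_cylinder s t r : bnd [set y : V | s <= y ord0 o <= r /\
  forall j, `|y ord0 j - y ord0 o * v ord0 j| <= t].
Proof.
exists (t + (`|s| + `|r|) * `|v|) => y [/andP[h1 h2] H] j.
rewrite -[y ord0 j](subrK (y ord0 o * v ord0 j)) (le_trans (ler_normD _ _))// lerD//.
rewrite normrM ler_pM// ?coord_le_norm//.
have := ler_norm r; have := ler_norm (- s); rewrite normrN.
by have := normr_ge0 r; have := normr_ge0 s; rewrite ler_norml => *; apply/andP; split; lra.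
Qed.

(* The slab of the cone just below level [t], translated by [r *: v], lies in
   the cylinder of slope [v] above the section at level [t]. *)
Lemma cylinder_ge t r : 0 < r -> r < t ->
  (t ^+ n - (t - r) ^+ n) * vol (cone_cap 1) <=
  vol [set y : V | t < y ord0 o <= t + r /\
    forall j, `|y ord0 j - y ord0 o * v ord0 j| <= e * t].
Proof.
move=> r0 rt; have tr : 0 < t - r by rewrite subr_gt0.
have bC := bnd_cone_cap t.
rewrite mulrBl -!vol_cone_cap ?(lt_trans r0 rt)//.
have -> : vol (cone_cap t) - vol (cone_cap (t - r)) =
    vol (cone_cap t `&` [set y | t - r < y ord0 o <= t]).
  rewrite half_slab//; last by lra.
  rewrite /below; congr (_ - _); congr vol; apply/seteqP; split => y.
  - by move=> h; split => //; case: h.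
  - by case.
  - by move=> [Cy h]; split => //; split => //; apply: le_trans h _; lra.
  - by move=> [[Cy _] h]; split.
rewrite -(vol_shift (r *: v) (bndI _ bC)); apply: le_vol.
  move=> y [[Cy yt] /andP[]]; rewrite !mxE v1 mulr1 => h1 h2; split.
    by apply/andP; split; lra.
  move=> j; have := Cy j; rewrite !mxE v1 mulr1.
  have -> : y ord0 j - r * v ord0 j - (y ord0 o - r) * v ord0 j =
    y ord0 j - y ord0 o * v ord0 j by ring.
  by move=> /le_trans; apply; rewrite ler_pM2l.
apply: bnd_sub (bnd_cylinder t (e * t) (t + r)) => y [/andP[h1 h2] H].
by split => //; rewrite h2 ltW.
Qed.

End TruncatedCone.

(** * Ratio and cutting level of the extremal cone *)

Section SharpConstant.
Variables (R : realType) (m : nat).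
Local Notation n := m.+1.

(** [t] is the level at which the slab from [1] to [t] takes the fraction [x] of the slab from [1]
    to [w]. The last expression is the limiting product of diameter and boundary measure, which
    equals [x * G] at the extremal ratio when this exceeds [1]. *)
Lemma near_extremal_ratio (x eps : R) : 0 < x <= 2^-1 -> 0 < eps -> exists w t : R,
  [/\ 1 < w, 1 < t, t < w, t ^+ n = 1 - x + x * w ^+ n &
    n%:R * t ^+ m * (w - 1) / (w ^+ n - 1) <= x * G n x^-1 + eps].
Proof.
move=> x012 eps0; have /andP[x0 x12] := x012.
have level w : 1 < w -> exists t : R, [/\ 1 < t, t < w & t ^+ n = 1 - x + x * w ^+ n].
  move=> w1; have wn : 1 < w ^+ n by rewrite exprn_egt1.
  have A1 : 1 < 1 - x + x * w ^+ n by nra.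
  have A2 : 1 - x + x * w ^+ n < w ^+ n by nra.
  have [t t0 tE] := @nth_root_ex R m _ (le_trans ler01 (ltW A1)).
  exists t; split => //; rewrite -(@ltr_pXn2r _ n)// ?nnegrE ?(le_trans ler01 (ltW w1))// tE//.
  by rewrite expr1n.
have valE w t : 1 < w -> n%:R * t ^+ m * (w - 1) / (w ^+ n - 1) = n%:R * t ^+ m / geo n w :> R.
  move=> w1; rewrite -geoE.
  have g0 : 0 < geo n w by apply: geo_gt0; lra.
  by field; rewrite !gt_eqF// subr_gt0.
have [w [w1 _ c0 cE]] := G_extremal m x012.
move: w1; rewrite le_eqVlt => /orP[/eqP w1|w1]; last first.
  have [t [t1 tw tE]] := level w w1; exists w, t; split => //.
  have g0 : 0 < geo n w by apply: geo_gt0; lra.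
  rewrite valE//; apply: (@le_trans _ _ (x * G n x^-1)); last by rewrite lerDl ltW.
  rewrite -(@ler_pXn2r _ n)// ?nnegrE ?(ltW c0)//; last first.
    by rewrite divr_ge0 ?(ltW g0)// mulr_ge0// exprn_ge0//; lra.
  rewrite expr_div_n exprMn exprAC tE ler_pdivrMr ?exprn_gt0//.
  by rewrite cE.
have c1 : x * G n x^-1 = 1.
  have geo11 : geo n 1 = n%:R :> R.
    by rewrite /geo; under eq_bigr do rewrite expr1n; rewrite sumr_const card_ord.
  move: cE; rewrite -w1 geo11 expr1n mulr1 subrK expr1n mulr1.
  rewrite -[RHS]mul1r => /(mulIf _); rewrite expf_neq0 ?pnatr_eq0// => /(_ isT) cE.
  apply/eqP; rewrite -(@eqrXn2 _ n)// ?(ltW c0)//.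
  by rewrite cE expr1n.
(* For [w = 1] the extremal shape is a cylinder, which is no slab of a cone; a ratio [u] slightly
   above [1] with [u ^+ n = 1 + eps] approximates it. *)
have e1 : 0 <= 1 + eps by lra.
have [u u0 uE] := @nth_root_ex R m _ e1.
have u1 : 1 < u by rewrite -(@ltr_pXn2r _ n)// ?nnegrE// uE expr1n ltrDl.
have [t [t1 tu tE]] := level u u1; exists u, t; split => //.
rewrite valE// c1.
have gn : n%:R <= geo n u.
  rewrite /geo -[n%:R](_ : \sum_(i < n) (1 : R) = _); last by rewrite sumr_const card_ord.
  by apply: ler_sum => i _; rewrite exprn_ege1// ltW.
have gp : 0 < geo n u by apply: lt_le_trans gn.
rewrite ler_pdivrMr// mulrC; apply: ler_pM => //; first by rewrite exprn_ge0//; lra.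
rewrite -uE; apply: (@le_trans _ _ (u ^+ m)).
  by rewrite lerXn2r ?nnegrE ?ltW//; lra.
by rewrite exprS ler_peMl ?exprn_ge0// ltW.
Qed.

End SharpConstant.

(** * The near-extremal body and set *)

Section SharpExample.
Variables (R : realType) (m : nat).
Local Notation n := m.+1.
Local Notation V := 'rV[R]_n.
Local Notation o := (@ord0 m).
Variable N : V -> R.
Hypothesis HN : is_norm N.
Variables (k : R) (v : V) (e w t : R).
Hypothesis k0 : 0 < k.
Hypothesis v1 : v ord0 o = 1.
Hypothesis Nv : N v = k.
Hypothesis Nge : forall y : V, k * `|y ord0 o| <= N y.
Hypothesis e0 : 0 < e.
Hypothesis t1 : 1 < t.
Hypothesis tw : t < w.

Let K := cone_slab v e 1 w.
Let S := cone_slab v e 1 t.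
Let q := vol (cone_cap v e 1).

Lemma sharp_vol : vol K = (w ^+ n - 1) * q.
Proof. by rewrite /K below_cone_slab// ?expr1n// ltW// (lt_trans t1). Qed.

Lemma sharp_vol_gt0 : 0 < vol K.
Proof.
rewrite sharp_vol mulr_gt0//; last exact: vol_cone_cap1_gt0.
by rewrite subr_gt0 exprn_egt1// (lt_trans t1).
Qed.

Lemma sharp_sub : S `<=` K.
Proof.
by move=> y [Cy /andP[y1 y2]]; split => //; rewrite /= y1 (le_trans y2)// ltW.
Qed.

Lemma sharp_unif : unif K S = (t ^+ n - 1) / (w ^+ n - 1).
Proof.
rewrite (_ : unif K S = vol (S `&` K) / vol K)// setIidl; last exact: sharp_sub.
rewrite sharp_vol /S below_cone_slab// ?expr1n//; last exact: ltW.
have q0 : 0 < q by exact: vol_cone_cap1_gt0.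
have wn : 0 < w ^+ n - 1 by rewrite subr_gt0 exprn_egt1// (lt_trans t1).
by rewrite -/q; field; rewrite !gt_eqF.
Qed.

(** The axis contributes [k * (w - 1)] and the two sections at most [2 * w * e] in each coordinate,
    which vanishes as the cone gets thin. *)
Lemma sharp_diam : diam N K <= k * (w - 1) + 2 * w * e * norm_const N.
Proof.
have [N0 _ NZ NT] := HN.
have w1 : 1 < w := lt_trans t1 tw.
apply: ge_sup.
  have Kv : K v.
    split; last by rewrite /= v1 lexx ltW.
    by move=> j; rewrite v1 mul1r subrr normr0 mulr1 ltW.
  by exists (N (v - v)), v => //; exists v.
move=> _ [y [Cy /andP[y1 y2]] [z [Cz /andP[z1 z2]] ->]].
pose d := y ord0 o - z ord0 o.
have -> : y - z = d *: v + (y - z - d *: v) by rewrite [RHS]addrC subrK.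
rewrite (le_trans (NT _ _))// lerD//.
  rewrite NZ Nv mulrC ler_wpM2l ?(ltW k0)// ler_norml.
  by move: y1 y2 z1 z2; rewrite /d; move=> *; apply/andP; split; lra.
apply: norm_le => // j.
have -> : (y - z - d *: v) ord0 j =
    (y ord0 j - y ord0 o * v ord0 j) - (z ord0 j - z ord0 o * v ord0 j).
  by rewrite !mxE /d; ring.
rewrite (le_trans (ler_normB _ _))//.
have h1 := Cy j; have h2 := Cz j.
have h3 : e * y ord0 o <= e * w by rewrite ler_pM2l.
have h4 : e * z ord0 o <= e * w by rewrite ler_pM2l.
by move: h1 h2 h3 h4; lra.
Qed.

(** Since [v] is norming, moving by [h] in [N] changes the height by at most [h / k], and moving
    along [v] attains this. The neighbourhood thus lies in a slab of the cone and contains a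
    cylinder over the section at level [t]. *)
Lemma sharp_nbhd h : 0 < h -> h / k <= w - t -> h / k < t ->
  n%:R * (t - h / k) ^+ m / (k * (w ^+ n - 1)) <= unif K (nbhd_h N S h `\` S) / h <=
  n%:R * (t + h / k) ^+ m / (k * (w ^+ n - 1)).
Proof.
move=> h0; set r := h / k => rw rt.
have w1 : 1 < w := lt_trans t1 tw.
have t0 : 0 < t := lt_trans ltr01 t1.
have r0 : 0 < r by rewrite divr_gt0.
have hE : h = k * r by rewrite /r mulrC divfK// gt_eqF.
have q0 : 0 < q by exact: vol_cone_cap1_gt0.
have wn : 0 < w ^+ n - 1 by rewrite subr_gt0 exprn_egt1.
have [N0 _ NZ NT] := HN.
set W := (nbhd_h N S h `\` S) `&` K.
have bK : bnd K by exact: bnd_cone_slab.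
have uE : unif K (nbhd_h N S h `\` S) = vol W / ((w ^+ n - 1) * q).
  by rewrite -sharp_vol.
have up : vol W <= ((t + r) ^+ n - t ^+ n) * q.
  rewrite -below_cone_slab//; last by rewrite lerDl ltW.
  apply: le_vol; last exact: bnd_cone_slab.
  move=> y [[[s [Cs /andP[s1 s2]] ys] nSy] [Cy /andP[y1 y2]]]; split => //.
  have yt : t < y ord0 o.
    by rewrite ltNge; apply/negP => yt; apply: nSy; split => //=; rewrite y1.
  rewrite /= (ltW yt) /=.
  have : k * `|(y - s) ord0 o| <= k * r by rewrite -hE; exact: le_trans (Nge _) ys.
  rewrite ler_pM2l// !mxE => h1; have := ler_norm (y ord0 o - s ord0 o).
  by move: h1 s2; lra.
have lo : (t ^+ n - (t - r) ^+ n) * q <= vol W.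
  apply: le_trans (cylinder_ge v1 e0 r0 rt) _; apply: le_vol; last by apply: bnd_sub bK; exact: subIsetr.
  move=> y [/andP[y1 y2] Hy].
  have Cy : cone v e y.
    by move=> j; apply: le_trans (Hy j) _; rewrite ler_pM2l// ltW.
  have Ky : K y.
    split => //; apply/andP; split; first by rewrite ltW// (lt_trans t1).
    by apply: le_trans y2 _; move: rw; lra.
  split => //; split; last by move=> [_ /andP[_]]; rewrite leNgt y1.
  (* Sliding back along [v] reaches the section at level [t], which belongs to [S]. *)
  exists (y - (y ord0 o - t) *: v).
    have so : (y - (y ord0 o - t) *: v) ord0 o = t by rewrite !mxE v1; ring.
    split; last by rewrite /= so lexx ltW.
    move=> j; rewrite so !mxE.
    by rewrite (_ : _ - _ - _ = y ord0 j - y ord0 o * v ord0 j); [exact: Hy|ring].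
  rewrite opprB addrC subrK NZ Nv hE mulrC ler_pM2l// ger0_norm; last by rewrite subr_ge0 ltW.
  by move: y2; lra.
have diffE (a b : R) : b ^+ n - a ^+ n = (b - a) * hom_sum m a b.
  have := affine_primB m a (b - a) 0 1.
  rewrite /affine_prim; case: eqP => [ba|/eqP ba] _.
    have -> : b = a by move/eqP: ba; rewrite subr_eq0 => /eqP.
    by rewrite !subrr mul0r.
  rewrite subrXX; congr (_ * _).
  rewrite /hom_sum (reindex_inj rev_ord_inj) /=; apply: eq_bigr => i _.
  by rewrite subSS subKn 1?mulrC// -ltnS.
have homlo : n%:R * (t - r) ^+ m <= hom_sum m (t - r) t.
  by apply: hom_sum_ge; [rewrite subr_ge0 ltW|exact: lexx|rewrite gerBl ltW].
have homup : hom_sum m t (t + r) <= n%:R * (t + r) ^+ m.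
  rewrite -hom_sum_diag; apply: ler_sum => i _.
  have tr : t <= t + r by rewrite lerDl ltW.
  apply: ler_pM; rewrite ?exprn_ge0 ?(ltW t0)//; first by rewrite (le_trans (ltW t0)).
  by rewrite lerXn2r ?nnegrE ?(ltW t0)// (le_trans (ltW t0)).
have gen : vol W / ((w ^+ n - 1) * q) / h = (vol W / (r * q)) / (k * (w ^+ n - 1)).
  by rewrite hE; field; rewrite !gt_eqF.
have kw : 0 < k * (w ^+ n - 1) by rewrite mulr_gt0.
have kwi : 0 < (k * (w ^+ n - 1))^-1 by rewrite invr_gt0.
have rq : 0 < r * q by rewrite mulr_gt0.
rewrite uE gen !(ler_pM2r kwi); apply/andP; split.
  rewrite ler_pdivlMr//; apply: le_trans lo.
  rewrite diffE mulrA ler_pM2r// mulrC.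
  by rewrite (_ : t - (t - r) = r); [rewrite ler_pM2l|ring].
rewrite ler_pdivrMr//; apply: le_trans up _.
rewrite diffE mulrA ler_pM2r// [leRHS]mulrC.
by rewrite (_ : t + r - t = r); [rewrite ler_pM2l|ring].
Qed.

Lemma sharp_boundary_measure :
  boundary_measure N K S (n%:R * t ^+ m / (k * (w ^+ n - 1))).
Proof.
have t0 : 0 < t := lt_trans ltr01 t1.
pose f (s h : R) := n%:R * (t + s * (h / k)) ^+ m / (k * (w ^+ n - 1)).
have cf s : f s h @[h --> 0^'+] --> n%:R * t ^+ m / (k * (w ^+ n - 1)).
  have -> : n%:R * t ^+ m / (k * (w ^+ n - 1)) = f s 0 by rewrite /f mul0r mulr0 addr0.
  apply: cvg_at_right_filter.
  have cl : continuous (fun h : R => t + s * (h / k)).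
    move=> h; apply: cvgD; first exact: cvg_cst.
    by apply: cvgMl_tmp; apply: cvgMr_tmp; exact: cvg_id.
  have cp : continuous (fun h : R => (t + s * (h / k)) ^+ m).
    elim: m => [|i IH] h; first by under eq_fun do rewrite expr0; exact: cvg_cst.
    by under eq_fun do rewrite exprS; apply: cvgM; [exact: cl|exact: IH].
  by apply: cvgMr_tmp; apply: cvgMl_tmp; exact: cp.
apply: squeeze_cvgr (cf (- 1)) (cf 1); near=> h.
rewrite /f mulN1r mul1r; apply: sharp_nbhd.
- by near: h; exact: nbhs_right_gt.
- rewrite ler_pdivrMr//; near: h; apply: nbhs_right_le.
  by rewrite mulr_gt0// subr_gt0.
- by rewrite ltr_pdivrMr//; near: h; apply: nbhs_right_lt; rewrite mulr_gt0.
Unshelve. all: by end_near. Qed.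

End SharpExample.

Theorem diam_boundary_sharp (R : realType) (m : nat) (N : 'rV[R]_m.+1 -> R) :
  is_norm N -> forall x : R, 0 < x <= 2^-1 -> forall eps : R, 0 < eps ->
   exists (K S : set 'rV[R]_m.+1) (L : R),
     [/\ convex_body K, (0 < lebesgue_outer K)%E & S `<=` K] /\
     [/\ lebesgue_measurable S, unif K S = x & boundary_measure N K S L] /\
     diam N K * L / x < G m.+1 x^-1 + eps.
Proof.
move=> HN x x012 eps eps0; have /andP[x0 x12] := x012.
have [k [v [k0 v1 Nv Nge]]] := norming_vector HN.
(* One half of the error is spent on the ratio of the cone, the other on its thickness [e]. *)
have ex0 : 0 < eps * x / 2 by rewrite divr_gt0// mulr_gt0.
have [w [t [w1 t1 tw tE val]]] := near_extremal_ratio m x012 ex0.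
pose L := m.+1%:R * t ^+ m / (k * (w ^+ m.+1 - 1)).
have wn : 0 < w ^+ m.+1 - 1 by rewrite subr_gt0 exprn_egt1.
have t0 : 0 < t := lt_trans ltr01 t1.
have w0 : 0 < w := lt_trans ltr01 w1.
have L0 : 0 < L by rewrite !divr_gt0 ?mulr_gt0 ?exprn_gt0.
have C0 : 0 <= norm_const N by exact: norm_const_ge0.
pose B := 2 * w * norm_const N * L.
have B0 : 0 <= B := mulr_ge0 (mulr_ge0 (mulr_ge0 (ler0n _ 2) (ltW w0)) C0) (ltW L0).
have B1 : 0 < B + 1 by rewrite ltr_wpDl.
pose e := eps * x / 2 / (B + 1).
have e0 : 0 < e by rewrite divr_gt0.
exists (cone_slab v e 1 w), (cone_slab v e 1 t), L; split; last split.
- split; first exact: cone_slab_convex_body.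
    rewrite lam_fin; last exact: bnd_cone_slab.
    by rewrite lte_fin (sharp_vol_gt0 v1 e0 t1 tw).
  exact: sharp_sub.
- split; first exact: cone_slab_meas.
    rewrite (sharp_unif v1 e0 t1 tw) tE.
    by field; rewrite gt_eqF.
  exact: sharp_boundary_measure.
- rewrite ltr_pdivrMr// mulrDl.
  have := sharp_diam HN k0 v1 Nv e0 t1 tw.
  rewrite -(ler_pM2r L0) => /le_lt_trans; apply.
  have -> : (k * (w - 1) + 2 * w * e * norm_const N) * L =
     m.+1%:R * t ^+ m * (w - 1) / (w ^+ m.+1 - 1) + e * B.
    by rewrite /B mulrDl; congr (_ + _); [rewrite /L; field; rewrite !gt_eqF|ring].
  have eB : e * B < eps * x / 2.
    have h : e * (B + 1) = eps * x / 2 by rewrite /e divfK// gt_eqF.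
    by rewrite -h mulrDr mulr1 ltrDl.
  by rewrite (mulrC (G _ _)); move: val eB; clear; lra.
Qed.

Unset Implicit Arguments.

Theorem theorem4p1 (R : realType) (n : nat) (N : 'rV[R]_n -> R) :
  (0 < n)%N -> is_norm N ->
  (forall (K : set 'rV[R]_n), convex_body K -> (0 < lebesgue_outer K)%E ->
   forall (S : set 'rV[R]_n), S `<=` K -> lebesgue_measurable S ->
   0 < unif K S <= 2^-1 ->
   forall L : R, boundary_measure N K S L ->
   unif K S * G n (unif K S)^-1 <= diam N K * L)
  /\
  (forall x : R, 0 < x <= 2^-1 -> forall eps : R, 0 < eps ->
   exists (K S : set 'rV[R]_n) (L : R),
     [/\ convex_body K, (0 < lebesgue_outer K)%E & S `<=` K] /\
     [/\ lebesgue_measurable S, unif K S = x & boundary_measure N K S L] /\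
     diam N K * L / x < G n x^-1 + eps).
Proof.
case: n N => [//|m] N _ HN; split; last exact: diam_boundary_sharp.
move=> K cK lK S SK mS x012 L HL.
exact (diam_boundary_ge HN cK lK SK mS x012 HL).
Qed.
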